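(* Every unitary $\mathrm{BT}_1$ module $\widetilde{M}=(M,F,V,\lambda,M=M_0\oplus M_1)$ over $k$ decomposes as a direct sum of unitary unicycles, unitary bicycles, Serre unicycles and Serre bicycles. Formally, there is an isomorphism of unitary $\mathrm{BT}_1$ modules $$\widetilde{M} \cong \bigoplus_{w \in W_1} \widetilde{M}(w) \oplus \bigoplus_{w\in W_2} \widetilde{M}(w,w^{\star}) \oplus \bigoplus_{w\in W_3} \widetilde{M}(w,w^{\star}) \oplus \bigoplus_{w \in W_4} \widetilde{M}(w,w^{\star}),$$ where - $W_1$ is a multiset of primitive self-dual words $w=yy^{\star}$ where $y$ has odd length (unitary unicycles); - $W_2$ is a multiset of primitive non-self-dual words of even length (unitary bicycles); - $W_3$ is a multiset of primitive self-dual words $w=yy^{\star}$ where $y$ has even length (Serre unicycles); - $W_4$ is a multiset of words $w=zz$ where $z$ is primitive of odd length (Serre bicycles). The decomposition is unique up to the action of $\tau^2$ on words in $W_1$ and $W_2$, the action of $w \mapsto \tau(w)^{\star}$ on words in $W_2$, the action of $\tau$ on words in $W_3$ and $W_4$, and the action of $w \mapsto w^{\star}$ on words in $W_4$.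
   Context: $k$ is an algebraically closed field of prime characteristic $p>2$. Words. A word is a nonempty finite string $w=u_{\ell-1}\cdots u_0$ in the alphabet $\{\mathtt f,\mathtt v\}$; $\ell(w)=\ell$ is its length. Juxtaposition is concatenation and $z^n$ is the concatenation of $n$ copies of $z$. The rotation operator is $\tau(u_{\ell-1}\cdots u_0)=u_0u_{\ell-1}\cdots u_1$. The dual word $w^\star$ is obtained by exchanging $\mathtt f$ and $\mathtt v$ (also $u^\star$ for a single letter). $w$ is self-dual if $w^\star=\tau^n(w)$ for some $n$; $w$ is primitive if it is not of the form $z^n$ with $n>1$. $\mathrm{BT}_1$ modules. A $\mathrm{BT}_1$ module is a triple $(M,F,V)$ with $M$ a finite-dimensional $k$-vector space, $F:M\to M$ Frobenius-linear (i.e. additive with $F(ax)=a^pF(x)$), $V:M\to M$ inverse-Frobenius-linear, $\ker F=\operatorname{im}V$ and $\ker V=\operatorname{im}F$. For a word $w=u_{\ell-1}\cdots u_0$, $\overline M(w)$ is the $\mathrm{BT}_1$ module with $k$-basis $a_0,\dots,a_{\ell-1}$ (indices mod $\ell$) and: $F(a_j)=a_{j+1}$ if $u_j=\mathtt f$, $F(a_j)=0$ if $u_j=\mathtt v$; $V(a_{j+1})=a_j$ if $u_j=\mathtt v$, $V(a_{j+1})=0$ if $u_j=\mathtt f$. A polarized $\mathrm{BT}_1$ module $(M,F,V,\lambda)$ is a $\mathrm{BT}_1$ module with a symplectic (bilinear, alternating, non-degenerate) pairing $\lambda:M\times M\to k$ with $\lambda(F(x),y)=\lambda(x,V(y))^p$.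 A unitary $\mathrm{BT}_1$ module is a tuple $(M,F,V,\lambda,M=M_0\oplus M_1)$ where $(M,F,V,\lambda)$ is a polarized $\mathrm{BT}_1$ module, $F$ and $V$ exchange $M_0$ and $M_1$ (i.e. map $M_i$ into $M_{1-i}$), and $M_0,M_1$ are Lagrangian for $\lambda$. Isomorphisms are $k$-linear isomorphisms respecting all the structure; direct sums are orthogonal and graded. The modules $\widetilde M(w)$. Let $w=yy^\star$ be primitive with $y$ of odd length $\ell$. $\widetilde M(w)$ has underlying $\mathrm{BT}_1$ module $\overline M(w)$ with basis $a_0,\dots,a_{2\ell-1}$; fix $c\in k^\times$ with $c^{p^\ell}=-c$; set $\lambda(a_i,a_j)=c^{p^i}$ if $j\equiv i+\ell \pmod{2\ell}$ and $0$ otherwise; $M_0=\operatorname{span}\{a_j: j\text{ even}\}$, $M_1=\operatorname{span}\{a_j:j\text{ odd}\}$. Such $\widetilde M(w)$ is called a unitary unicycle. The modules $\widetilde M(w,w^\star)$. Let $w$ have even length. $\widetilde M(w,w^\star)$ has underlying $\mathrm{BT}_1$ module $\overline M(w)\oplus\overline M(w^\star)$, with standard bases $a_0,\dots,a_{\ell-1}$ and $b_0,\dots,b_{\ell-1}$; $\lambda$ is the symplectic form with $\lambda(a_i,b_j)=\delta_{i,j}$, $\lambda(a_i,a_j)=\lambda(b_i,b_j)=0$; $M_0=\operatorname{span}\{a_j: j\text{ even}\}\oplus\operatorname{span}\{b_j: j\text{ odd}\}$ and $M_1=\operatorname{span}\{a_j: j\text{ odd}\}\oplus\operatorname{span}\{b_j: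 j\text{ even}\}$. It is called a unitary bicycle if $w$ is primitive and non-self-dual; a Serre unicycle if $w$ is primitive and self-dual with $4\mid\ell(w)$; a Serre bicycle if $w=zz$ with $z$ primitive of odd length. *)

(* Defs.v *)
From HB Require Import structures.
From mathcomp Require Import all_boot all_order all_algebra.
From Stdlib Require Import Relation_Operators.
From Stdlib Require List.

Set Implicit Arguments.
Unset Strict Implicit.
Unset Printing Implicit Defensive.

Import GRing.Theory.
Local Open Scope ring_scope.

Inductive letter := lf | lv.

Definition letter_to_bool (u : letter) : bool := if u is lf then true else false.
Definition bool_to_letter (b : bool) : letter := if b then lf else lv.

Lemma letter_to_boolK : cancel letter_to_bool bool_to_letter.
Proof. by case. Qed.

HB.instance Definition _ := Equality.copy letter (can_type letter_to_boolK).

(* A word u_{l-1} ... u_0 is stored as it is written, so its head is u_{l-1};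
   nonemptiness is imposed where it matters (see [primitive]). *)
Definition word := seq letter.

Definition letter_at (w : word) (j : nat) : letter := nth lf (rev w) j.

Definition dual_letter (u : letter) : letter := if u is lf then lv else lf.

Definition dual (w : word) : word := map dual_letter w.

(* u_{l-1} ... u_0 |-> u_0 u_{l-1} ... u_1 *)
Definition tau (w : word) : word := rotr 1 w.

Definition power (z : word) (n : nat) : word := flatten (nseq n z).

Definition self_dual (w : word) : Prop := exists n, dual w = iter n tau w.

Definition primitive (w : word) : Prop :=
  w <> [::] /\ forall (z : word) (n : nat), (1 < n)%N -> w <> power z n.

Definition in_W1 (w : word) : Prop :=
  [/\ primitive w, self_dual w & exists2 y : word, w = y ++ dual y & odd (size y)].

Definition in_W2 (w : word) : Prop :=
  [/\ primitive w, ~ self_dual w & ~~ odd (size w)].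

Definition in_W3 (w : word) : Prop :=
  [/\ primitive w, self_dual w & exists2 y : word, w = y ++ dual y & ~~ odd (size y)].

Definition in_W4 (w : word) : Prop :=
  exists z : word, [/\ w = z ++ z, primitive z & odd (size z)].

(* All generators below are bijections of finite order, so the equivalence
   relation they generate is the relation "same orbit". *)
Definition orbit1 : word -> word -> Prop :=
  clos_refl_sym_trans _ (fun w w' => w' = tau (tau w)).

Definition orbit2 : word -> word -> Prop :=
  clos_refl_sym_trans _ (fun w w' => w' = tau (tau w) \/ w' = dual (tau w)).

Definition orbit3 : word -> word -> Prop :=
  clos_refl_sym_trans _ (fun w w' => w' = tau w).

Definition orbit4 : word -> word -> Prop :=
  clos_refl_sym_trans _ (fun w w' => w' = tau w \/ w' = dual w).

(* Sequences stand for multisets: after a reordering of the second one, the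
   entries match one to one up to [R]. *)
Definition mset_eq_up_to (R : word -> word -> Prop) (W W' : seq word) : Prop :=
  exists2 W'' : seq word, perm_eq W' W'' & List.Forall2 R W W''.

Section Modules.

Variables (k : closedFieldType) (p : nat).

Record fv_module := FVModule {
  fv_sort :> vectType k;
  frob : fv_sort -> fv_sort;
  vers : fv_sort -> fv_sort }.

(* V is inverse-Frobenius-linear: V (b x) = b^{1/p} V x, written with b = a^p;
   this loses nothing because k is perfect. *)
Definition is_BT1 (M : fv_module) : Prop :=
  [/\ (forall x y : M, frob (x + y) = frob x + frob y)
      /\ (forall (a : k) (x : M), frob (a *: x) = a ^+ p *: frob x),
      (forall x y : M, vers (x + y) = vers x + vers y)
      /\ (forall (a : k) (x : M), vers (a ^+ p *: x) = a *: vers x),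
      forall x : M, frob x = 0 <-> exists y : M, x = vers y
    & forall x : M, vers x = 0 <-> exists y : M, x = frob y].

(* [grad false] is M_0 and [grad true] is M_1. *)
Record ufv_module := UFVModule {
  ufv_mod :> fv_module;
  pairing : ufv_mod -> ufv_mod -> k;
  grad : bool -> {vspace ufv_mod} }.

Definition symplectic (V : vectType k) (lam : V -> V -> k) : Prop :=
  [/\ (forall y, scalar (lam^~ y)) /\ (forall x, scalar (lam x)),
      forall x, lam x x = 0
    & forall x, (forall y, lam x y = 0) -> x = 0].

Definition is_polarized_BT1 (M : ufv_module) : Prop :=
  [/\ is_BT1 M, symplectic (@pairing M)
    & forall x y : M, pairing (frob x) y = pairing x (vers y) ^+ p].

Definition lagrangian (V : vectType k) (lam : V -> V -> k) (L : {vspace V}) : Prop :=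
  forall x, x \in L <-> forall y, y \in L -> lam x y = 0.

Definition is_unitary_BT1 (M : ufv_module) : Prop :=
  [/\ is_polarized_BT1 M,
      (grad M false + grad M true)%VS = fullv
      /\ (grad M false :&: grad M true)%VS = 0%VS,
      forall (i : bool) (x : M), x \in grad M i ->
        frob x \in grad M (~~ i) /\ vers x \in grad M (~~ i)
    & forall i : bool, lagrangian (@pairing M) (grad M i)].

Definition unitary_iso (M N : ufv_module) : Prop :=
  exists phi : {linear M -> N},
    [/\ bijective phi,
        (forall x, phi (frob x) = frob (phi x))
        /\ (forall x, phi (vers x) = vers (phi x)),
        forall x y, pairing (phi x) (phi y) = pairing x y
      & forall i x, (phi x \in grad N i) = (x \in grad M i)].

Definition fv_sum (M N : fv_module) : fv_module :=
  @FVModule (M * N)%type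
    (fun x => (frob x.1, frob x.2)) (fun x => (vers x.1, vers x.2)).

Definition vspace_prod (U V : vectType k) (A : {vspace U}) (B : {vspace V}) :
    {vspace (U * V)%type} :=
  (linfun (fun x : U * V => x.1) @^-1: A :&: linfun (fun x : U * V => x.2) @^-1: B)%VS.

Definition ufv_sum (M N : ufv_module) : ufv_module :=
  @UFVModule (fv_sum M N)
    (fun x y => pairing x.1 y.1 + pairing x.2 y.2)
    (fun i => vspace_prod (grad M i) (grad N i)).

Definition ufv_zero : ufv_module :=
  @UFVModule (@FVModule 'rV[k]_0 id id) (fun _ _ => 0) (fun=> 0%VS).

(* The p-th root: in characteristic p the polynomial X^p - x has exactly one
   root, and the sequence below lists its roots with multiplicity. *)
Definition proot (x : k) : k :=
  head 0 (sval (closed_field_poly_normal ('X^p - x%:P))).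

Lemma prootK (x : k) : (0 < p)%N -> proot x ^+ p = x.
Proof.
rewrite /proot => p_gt0; case: closed_field_poly_normal => /= r.
have szp : size ('X^p - x%:P) = p.+1 by rewrite size_XnsubC.
rewrite (monicP (monicXnsubC _ p_gt0)) scale1r => Er.
case: r Er => [|y r] Er.
  by move: szp; rewrite Er big_nil size_poly1 => -[p0]; rewrite -p0 in p_gt0.
have /eqP : ('X^p - x%:P).[y] = 0.
  by rewrite Er big_cons hornerM hornerXsubC subrr mul0r.
by rewrite !hornerE subr_eq0 => /eqP.
Qed.

(* The standard basis vector a_j; 'I_l is cyclic through [ordS]. *)
Definition bvec (n : nat) (j : 'I_n) : 'rV[k]_n := delta_mx 0 j.

(* F and V are extended from the basis by semilinearity. *)
Definition Mbar (w : word) : fv_module :=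
  @FVModule 'rV[k]_(size w)
    (fun x => \sum_(j < size w | letter_at w j == lf) x 0 j ^+ p *: bvec (ordS j))
    (fun x => \sum_(j < size w | letter_at w j == lv) proot (x 0 (ordS j)) *: bvec j).

(* Used for w = y y^* with |y| odd, so |w| = 2l; c is the constant with
   c^(p^l) = - c. *)
Definition Mtilde1 (c : k) (w : word) : ufv_module :=
  @UFVModule (Mbar w)
    (fun x y : 'rV[k]_(size w) =>
       \sum_(i < size w)
         \sum_(j < size w | j == (i + (size w)./2)%N %[mod size w])
           c ^+ (p ^ i) * x 0 i * y 0 j)
    (fun b => \sum_(j < size w | odd j == b) <[bvec j]>)%VS.

Definition unicycle_const (c : word -> k) : Prop :=
  forall y : word, primitive (y ++ dual y) -> odd (size y) ->
    c (y ++ dual y) != 0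
    /\ c (y ++ dual y) ^+ (p ^ size y) = - c (y ++ dual y).

(* Alternation forces lambda(b_j, a_i) = - delta_{i,j}. *)
Definition Mtilde2 (w : word) : ufv_module :=
  @UFVModule (fv_sum (Mbar w) (Mbar (dual w)))
    (fun x y : 'rV[k]_(size w) * 'rV[k]_(size (dual w)) =>
       \sum_(i < size w) \sum_(j < size (dual w) | (i == j :> nat))
         (x.1 0 i * y.2 0 j - x.2 0 j * y.1 0 i))
    (fun b => vspace_prod (\sum_(j < size w | odd j == b) <[bvec j]>)
                          (\sum_(j < size (dual w) | odd j == ~~ b) <[bvec j]>))%VS.

Definition cycle_sum (c : word -> k) (W1 W2 W3 W4 : seq word) : ufv_module :=
  ufv_sum (\big[ufv_sum/ufv_zero]_(w <- W1) Mtilde1 (c w) w)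
 (ufv_sum (\big[ufv_sum/ufv_zero]_(w <- W2) Mtilde2 w)
 (ufv_sum (\big[ufv_sum/ufv_zero]_(w <- W3) Mtilde2 w)
          (\big[ufv_sum/ufv_zero]_(w <- W4) Mtilde2 w))).

End Modules.

(* A [unicycle_const] always exists, so quantifying over it is harmless. *)
Lemma unicycle_const_exists (k : closedFieldType) (p : nat) :
  (1 < p)%N -> exists c : word -> k, unicycle_const p c.
Proof.
move=> p_gt1; exists (fun w => proot (p ^ (size w)./2).-1 (- 1)) => y _ y_odd.
rewrite size_cat size_map addnn doubleK; set n := (p ^ size y)%N.
have n_gt1 : (1 < n)%N by rewrite -(exp1n (size y)) ltn_exp2r // odd_gt0.
have n1_gt0 : (0 < n.-1)%N by rewrite -ltnS prednK // ltnW.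
have cn := prootK (- 1 : k) n1_gt0; move: cn; set c := proot _ _ => cn.
split; last by rewrite -(prednK (ltnW n_gt1)) exprS cn mulrN1.
apply/eqP=> c0; move/eqP: cn.
by rewrite c0 expr0n gtn_eqF // eq_sym oppr_eq0 oner_eq0.
Qed.

Definition cycle_multisets (W1 W2 W3 W4 : seq word) : Prop :=
  [/\ {in W1, forall w, in_W1 w}, {in W2, forall w, in_W2 w},
      {in W3, forall w, in_W3 w} & {in W4, forall w, in_W4 w}].

(* Main.v *)
(* Both F and the inverse of V move along the letters of a word, so consider
   sequences a_0, a_1, ... of homogeneous vectors with a_(i+1) = F a_i or
   a_i = V a_(i+1) according to the i-th letter ("chains"). If a is a chain along
   u and b one along the dual word, then lambda(a_(i+1), b_(i+1)) is the p-th power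
   of lambda(a_i, b_i).

   Existence. For words w of a given length the intervals from w(0) to w(M_0) form
   a chain of subspaces of M, so at most dim M of them are nontrivial, and a
   pigeonhole argument gives an even word w for which no power w^N has
   w^N(M_0) = w^N(0). The composite relation R along w is p^|w|-linear, and, by
   solving one polynomial equation at a time, the vectors x with x R x span
   R^N(M_0) modulo R^N(0): there are closed chains a along w, and dually closed
   chains b along the dual word, with lambda(a_0, b_0) <> 0 (when w is self-dual by
   an odd shift, b can be replaced by a shift of a). The Gram matrix of the
   resulting frame is unitriangular up to the standard form for the lexicographic
   order, and an odd-order argument in characteristic p > 2 (x^(p^t) = 1 for
   unipotent x, so x has a square root which is a power of x) makes it standard.
   The frame spans a copy of one of the four kinds of modules, whose orthogonal
   complement is again a unitary BT1 module.

   Uniqueness. The rank of the pairing between starting vectors of chains along an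
   infinite word and along its dual is additive, and for the standard modules it
   counts the basis vectors of degree 0 at which this word is read off. *)
Require Import Defs.
From HB Require Import structures.
From mathcomp Require Import all_boot all_order all_algebra zify ring.
From Stdlib Require Import Classical IndefiniteDescription Relation_Operators.

Set Implicit Arguments.
Unset Strict Implicit.
Unset Printing Implicit Defensive.

Import GRing.Theory.
Local Open Scope ring_scope.

(** Inverting V makes the action of a word a relation rather than a map, so images and fixed vectors
    are studied for additive semilinear relations. Every word followed around a cycle has even
    length, because only then does a closed chain return to its degree. The word found is therefore
    only known not to be a power of a shorter even word: an odd root z may survive as w = zz, which
    is the source of the Serre bicycles, while an odd antiperiod is the source of the unicycles. The
    square root that straightens a frame is taken as a power of one self-adjoint endomorphism
    commuting with F and V and preserving the grading, so that chains remain chains; the exponent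
    (p^t - 1) / 2 is an integer because p is odd. In the uniqueness part, a vector starting a chain
    along a word may have components at positions where another word is read. Pairing with the
    starting vectors for the dual word removes them: the lexicographic inequalities obtained for the
    word and for its dual leave only equality. *)

Lemma linfunE_of_linear (K : fieldType) (U V : vectType K) (f : U -> V) :
  linear f -> linfun f =1 f.
Proof.
move=> lin_f x; pose g : {linear U -> V} := HB.pack f (GRing.isLinear.Build _ _ _ _ f lin_f).
by rewrite -[f]/(g : U -> V) lfunE.
Qed.

(** * Subspaces given by predicates, and symplectic forms *)

Definition subspace (K : fieldType) (V : vectType K) (S : V -> Prop) :=
  S 0 /\ forall a x y, S x -> S y -> S (a *: x + y).

Lemma bounded_stationary (f : nat -> nat) D : (forall n, (f n <= D)%N) ->
  (forall n, (f n <= f n.+1)%N) -> exists2 n, (n <= D)%N & f n = f n.+1.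
Proof.
move=> fD f_le; apply: NNPP => nex.
suff lt n : (n <= D.+1)%N -> (n <= f n)%N.
  by have := leq_trans (lt _ (leqnn _)) (fD _); rewrite ltnn.
elim: n => // n IHn le_n; apply: leq_ltn_trans (IHn (ltnW le_n)) _.
by rewrite ltn_neqAle f_le andbT; apply/eqP => e; apply: nex; exists n.
Qed.

Section Subspaces.

Variables (K : fieldType) (V : vectType K).
Implicit Types (S : V -> Prop) (U : {vspace V}).

Lemma subspaceD S x y : subspace S -> S x -> S y -> S (x + y).
Proof. by move=> [_ SD] Sx Sy; rewrite -[x]scale1r; apply: SD. Qed.

Lemma subspaceZ S a x : subspace S -> S x -> S (a *: x).
Proof. by move=> [S0 SD] Sx; rewrite -[_ *: x]addr0; apply: SD. Qed.

Lemma subspaceN S x : subspace S -> S x -> S (- x).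
Proof. by move=> SS Sx; rewrite -scaleN1r; apply: subspaceZ. Qed.

Lemma subspace_sum S (I : Type) (r : seq I) (P : pred I) (F : I -> V) :
  subspace S -> (forall i, P i -> S (F i)) -> S (\sum_(i <- r | P i) F i).
Proof.
by move=> SS SF; apply: big_ind => //; [case: SS | move=> *; apply: subspaceD].
Qed.

(** Images under relations are described by existential statements, hence by predicates. A vspace
    inside [S] is enlarged by vectors of [S] outside it (excluded middle); its codimension bounds
    the number of steps. *)
Lemma subspace_vspace S : subspace S -> exists U, forall x, x \in U <-> S x.
Proof.
move=> SS.
have [n] := ubnP (\dim {:V} - \dim (0%VS : {vspace V})).
have : forall x, x \in (0%VS : {vspace V}) -> S x.
  by move=> x; rewrite memv0 => /eqP ->; case: SS.
elim: n (0%VS) => // n IHn U US; rewrite ltnS => leUn.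
have [SU | nSU] := classic (forall x, S x -> x \in U).
  by exists U => x; split; [apply: US | apply: SU].
have [x nSx] := not_all_ex_not _ _ nSU.
have [Sx /negP xU] := imply_to_and _ _ nSx.
apply: (IHn (U + <[x]>)%VS).
  move=> _ /memv_addP [u uU [_ /vlineP [a ->] ->]].
  by apply: subspaceD => //; [apply: US | apply: subspaceZ].
have ltU : (\dim U < \dim (U + <[x]>))%N.
  rewrite (ltn_leqif (dimv_leqif_sup (addvSl _ _))).
  by apply: contra xU => /subvP; apply; rewrite memvE addvSr.
have := dimvS (subvf (U + <[x]>)); lia.
Qed.

(** In a linear relation take an index [j] of least [r] among the nonzero coefficients: all other
    terms lie in [S j], hence so would [y j]. *)
Lemma graded_independent (I : finType) (y : I -> V) (r : I -> nat) (S : I -> V -> Prop) :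
    (forall i, subspace (S i)) -> (forall i, ~ S i (y i)) ->
    (forall i j, j != i -> (r i <= r j)%N -> S i (y j)) ->
  forall c : I -> K, \sum_i c i *: y i = 0 -> forall i, c i = 0.
Proof.
move=> SS Sny Sy c c0 i; apply/eqP/negPn/negP => ci.
case: (@arg_minnP _ i (fun i => c i != 0) r ci) => j cj rj.
apply: (Sny j); rewrite -(scalerK cj (y j)); apply: subspaceZ => //.
move: c0; rewrite (bigD1 j) //= => /eqP; rewrite addr_eq0 => /eqP ->.
apply: subspaceN => //; apply: subspace_sum => // l lj.
have [-> | cl] := eqVneq (c l) 0; first by rewrite scale0r; case: (SS j).
by apply: subspaceZ => //; apply: Sy lj _; apply: rj.
Qed.

Lemma independent_leq_dim m (y : 'I_m -> V) :
    (forall c : 'I_m -> K, \sum_i c i *: y i = 0 -> forall i, c i = 0) ->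
  (m <= \dim {:V})%N.
Proof.
move=> indy; have : free [tuple y i | i < m].
  apply/freeP => c c0; apply: indy; rewrite -[RHS]c0.
  by apply: eq_bigr => i _; rewrite -tnth_nth tnth_mktuple.
by rewrite /free size_tuple => /eqP <-; rewrite dimvS // subvf.
Qed.

End Subspaces.

Section Forms.

Variables (K : closedFieldType) (V : vectType K) (lam : V -> V -> K).
Hypothesis symp : symplectic lam.

Lemma formDl y : {morph lam^~ y : x1 x2 / x1 + x2}.
Proof. by case: symp => [[lin _] _ _] x1 x2; rewrite -[x1]scale1r lin mul1r !scale1r. Qed.

Lemma formDr x : {morph lam x : x1 x2 / x1 + x2}.
Proof. by case: symp => [[_ lin] _ _] x1 x2; rewrite -[x1]scale1r lin mul1r !scale1r. Qed.

Lemma form0l y : lam 0 y = 0.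
Proof. by apply: (addrI (lam 0 y)); rewrite -formDl !addr0. Qed.

Lemma form0r x : lam x 0 = 0.
Proof. by apply: (addrI (lam x 0)); rewrite -formDr !addr0. Qed.

Lemma formZl a x y : lam (a *: x) y = a * lam x y.
Proof. by case: symp => [[lin _] _ _]; rewrite -[a *: x]addr0 lin form0l addr0. Qed.

Lemma formZr a x y : lam x (a *: y) = a * lam x y.
Proof. by case: symp => [[_ lin] _ _]; rewrite -[a *: y]addr0 lin form0r addr0. Qed.

Lemma formNl x y : lam (- x) y = - lam x y.
Proof. by rewrite -scaleN1r formZl mulN1r. Qed.

Lemma formNr x y : lam x (- y) = - lam x y.
Proof. by rewrite -scaleN1r formZr mulN1r. Qed.

Lemma form_suml (I : Type) (r : seq I) (P : pred I) (F : I -> V) y :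
  lam (\sum_(i <- r | P i) F i) y = \sum_(i <- r | P i) lam (F i) y.
Proof. by apply: (big_morph (lam^~ y) (formDl y)); rewrite form0l. Qed.

Lemma form_sumr (I : Type) (r : seq I) (P : pred I) (F : I -> V) x :
  lam x (\sum_(i <- r | P i) F i) = \sum_(i <- r | P i) lam x (F i).
Proof. by apply: (big_morph (lam x) (formDr x)); rewrite form0r. Qed.

Lemma formC x y : lam x y = - lam y x.
Proof.
case: symp => _ alt _; apply/eqP; rewrite -addr_eq0; apply/eqP.
by have := alt (x + y); rewrite formDl !formDr !alt addr0 add0r addrC.
Qed.

Lemma form_perp_subspace y : subspace (fun x => lam x y = 0).
Proof.
by split=> [|a x z xy zy]; rewrite ?form0l // formDl formZl xy zy mulr0 addr0.
Qed.

(** Nondegeneracy makes [y |-> lam _ y] injective into the dual space, which has the same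
    dimension. *)
Lemma form_repr (f : V -> K) : scalar f -> exists y, forall x, f x = lam x y.
Proof.
move=> lin_f; pose L y := linfun (lam^~ y : V -> K^o).
have LE y x : L y x = lam x y.
  rewrite linfunE_of_linear // => a u v; case: symp => -[lin _] _ _.
  exact: lin.
have linL : linear L.
  move=> a u v; apply/lfunP => x.
  by rewrite add_lfunE scale_lfunE !LE formDr formZr.
have kerL : lker (linfun L) == 0%VS.
  rewrite -subv0; apply/subvP => y; rewrite memv_ker linfunE_of_linear // => /eqP Ly.
  rewrite memv0; apply/eqP; case: symp => _ _; apply => x.
  by rewrite formC -LE Ly zero_lfunE oppr0.
have imL : limg (linfun L) = fullv.
  apply/eqP; rewrite eqEdim subvf /=.
  have := limg_ker_dim (linfun L) fullv.
  rewrite (eqP kerL) capv0 dimv0 add0n => ->.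
  by rewrite !dimvf /dim /= muln1.
have /memv_imgP [y _ Ly] : linfun (f : V -> K^o) \in limg (linfun L).
  by rewrite imL memvf.
exists y => x; rewrite -LE; move: Ly; rewrite linfunE_of_linear // => <-.
by rewrite linfunE_of_linear // => a u v; apply: lin_f.
Qed.

(** The coordinates of [z - projv U z] are functionals that kill [U]; one of them is nonzero at [x],
    and [form_repr] turns it into a pairing. *)
Lemma form_separation (U : {vspace V}) x :
  x \notin U -> exists2 y, forall u, u \in U -> lam u y = 0 & lam x y != 0.
Proof.
move=> xU; pose d z := z - projv U z.
have [j dj] : exists j, coord (vbasis {:V}) j (d x) != 0.
  apply/existsP; rewrite -negb_forall; apply: contra xU => /forallP d0.
  have /subr0_eq -> : d x = 0; last exact: memv_proj.
  rewrite (coord_vbasis (memvf (d x))) big1 // => j _.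
  by rewrite (eqP (d0 j)) scale0r.
have [|y yE] := @form_repr (fun z => coord (vbasis {:V}) j (d z)).
  move=> a u v; rewrite /d linearP /= opprD addrACA -scalerBr.
  by rewrite linearP.
exists y => [u uU|]; last by rewrite -yE.
by rewrite -yE /d projv_id // subrr linear0.
Qed.

End Forms.

(** * Fixed vectors of semilinear relations *)

(* If y_n = sum_(j < n) c_j y_j and y_(j+1) is related to y_j for all j, then
   sum_j (a_j)^q y_j is a fixed vector as soon as (a_j)^q = a_(j-1) + c_j t, with
   t = a_(n-1) and a_(-1) = 0. Solving downwards from t = 'X gives the
   polynomials below, with d_j = c_(n-1-j); the last equation is a root condition. *)
Section AdditivePolynomial.

Variables (K : closedFieldType) (q : nat) (d : nat -> K).

Fixpoint twisted_poly (i : nat) : {poly K} :=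
  if i is j.+1 then twisted_poly j ^+ q - d j *: 'X else 'X.

Hypothesis q_gt1 : (1 < q)%N.

Lemma size_twisted_poly i : (1 < size (twisted_poly i))%N.
Proof.
elim: i => [|i IHi] /=; first by rewrite size_polyX.
have sz : (2 < size (twisted_poly i ^+ q)%R)%N.
  suff : (2 <= (size (twisted_poly i ^+ q)%R).-1)%N by case: size => [|[|[|]]].
  rewrite size_exp; apply: leq_trans q_gt1 _.
  by rewrite leq_pmull // -ltnS prednK // ltnW.
rewrite size_polyDl; first exact: ltnW.
by rewrite size_polyN (leq_ltn_trans (size_scale_leq _ _)) // size_polyX.
Qed.

(** The polynomial is [h * 'X] with [h] nonconstant of constant term [- d n], so a root of [h]
    cannot be zero. *)
Lemma twisted_poly_root n :
  d n != 0 -> exists2 t, t != 0 & (twisted_poly n.+1).[t] = 0.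
Proof.
move=> dn; have XqE : 'X ^+ q.-1 * 'X = 'X ^+ q :> {poly K}.
  by rewrite -exprSr prednK // ltnW.
have [g gE] : exists g, twisted_poly n = g * 'X.
  elim: n {dn} => [|n [g gE]] /=; first by exists 1; rewrite mul1r.
  exists (g ^+ q * 'X ^+ q.-1 - (d n)%:P).
  by rewrite mulrBl -mulrA XqE mul_polyC gE exprMn.
have g0 : g != 0.
  by apply/eqP => g0; have := size_twisted_poly n; rewrite gE g0 mul0r size_poly0.
pose h := g ^+ q * 'X ^+ q.-1 - (d n)%:P.
have hE : twisted_poly n.+1 = h * 'X.
  by rewrite /= mulrBl -mulrA XqE mul_polyC gE exprMn.
have : size h != 1.
  have sz : (1 < size (g ^+ q * 'X ^+ q.-1)%R)%N.
    rewrite size_Mmonic ?monicXn ?expf_neq0 // size_polyXn addnS /=.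
    have : (0 < size (g ^+ q)%R)%N by rewrite size_poly_gt0 expf_neq0.
    by move=> sz; apply: (@leq_trans (1 + q.-1)); [lia | rewrite leq_add2r].
  by rewrite size_polyDl ?gtn_eqF // size_polyN (leq_ltn_trans (size_polyC_leq1 _)).
case/closed_rootP => t /eqP ht; exists t; last by rewrite hE hornerM ht mul0r.
apply: contraNneq dn => t0; move: ht; rewrite t0 /h !hornerE.
by rewrite expr0n -subn1 subn_eq0 leqNgt q_gt1 mulr0 sub0r => /eqP; rewrite oppr_eq0.
Qed.

End AdditivePolynomial.

Section SemilinearRelations.

Variables (K : closedFieldType) (V : vectType K) (q : nat) (R : V -> V -> Prop).
Hypotheses (q_gt1 : (1 < q)%N) (q_pchar : [pchar K].-nat q).
Hypothesis R0 : R 0 0.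
Hypothesis RD : forall x y x' y', R x y -> R x' y' -> R (x + x') (y + y').
Hypothesis RZ : forall a x y, R x y -> R (a *: x) (a ^+ q *: y).

Fixpoint iter_rel (n : nat) (x y : V) : Prop :=
  if n is m.+1 then exists2 z, iter_rel m x z & R z y else x = y.

(** As [R] is multivalued, its powers can move 0; fixed vectors are determined only modulo this
    increasing union. *)
Definition reach0 (y : V) : Prop := exists n, iter_rel n 0 y.

Lemma iter_relS0 n y : iter_rel n 0 y -> iter_rel n.+1 0 y.
Proof.
elim: n y => [_ <-|n IHn y [z /IHn zn Rzy]]; first by exists 0.
by exists z.
Qed.

Lemma iter_rel0_leq n m y : (n <= m)%N -> iter_rel n 0 y -> iter_rel m 0 y.
Proof.
by move=> /subnK <-; elim: (m - n)%N => // i IHi /IHi; apply: iter_relS0.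
Qed.

Lemma RB x y x' y' : R x y -> R x' y' -> R (x - x') (y - y').
Proof.
move=> Rxy /(RZ (-1)); rewrite exprNn_pchar // expr1n !scaleN1r.
exact: RD.
Qed.

Lemma iter_relD n x y x' y' :
  iter_rel n x y -> iter_rel n x' y' -> iter_rel n (x + x') (y + y').
Proof.
elim: n y y' => [|n IHn] y y' /=; first by move=> -> ->.
by move=> [z xz zy] [z' xz' zy']; exists (z + z'); [apply: IHn | apply: RD].
Qed.

Lemma iter_relZ n a x y :
  iter_rel n x y -> iter_rel n (a *: x) (a ^+ (q ^ n) *: y).
Proof.
elim: n y => [|n IHn] y /=; first by move=> ->; rewrite expr1.
move=> [z /IHn az Rzy]; exists (a ^+ (q ^ n) *: z) => //.
by rewrite expnSr exprM; apply: RZ.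
Qed.

Lemma expr_surj n (a : K) : (0 < n)%N -> exists b, b ^+ n = a.
Proof. by move=> n_gt0; exists (proot n a); apply: prootK. Qed.

(** To scale the end of a path of length [n] by [a], its start is scaled by a root of order [q ^ n]
    of [a]. Paths from 0 are brought to a common length by prepending zeros. *)
Lemma reach0_subspace : subspace reach0.
Proof.
split=> [|a x y [n nx] [m my]]; first by exists 0.
exists (maxn n m); rewrite -[0]addr0; apply: iter_relD; last first.
  exact: iter_rel0_leq (leq_maxr n m) my.
apply: iter_rel0_leq (leq_maxl n m) _; rewrite -[0](scaler0 _ (proot (q ^ n) a)).
rewrite -[in a *: x](@prootK _ (q ^ n) a) ?expn_gt0 ?(ltnW q_gt1) //.
exact: iter_relZ.
Qed.

Lemma iter_image_subspace S n :
  subspace S -> subspace (fun y => exists2 x, S x & iter_rel n x y).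
Proof.
move=> [S0 SD]; split.
  by exists 0 => //; elim: n => //= n IHn; exists 0.
move=> a x y [x' Sx' xn] [y' Sy' yn].
exists (proot (q ^ n) a *: x' + y'); first exact: SD.
apply: iter_relD => //; have qn_gt0 : (0 < q ^ n)%N by rewrite expn_gt0 ltnW.
by rewrite -[in a *: x](prootK a qn_gt0); apply: iter_relZ.
Qed.

Lemma iter_rel_front n x y :
  iter_rel n.+1 x y <-> exists2 z, R x z & iter_rel n z y.
Proof.
elim: n y => [|n IHn] y; first by split=> [[z /= -> Rzy] | [z Rxz /= <-]]; [exists y | exists x].
split=> [[z /IHn [t Rxt tz] Rzy] | [t Rxt [z tz Rzy]]].
  by exists t => //; exists z.
by exists z => //; apply/IHn; exists t.
Qed.

(** The subspaces R^n(0) increase, and once two consecutive ones agree all later ones do; this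
    happens within [\dim {:V}] steps. *)
Lemma reach0_dim y : reach0 y -> iter_rel (\dim {:V}) 0 y.
Proof.
have sub0 : subspace (fun x : V => x = 0).
  by split=> // a x z -> ->; rewrite scaler0 addr0.
have ex_U n : exists U : {vspace V}, forall x, x \in U <-> iter_rel n 0 x.
  have [U UE] := subspace_vspace (iter_image_subspace n sub0); exists U => x.
  by rewrite UE; split=> [[_ ->] | nx] //; exists 0.
have [U UE] := functional_choice _ ex_U.
have sU n : (U n <= U n.+1)%VS by apply/subvP => x /UE xn; apply/UE/iter_relS0.
have eqU n : U n = U n.+1 -> forall m, (n <= m)%N -> U m = U n.
  move=> eqn m /subnK <-; elim: (m - n)%N => // i IHi.
  apply/vspaceP => x; rewrite addSn; apply/idP/idP => [/UE [z zn Rzx] | /UE zn].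
    by rewrite eqn; apply/UE; exists z => //; apply/UE; rewrite -IHi; apply/UE.
  by apply/UE/iter_relS0/UE; rewrite IHi; apply/UE.
have [|n|n le_n /eqP eqn] := @bounded_stationary (fun n => \dim (U n)) (\dim {:V}).
- by move=> n; apply/dimvS/subvf.
- exact: dimvS.
have {eqn} eqn : U n = U n.+1 by apply/eqP; rewrite eqEdim sU (eqP eqn) leqnn.
case=> m ym; have [le_m | /ltnW le_m] := leqP m (\dim {:V}).
  exact: iter_rel0_leq ym.
apply/UE; rewrite (eqU n) // -(eqU n eqn m) ?(leq_trans le_n) //.
exact/UE.
Qed.

Section Image.

Variable S : V -> Prop.
Hypotheses (S_sub : subspace S) (S_fwd : forall x y, R x y -> S y).

Definition iter_image (n : nat) (y : V) : Prop := exists2 x, S x & iter_rel n x y.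

Lemma iter_imageS n y : iter_image n.+1 y -> iter_image n y.
Proof. by case=> x Sx /iter_rel_front [z /S_fwd Sz zy]; exists z. Qed.

(** The decreasing images of [S] are stable from the dimension of [V] on, so the stable one is its
    own image under [R]. *)
Lemma iter_image_back y :
  iter_image (\dim {:V}) y -> exists2 x, iter_image (\dim {:V}) x & R x y.
Proof.
have ex_U n : exists U : {vspace V}, forall x, x \in U <-> iter_image n x.
  exact: subspace_vspace (iter_image_subspace n S_sub).
have [U UE] := functional_choice _ ex_U.
have sU n : (U n.+1 <= U n)%VS.
  by apply/subvP => x /UE xn; apply/UE/iter_imageS.
have eqU n : U n = U n.+1 -> U n.+1 = U n.+2.
  move=> eqn; apply/vspaceP => x.
  apply/idP/idP => [/UE [z Sz [t zt Rtx]] | ]; last exact/subvP/sU.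
  have : t \in U n.+1 by rewrite -eqn; apply/UE; exists z.
  by case/UE => z' Sz' z't; apply/UE; exists z' => //; exists t.
suff eqn : U (\dim {:V}) = U (\dim {:V}).+1.
  move=> /UE; rewrite eqn => /UE [x Sx [z xz Rzy]].
  by exists z => //; exists x.
have [|n|n le_n eqn] := @bounded_stationary (fun n => \dim {:V} - \dim (U n))%N (\dim {:V}).
- by move=> n; apply: leq_subr.
- by apply/leq_sub2l/dimvS.
have {}eqn : U n = U n.+1.
  apply/eqP; rewrite eq_sym eqEdim sU /=; have := dimvS (subvf (U n)).
  by have := dimvS (subvf (U n.+1)); move: eqn; clear; lia.
by move: le_n => /subnK <-; elim: (_ - n)%N => // i /eqU.
Qed.

End Image.

Lemma reach0_fwd x y : reach0 x -> R x y -> reach0 y.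
Proof. by move=> [n nx] xy; exists n.+1, x. Qed.

(* The witness is the sum of the entries of a chain leading from 0 to b. *)
Lemma reach0_translate b : reach0 b -> exists2 t, reach0 t & R t (t + b).
Proof.
case=> n; elim: n b => [_ <-|n IHn b [z nz Rzb]].
  by exists 0; [exists 0 | rewrite addr0].
have [t Bt Rt] := IHn z nz; exists (t + z); last by apply: RD.
by apply: (subspaceD reach0_subspace) => //; exists n.
Qed.

Variable A : V -> Prop.
Hypothesis A_sub : subspace A.
Hypothesis A_back : forall y, A y -> exists2 x, A x & R x y.
Hypothesis reach0_A : forall y, reach0 y -> A y.

Definition fixed_in (s : seq V) := forall x, x \in s -> A x /\ R x x.

Lemma fixed_span_rel s v : fixed_in s -> v \in <<s>>%VS ->
  A v /\ exists2 g, g \in <<s>>%VS & R v g.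
Proof.
move=> fs vs; rewrite (coord_span (X := in_tuple s) vs); split.
  apply: subspace_sum => // i _; apply: subspaceZ => //.
  by have [] := fs (in_tuple s)`_i (mem_nth _ (ltn_ord i)).
exists (\sum_i coord (in_tuple s) i v ^+ q *: (in_tuple s)`_i).
  by apply: rpred_sum => i _; apply/rpredZ/memv_span/mem_nth.
apply: (big_ind2 R) => // i _; apply: RZ.
by have [] := fs (in_tuple s)`_i (mem_nth _ (ltn_ord i)).
Qed.

(** On each coordinate this is the Artin-Schreier type equation f^q = f + c, which has a root
    because K is algebraically closed. *)
Lemma fixed_span_shift s v : fixed_in s -> v \in <<s>>%VS ->
  exists f, f + v \in <<s>>%VS /\ R f (f + v).
Proof.
move=> fs vs; rewrite [v](coord_span (X := in_tuple s) vs).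
have ex_f i : exists f : K, f ^+ q = f + coord (in_tuple s) i v.
  set c := coord _ i v; have szp : size ('X^q - 'X - c%:P) != 1.
    rewrite -addrA -opprD size_polyDl size_polyXn.
      by rewrite eqSS gtn_eqF // ltnW.
    by rewrite size_polyN size_XaddC ltnS.
  have /closed_rootP [f /eqP fr] := szp.
  by exists f; move/eqP: fr; rewrite !hornerE -addrA -opprD subr_eq0 => /eqP.
have [f fE] := functional_choice _ ex_f.
exists (\sum_i f i *: (in_tuple s)`_i); rewrite -big_split /=.
under eq_bigr do rewrite -scalerDl -fE; split.
  by apply: rpred_sum => i _; apply/rpredZ/memv_span/mem_nth.
apply: (big_ind2 R) => // i _; apply: RZ.
by have [] := fs (in_tuple s)`_i (mem_nth _ (ltn_ord i)).
Qed.

(** [y] is followed backwards along [R] until the predecessors become dependent modulo [W]. A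
    combination of them is then fixed up to an error in [W], and this error is absorbed by vectors
    of [W]. *)
Lemma exists_fixed (B : {vspace V}) s y :
    (forall x, x \in B <-> reach0 x) -> fixed_in s ->
    A y -> y \notin (<<s>> + B)%VS ->
  exists z, [/\ A z, R z z & z \notin (<<s>> + B)%VS].
Proof.
move=> BE fs Ay yW; set W := (_ + _)%VS in yW *.
have prevA x : exists x', A x -> A x' /\ R x' x.
  have [/A_back [x' Ax' Rx'] | nAx] := classic (A x); first by exists x'.
  by exists 0.
have {prevA} [pr prE] := functional_choice _ prevA.
have {prE} [u [u0 Au Ru]] : exists u : nat -> V,
    [/\ u 0%N = y, forall i, A (u i) & forall i, R (u i.+1) (u i)].
  have Au i : A (iter i pr y) by elim: i => //= i /prE [].
  by exists (fun i => iter i pr y); split=> // i; have [] := prE _ (Au i).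
pose E n := (W + \sum_(j < n) <[u j]>)%VS.
have ES n : E n.+1 = (E n + <[u n]>)%VS by rewrite /E big_ord_recr /= addvA.
have [n] : exists n, u n \in E n.
  apply: NNPP => nE; suff /(_ (dim V).+1) : forall n, (n <= \dim (E n))%N.
    by move/leq_trans/(_ (dimvS (subvf _))); rewrite dimvf ltnn.
  elim=> // n IHn; apply: leq_ltn_trans IHn _; rewrite ES.
  rewrite (ltn_leqif (dimv_leqif_sup (addvSl _ _))).
  apply/negP => /subvP sE; apply: nE; exists n; apply: sE.
  by rewrite memvE addvSr.
move=> un0; have ex_n : exists n, u n \in E n by exists n.
case: (ex_minnP ex_n) => {un0 ex_n}-[|{}n] un nmin.
  by move: un; rewrite /E big_ord0 addv0 u0 (negbTE yW).
have unE : u n \notin E n by apply/negP => /nmin; rewrite ltnn.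
case/memv_addP: un => w wW [v /memv_sumP [v_ v_u vE] unE1].
have ex_c (i : 'I_n.+1) : exists c, v_ i = c *: u i.
  by have /vlineP := v_u i isT.
have {ex_c} [c cE] := functional_choice _ ex_c.
have {v v_ v_u vE cE} unE1 : u n.+1 = w + \sum_(i < n.+1) c i *: u i.
  by rewrite unE1 vE; congr (_ + _); apply: eq_bigr => i _; rewrite cE.
(* If this coefficient vanished, applying [R] to the relation would lower all indices by one and put
   [u n] in [E n], against the minimality of [n]. *)
have c0 : c ord0 != 0.
  apply: contraNneq unE => c0; move: unE1; rewrite big_ord_recl c0 scale0r add0r.
  move=> {}unE1; pose v := \sum_(i < n) c (lift ord0 i) ^+ q *: u i.
  have Rw : R w (u n - v).
    have -> : w = u n.+1 - \sum_(i < n) c (lift ord0 i) *: u (lift ord0 i).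
      by rewrite unE1 addrK.
    apply: RB => //; apply: (big_ind2 R) => // i _.
    by apply: RZ; apply: Ru.
  have {Rw} : u n - v \in W.
    case/memv_addP: wW Rw => x xs [b /BE Bb ->] Rw.
    have [_ [g gs Rxg]] := fixed_span_rel fs xs.
    rewrite -(subrK g (u n - v)) addrC memv_add //; apply/BE.
    by apply: reach0_fwd Bb _; have := RB Rw Rxg; rewrite addrAC subrr add0r.
  move=> uvW; rewrite -(subrK v (u n)) memv_add //.
  by apply: memv_sumr => i _; rewrite memvZ // memv_line.
(* The indices are reversed because the equations are solved downwards from [a n = t]; in particular
   [d n = c ord0], whose nonvanishing gives a nonzero [t]. *)
pose d j := c (inord (n - j)).
have [|t t0 tE] := @twisted_poly_root _ q d q_gt1 n.
  by rewrite /d subnn (_ : inord 0 = ord0) //; apply/val_inj; rewrite /= inordK.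
pose a j := (twisted_poly q d (n - j)).[t].
have an : a n = t by rewrite /a subnn hornerX.
have aS (j : 'I_n) : a j.+1 ^+ q = a j + c (lift ord0 j) * t.
  have nj : (n - j = (n - j.+1).+1)%N by have := ltn_ord j; lia.
  rewrite /a nj /= !hornerE; set P := (twisted_poly _ _ _).[_].
  suff -> : d (n - j.+1)%N = c (lift ord0 j) by rewrite subrK.
  rewrite /d; congr c; apply/val_inj; rewrite /= /bump leq0n add1n subKn // inordK //.
  by rewrite ltnS.
have a0 : a 0%N ^+ q = c ord0 * t.
  move: tE; rewrite /= !hornerE /a subn0 => /subr0_eq ->.
  by rewrite /d subnn; congr (c _ * _); apply/val_inj; rewrite /= inordK.
pose Z := \sum_(j < n.+1) a j ^+ q *: u j.
(* The coefficient of [u n] in [Z] is t^q, so [Z] in [W] would again give [u n] in [E n]. *)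
have ZW : Z \notin W.
  apply: contra unE; rewrite /Z big_ord_recr /= an => ZW.
  rewrite -(scalerK (expf_neq0 q t0) (u n)) memvZ //.
  move: ZW; set v := \sum_(i < n) _ => ZW; rewrite -(addKr v (_ *: _)) addrC.
  rewrite memv_add // rpredN.
  by apply: memv_sumr => i _; rewrite memvZ // memv_line.
(* The equations for [a] say that the sum of the [a j *: u j.+1] is [Z + t *: w], and [R] relates
   this sum to [Z] term by term. *)
have RZ1 : R (Z + t *: w) Z.
  have -> : Z + t *: w = \sum_(j < n.+1) a j *: u j.+1.
    rewrite big_ord_recr /= an unE1 scalerDr addrCA addrC; congr (_ + _).
    rewrite /Z !big_ord_recl /= a0 scalerDr scalerA mulrC addrCA; congr (_ + _).
    rewrite scaler_sumr -big_split; apply: eq_bigr => j _ /=.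
    by rewrite aS scalerDl scalerA mulrC.
  by apply: (big_ind2 R) => // i _; apply: RZ.
(* The error [t *: w] is a sum v + b. Adding [f] with [R f (f + v)] and [x] with [R x (x + b)] makes
   both sides of [RZ1] equal to Z + (f + v) + (x + b). *)
have [v [b [vs Bb twE]]] : exists v b, [/\ v \in <<s>>%VS, reach0 b & t *: w = v + b].
  by have /memv_addP [v vs [b /BE Bb ->]] := memvZ t wW; exists v, b.
have [f [fvs Rf]] := fixed_span_shift fs vs.
have [x Bx Rx] := reach0_translate Bb.
exists (Z + (f + v) + (x + b)); split.
- apply: subspaceD => //; last by apply/reach0_A/(subspaceD reach0_subspace).
  apply: subspaceD => //; last by have [] := fixed_span_rel fs fvs.
  by apply: subspace_sum => // i _; apply: subspaceZ.
- have := RD (RD RZ1 Rf) Rx; rewrite twE.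
  suff -> : Z + (v + b) + f + x = Z + (f + v) + (x + b) by [].
  by rewrite -!addrA (addrCA f) (addrC b) addrA -!addrA.
- apply: contra ZW => ZW; rewrite -(addrK (f + v + (x + b)) Z) addrA memvB //.
  by rewrite memv_add //; apply/BE/(subspaceD reach0_subspace).
Qed.

(** Every vector supplied by [exists_fixed] enlarges [<<s>> + B], so finitely many of them
    suffice. *)
Lemma fixed_vectors_span :
  exists2 s, fixed_in s & forall x, A x -> exists2 v, v \in <<s>>%VS & reach0 (x - v).
Proof.
have [B BE] := subspace_vspace reach0_subspace.
suff [s fs sA] : exists2 s, fixed_in s & forall x, A x -> x \in (<<s>> + B)%VS.
  exists s => // x /sA /memv_addP [v vs [b /BE Bb ->]]; exists v => //.
  by rewrite addrC addKr.
have : fixed_in [::] by [].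
have [n] := ubnP (\dim {:V} - \dim (<<[::]>> + B)%VS); move: [::].
elim: n => // n IHn s; rewrite ltnS => le_n fs.
have [sA | nsA] := classic (forall x, A x -> x \in (<<s>> + B)%VS); first by exists s.
have [y nAy] := not_all_ex_not _ _ nsA; have [Ay /negP yW] := imply_to_and _ _ nAy.
have [z [Az Rz zW]] := exists_fixed BE fs Ay yW.
apply: (IHn (z :: s)); last by move=> x; rewrite inE => /predU1P [-> | /fs].
have ltd : (\dim (<<s>> + B) < \dim (<<z :: s>> + B))%N.
  rewrite span_cons -addvA (ltn_leqif (dimv_leqif_sup (addvSr _ _))).
  by apply: contra zW => /subvP; apply; rewrite memvE addvSl.
by apply: leq_trans le_n; rewrite ltn_sub2l // (leq_trans ltd) // dimvS // subvf.
Qed.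

End SemilinearRelations.

(** * Paths in unitary BT1 modules *)

Section FrobeniusPower.

Variables (k : closedFieldType) (p : nat).
Hypothesis charp : p \in [pchar k].

Let p_prime : prime p := pcharf_prime charp.

Lemma pnat_pchar_expn n : [pchar k].-nat (p ^ n)%N.
Proof. by rewrite pnatX pnatE // charp. Qed.

Lemma frob_powerD n (x y : k) : (x + y) ^+ (p ^ n) = x ^+ (p ^ n) + y ^+ (p ^ n).
Proof. exact/exprDn_pchar/pnat_pchar_expn. Qed.

Lemma frob_powerN n (x : k) : (- x) ^+ (p ^ n) = - x ^+ (p ^ n).
Proof. exact/exprNn_pchar/pnat_pchar_expn. Qed.

Lemma frob_power_inj n : injective (fun x : k => x ^+ (p ^ n)).
Proof.
move=> x y /= /eqP; rewrite -subr_eq0 -frob_powerN -frob_powerD expf_eq0 subr_eq0.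
by case/andP => _ /eqP.
Qed.

Lemma prootX (x : k) : proot p (x ^+ p) = x.
Proof.
apply: (@frob_power_inj 1); rewrite /= expn1 prootK //; exact: prime_gt0.
Qed.

Lemma proot0 : proot p (0 : k) = 0.
Proof. by rewrite -[RHS]prootX expr0n gtn_eqF // prime_gt0. Qed.

End FrobeniusPower.

Section UnitaryModule.

Variables (k : closedFieldType) (p : nat).
Hypothesis charp : p \in [pchar k].
Variable M : ufv_module k.
Hypothesis hM : is_unitary_BT1 p M.

Let p_prime : prime p := pcharf_prime charp.
Let p_gt0 : (0 < p)%N := prime_gt0 p_prime.

Lemma unitary_symplectic : symplectic (@pairing k M).
Proof. by case: hM => [[_ ? _] _ _ _]. Qed.

Lemma frobD x y : frob (x + y : M) = frob x + frob y.
Proof. by case: hM => [[[[]]]]. Qed.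

Lemma frobZ a x : frob (a *: x : M) = a ^+ p *: frob x.
Proof. by case: hM => [[[[]]]]. Qed.

Lemma versD x y : vers (x + y : M) = vers x + vers y.
Proof. by case: hM => [[[_ []]]]. Qed.

Lemma versXZ a x : vers (a ^+ p *: x : M) = a *: vers x.
Proof. by case: hM => [[[_ []]]]. Qed.

Lemma versZ a x : vers (a *: x : M) = proot p a *: vers x.
Proof. by rewrite -{1}(prootK a p_gt0) versXZ. Qed.

Lemma frob0 : frob (0 : M) = 0.
Proof. by apply: (addrI (frob (0 : M))); rewrite -frobD !addr0. Qed.

Lemma vers0 : vers (0 : M) = 0.
Proof. by apply: (addrI (vers (0 : M))); rewrite -versD !addr0. Qed.

Lemma frobB x y : frob (x - y : M) = frob x - frob y.
Proof. by apply: (addIr (frob y)); rewrite -frobD !subrK. Qed.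

Lemma frob_eq0 (x : M) : frob x = 0 <-> exists y : M, x = vers y.
Proof. by case: hM => [[[]]]. Qed.

Lemma vers_eq0 (x : M) : vers x = 0 <-> exists y : M, x = frob y.
Proof. by case: hM => [[[]]]. Qed.

Lemma frob_vers (x : M) : frob (vers x) = 0.
Proof. by apply/frob_eq0; exists x. Qed.

Lemma vers_frob (x : M) : vers (frob x) = 0.
Proof. by apply/vers_eq0; exists x. Qed.

Lemma pairing_frobl (x y : M) : pairing (frob x) y = pairing x (vers y) ^+ p.
Proof. by case: hM => [[]]. Qed.

Lemma pairing_frobr (x y : M) : pairing x (frob y) = pairing (vers x) y ^+ p.
Proof.
rewrite (formC unitary_symplectic) pairing_frobl (formC unitary_symplectic y).
by rewrite -[X in _ ^+ X](expn1 p) frob_powerN // opprK.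
Qed.

Lemma grad_frob g (x : M) : x \in grad M g -> frob x \in grad M (~~ g).
Proof. by case: hM => _ _ h _ /h []. Qed.

Lemma grad_vers g (x : M) : x \in grad M g -> vers x \in grad M (~~ g).
Proof. by case: hM => _ _ h _ /h []. Qed.

Lemma grad_isotropic g (x y : M) :
  x \in grad M g -> y \in grad M g -> pairing x y = 0.
Proof. by case: hM => _ _ _ /(_ g) h /h; apply. Qed.

Lemma grad_disjoint g (x : M) : x \in grad M g -> x \in grad M (~~ g) -> x = 0.
Proof.
case: hM => _ [_ cap0] _ _ xg xg'; apply/eqP; rewrite -memv0 -cap0 memv_cap.
by case: g xg xg' => /= -> ->.
Qed.

Lemma grad_split g (x : M) :
  exists x1 x2, [/\ x = x1 + x2, x1 \in grad M g & x2 \in grad M (~~ g)].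
Proof.
case: hM => _ [sum1 _] _ _; have := memvf x; rewrite -sum1.
case/memv_addP => y y0 [z z1 ->].
by case: g => /=; [exists z, y; rewrite addrC | exists y, z].
Qed.

Lemma grad_nondegenerate g (x : M) :
  x \in grad M g -> (forall y, y \in grad M (~~ g) -> pairing x y = 0) -> x = 0.
Proof.
move=> xg x0; apply: (grad_disjoint xg); case: hM => _ _ _ /(_ (~~ g)) h.
exact/h.
Qed.

(* A step along [lf] applies F, a step along [lv] inverts V. *)
Definition gstep (g : bool) (u : letter) (x y : M) : Prop :=
  [/\ x \in grad M g, y \in grad M (~~ g)
    & if u is lf then y = frob x else x = vers y].

(* Here words are listed in the order of application, so that a [word] w
   corresponds to [rev w]. *)
Fixpoint gpath (g : bool) (w : seq letter) (x y : M) : Prop :=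
  if w is u :: w' then exists2 z, gstep g u x z & gpath (~~ g) w' z y
  else x = y /\ x \in grad M g.

Lemma gstep0 g u : gstep g u 0 0.
Proof. by case: u; split; rewrite ?mem0v ?frob0 ?vers0. Qed.

Lemma gstepD g u x y x' y' :
  gstep g u x y -> gstep g u x' y' -> gstep g u (x + x') (y + y').
Proof.
by case: u => -[xg yg e] [xg' yg' e']; split; rewrite ?memvD // e e' ?frobD ?versD.
Qed.

Lemma gstepZ g u a x y : gstep g u x y -> gstep g u (a *: x) (a ^+ p *: y).
Proof. by case: u => -[xg yg e]; split; rewrite ?memvZ // e ?frobZ ?versXZ. Qed.

Lemma gpath_grad g w x y :
  gpath g w x y -> x \in grad M g /\ y \in grad M (g (+) odd (size w)).
Proof.
elim: w g x => [|u w IHw] g x /=; first by case=> <- xg; rewrite addbF.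
by move=> [z [xg zg _] /IHw [_ yg]]; rewrite addbN addNb in yg *.
Qed.

Lemma gpath0 g w : gpath g w 0 0.
Proof.
elim: w g => [|u w IHw] g /=; first by rewrite mem0v.
by exists 0; [apply: gstep0 | apply: IHw].
Qed.

Lemma gpathD g w x y x' y' :
  gpath g w x y -> gpath g w x' y' -> gpath g w (x + x') (y + y').
Proof.
elim: w g x x' => [|u w IHw] g x x' /=.
  by move=> [<- xg] [<- xg']; rewrite memvD.
move=> [z xz zy] [z' xz' zy']; exists (z + z'); first exact: gstepD.
exact: IHw.
Qed.

Lemma gpathZ g w a x y :
  gpath g w x y -> gpath g w (a *: x) (a ^+ (p ^ size w) *: y).
Proof.
elim: w g a x => [|u w IHw] g a x /=; first by move=> [<- xg]; rewrite expr1 memvZ.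
move=> [z xz zy]; exists (a ^+ p *: z); first exact: gstepZ.
by rewrite expnS exprM; apply: IHw.
Qed.

Lemma gpath_cat g w w' x y :
  gpath g (w ++ w') x y <->
  exists2 z, gpath g w x z & gpath (g (+) odd (size w)) w' z y.
Proof.
elim: w g x => [|u w IHw] g x /=.
  rewrite addbF; split=> [xy | [z [-> _]] //].
  by exists x => //; split=> //; have [] := gpath_grad xy.
split=> [[z xz /IHw [t zt ty]] | [t [z xz zt] ty]].
  by exists t; [exists z | move: ty; rewrite addbN addNb].
by exists z => //; apply/IHw; exists t => //; rewrite addbN addNb in ty *.
Qed.

Definition gpath_image (g : bool) (w : seq letter) (S : M -> Prop) (y : M) : Prop :=
  exists2 x, S x & gpath g w x y.

Lemma image_subspace g w S : subspace S -> subspace (gpath_image g w S).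
Proof.
move=> [S0 SD]; split; first by exists 0 => //; apply: gpath0.
move=> a x y [x' Sx' xx] [y' Sy' yy].
exists (proot (p ^ size w) a *: x' + y'); first exact: SD.
apply: gpathD => //; rewrite -[in a *: x](@prootK k (p ^ size w) a) ?expn_gt0 ?p_gt0 //.
exact: gpathZ.
Qed.

Definition zero_pred (x : M) : Prop := x = 0.

Lemma zero_pred_subspace : subspace zero_pred.
Proof. by split=> // a x y -> ->; rewrite /zero_pred scaler0 addr0. Qed.

Lemma grad_subspace g : subspace (fun x : M => x \in grad M g).
Proof. by split=> [|a x y xg yg]; rewrite ?mem0v // memvD // memvZ. Qed.

(** In terms of subspaces: the interval from w(0) to w(M_g) is nontrivial. *)
Definition admissible (g : bool) (w : seq letter) : Prop :=
  exists x y, gpath g w x y /\ ~ gpath g w 0 y.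

Lemma admissible_prefix g w w' : admissible g (w ++ w') -> admissible g w.
Proof.
case=> x [y [/gpath_cat [z xz zy] n0y]]; exists x, z; split=> // n0z.
by apply: n0y; apply/gpath_cat; exists z.
Qed.

Lemma admissible_suffix g w w' :
  admissible g (w ++ w') -> admissible (g (+) odd (size w)) w'.
Proof.
case=> x [y [/gpath_cat [z xz zy] n0y]]; exists z, y; split=> // n0z.
by apply: n0y; apply/gpath_cat; exists 0 => //; apply: gpath0.
Qed.

Lemma gpathB0 g w x y z : gpath g w x y -> gpath g w 0 z -> gpath g w x (y - z).
Proof.
move=> xy zw; rewrite -[x]addr0 -scaleN1r; apply: gpathD => //.
by have := gpathZ (-1) zw; rewrite scaler0 frob_powerN // expr1n.
Qed.

Lemma gpath1 g u x y : gpath g [:: u] x y <-> gstep g u x y.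
Proof.
split=> [[z xz [<- _]] // | xy]; exists y => //; split=> //.
by case: xy.
Qed.

(* If U is not contained in U', then, because ker F = im V, either F(U) is not
   contained in F(U') or V^{-1}(U) is not contained in V^{-1}(U'). *)
Lemma admissible_extend g w : admissible g w -> exists u, admissible g (rcons w u).
Proof.
case=> x [y [xy n0y]]; have [xg yg] := gpath_grad xy.
set h := g (+) odd (size w) in yg.
have [[y' n0y' y'E] | nfy] := classic (exists2 y', gpath g w 0 y' & frob y = frob y').
  have n0y'g : y' \in grad M h by have [] := gpath_grad n0y'.
  have /frob_eq0 [z zE] : frob (y - y') = 0 by rewrite frobB y'E subrr.
  (* The step along [lv] needs a homogeneous preimage under V. The part [z2] of the wrong degree has
     its image in both pieces of the grading, hence V kills it. *)
  have [z1 [z2 [zE12 z1h z2h]]] := grad_split (~~ h) z.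
  rewrite negbK in z2h; have vz1 : vers z1 \in grad M h.
    by rewrite -(negbK h); apply: grad_vers.
  have vz2 : vers z2 = 0.
    apply: (@grad_disjoint h); last exact: grad_vers.
    rewrite (_ : vers z2 = y - y' - vers z1); first by rewrite !memvB.
    by rewrite zE zE12 versD addrC addKr.
  have vz1E : y - y' = vers z1 by rewrite zE zE12 versD vz2 addr0.
  exists lv; exists x, z1; rewrite -cats1; split.
    apply/gpath_cat; exists (y - y'); first exact: gpathB0.
    by apply/gpath1; split=> //; rewrite memvB.
  case/gpath_cat => t n0t /gpath1 [_ _ tE]; apply: n0y.
  rewrite -(subrK y' y) vz1E -tE -[0]addr0; exact: gpathD.
exists lf; exists x, (frob y); rewrite -cats1; split.
  apply/gpath_cat; exists y => //; apply/gpath1; split=> //; exact: grad_frob.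
by case/gpath_cat => z n0z /gpath1 [_ _ yE]; apply: nfy; exists z.
Qed.

End UnitaryModule.

(* The last letter applied is the most significant digit. *)
Definition word_code (w : seq letter) : nat :=
  foldr (fun u n => (u == lv) + n.*2)%N 0%N w.

Lemma word_code_inj w w' : size w = size w' -> word_code w = word_code w' -> w = w'.
Proof.
elim: w w' => [|u w IHw] [|u' w'] //= [sz] e.
have e2 : word_code w = word_code w' by case: u u' e => -[] /=; lia.
rewrite (IHw w') //; move: e; rewrite e2; case: u u' => -[] //=; lia.
Qed.

(** Comparing at the last difference leaves a common tail [t], under which an inclusion of images
    established at that difference persists. *)
Lemma word_code_lt w w' : size w = size w' -> (word_code w < word_code w')%N ->
  exists x x' t, [/\ w = x ++ lf :: t, w' = x' ++ lv :: t & size x = size x'].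
Proof.
elim: w w' => [|u w IHw] [|u' w'] //= [sz] lt.
have [lt2 | le2] := ltnP (word_code w) (word_code w').
  have [x [x' [t [-> -> xx']]]] := IHw w' sz lt2.
  by exists (u :: x), (u' :: x'), t; rewrite /= xx'.
exists [::], [::], w; move: lt; have [e | ne] := eqVneq (word_code w) (word_code w').
  by rewrite (word_code_inj sz e); case: u u' => -[] //=; lia.
by case: u u' => -[] /=; lia.
Qed.

Lemma powerS z n : power z n.+1 = z ++ power z n.
Proof. by []. Qed.

Lemma powerD z m n : power z (m + n) = power z m ++ power z n.
Proof. by rewrite /power nseqD flatten_cat. Qed.

Lemma powerM z m n : power z (m * n) = power (power z m) n.
Proof. by elim: n => [|n IHn]; rewrite ?muln0 // mulnS powerD IHn. Qed.

Lemma size_power z n : size (power z n) = (n * size z)%N.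
Proof. by elim: n => // n IHn; rewrite powerS size_cat IHn mulSn. Qed.

Lemma take_periodic L P (z : seq letter) :
    take L z = take L (drop P z) -> (L + P <= size z)%N ->
  forall n, (n * P <= L)%N -> take (n * P) z = power (take P z) n.
Proof.
move=> e sz; elim=> [|n IHn] le_L; first by rewrite take0.
rewrite mulSn takeD powerS -IHn; last by apply: leq_trans le_L; rewrite mulSn leq_addl.
congr (_ ++ _); have le_L' : (n * P <= L)%N by move: le_L; rewrite mulSn; lia.
by rewrite -(take_takel _ le_L') -e take_takel.
Qed.

(** * An even word all of whose powers are admissible *)

Section PeriodicWord.

Variables (k : closedFieldType) (p : nat).
Hypothesis charp : p \in [pchar k].
Variable M : ufv_module k.
Hypothesis hM : is_unitary_BT1 p M.

(** A vector just produced by [lf] lies in im F = ker V, so [lv] reaches it from 0. Thus the whole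
    image of the word with smaller code is contained in the image of 0 under the other. *)
Lemma gpath_lt_zero g x x' t (a y : M) : size x = size x' ->
  gpath g (x ++ lf :: t) a y -> gpath g (x' ++ lv :: t) 0 y.
Proof.
move=> sz /gpath_cat [z az [z' [zg z'g z'E] z'y]].
apply/gpath_cat; exists 0; first exact: (gpath0 hM).
rewrite -sz; exists z' => //; split=> //; first exact: mem0v.
by rewrite z'E (vers_frob hM).
Qed.

(** If M_0 were 0, every vector would be orthogonal to it, and the Lagrangian condition would force
    M = M_0 = 0. *)
Lemma admissible_nil : (0 < \dim {:M})%N -> admissible M false [::].
Proof.
move=> dim_gt0; apply: NNPP => nadm.
have M0 (x : M) : x \in grad M false -> x = 0.
  by move=> x0; apply: NNPP => xn0; apply: nadm; exists x, x; split=> // -[] /esym.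
suff : (fullv <= (0%VS : {vspace M}))%VS by move/dimvS; rewrite dimv0 leqNgt dim_gt0.
apply/subvP => x _; rewrite memv0; apply/eqP/M0.
case: hM => _ _ _ /(_ false) lag; apply/lag => y /M0 ->.
exact: form0r (unitary_symplectic hM) _.
Qed.

Lemma admissible_long n : (0 < \dim {:M})%N ->
  exists2 w, size w = n & admissible M false w.
Proof.
move=> dim_gt0; elim: n => [|n [w sz adm]].
  by exists [::] => //; apply: admissible_nil.
have [u adm'] := admissible_extend charp hM adm.
by exists (rcons w u) => //; rewrite size_rcons sz.
Qed.

(** The offset is even so that the window starts in degree 0 again. *)
Lemma admissible_window w i L : admissible M false w ->
  admissible M false (take L (drop i.*2 w)).
Proof.
move=> adm; have [lt | le] := ltnP i.*2 (size w); last first.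
  rewrite drop_oversize //=; rewrite -(cat0s w) in adm.
  exact: admissible_prefix adm.
rewrite -(cat_take_drop i.*2 w) in adm.
have := admissible_suffix hM adm; rewrite (size_takel (ltnW lt)) odd_double.
rewrite -{1}(cat_take_drop L (drop i.*2 w)) addbF; exact: admissible_prefix.
Qed.

(* Distinct admissible words of the same length yield independent vectors, since
   F(M) = V^{-1}(0) makes their images a chain of subspaces; so among the windows
   of a long admissible word two coincide. *)
Lemma repeated_window w L : admissible M false w ->
    ((\dim {:M}).*2 + L <= size w)%N ->
  exists i j, [/\ (i < j <= \dim {:M})%N
    & take L (drop i.*2 w) = take L (drop j.*2 w)].
Proof.
set D := \dim _ => adm sz; pose win (i : 'I_D.+1) := take L (drop i.*2 w).
have sz_win i : size (win i) = L.
  by rewrite size_takel // size_drop; have := ltn_ord i; lia.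
have [injw | /injectivePn [i [j ij]]] := altP (injectiveP (word_code \o win)); last first.
  move=> /= /word_code_inj; rewrite !sz_win => /(_ erefl) e.
  have [lt | lt | /val_inj eij] := ltngtP i j; last by rewrite eij eqxx in ij.
    by exists i, j; rewrite lt -ltnS ltn_ord.
  by exists j, i; rewrite lt -ltnS ltn_ord.
have exy i : exists y, (exists x, gpath (M := M) false (win i) x y) /\ ~ gpath (M := M) false (win i) 0 y.
  have [x [y [xy n0y]]] := admissible_window i L adm.
  by exists y; split=> //; exists x.
have [y yE] := functional_choice _ exy.
(* [C] serves to reverse the order: the larger the code, the smaller the rank needed by
   [graded_independent]. *)
pose C := (\sum_i word_code (win i))%N.
suff : (D.+1 <= D)%N by rewrite ltnn.
apply: (@independent_leq_dim _ _ _ y).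
apply: (@graded_independent _ _ _ y (fun i => C - word_code (win i))%N
  (fun i => gpath_image false (win i) (@zero_pred k M))).
- by move=> i; apply: (image_subspace charp hM); apply: zero_pred_subspace.
- by move=> i [x -> xy]; have [_] := yE i; apply.
- move=> i j ji le; have leC i' : (word_code (win i') <= C)%N.
    by rewrite /C (bigD1 i') //= leq_addr.
  have ltji : (word_code (win j) < word_code (win i))%N.
    rewrite ltn_neqAle (inj_eq injw) ji /=; have := leC i; have := leC j; lia.
  have sz_ji : size (win j) = size (win i) by rewrite !sz_win.
  have [x [x' [t [ej ei xx']]]] := word_code_lt sz_ji ltji.
  have [[a aE] _] := yE j; exists 0 => //; rewrite ei.
  by apply: gpath_lt_zero xx' _; rewrite -ej; apply: aE.
Qed.

Lemma admissible_power N : (0 < \dim {:M})%N ->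
  exists w, [/\ (0 < size w)%N, ~~ odd (size w) & admissible M false (power w N)].
Proof.
move=> dim_gt0; set D := \dim {:M} in dim_gt0 *.
(* Windows start at most 2D letters into the word, and a window of length N * 2D has room for N
   periods, each of length at most 2D. *)
have [w sz adm] := admissible_long (D.*2 + N * D.*2)%N dim_gt0.
have [|i [j [/andP [ij jD] e]]] := repeated_window (L := (N * D.*2)%N) adm.
  by rewrite sz.
pose P := (j - i).*2; pose z := drop i.*2 w.
have le_P : (P <= D.*2)%N by rewrite leq_double; lia.
have sz_z : (N * D.*2 + P <= size z)%N by rewrite size_drop sz /P; lia.
have szP : size (take P z) = P by rewrite size_takel //; lia.
exists (take P z); rewrite szP odd_double double_gt0 subn_gt0 ij; split=> //.
rewrite -(@take_periodic (N * D.*2)) ?leq_mul2l ?le_P ?orbT //.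
  exact: admissible_window.
by rewrite e drop_drop -doubleD subnK // ltnW.
Qed.

(** Descent on the length: if w = z^n, then z^N is a prefix of w^N. The descent stops at even roots,
    since a path along an odd word ends in the other degree. *)
Lemma primitive_admissible_power N : (0 < \dim {:M})%N ->
  exists w, [/\ (0 < size w)%N, ~~ odd (size w),
    forall z n, ~~ odd (size z) -> (1 < n)%N -> w <> power z n
    & admissible M false (power w N)].
Proof.
move=> dim_gt0; have [w0 w0P] := admissible_power N dim_gt0.
have [m] := ubnP (size w0); elim: m w0 w0P => // m IHm w [w_gt0 w_even adm].
rewrite ltnS => le_m.
have [[z [n [z_even n_gt1 wE]]] | nw] := classic (exists z n, [/\ ~~ odd (size z), (1 < n)%N & w = power z n]).
  have szw : size w = (n * size z)%N by rewrite wE size_power.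
  have z_gt0 : (0 < size z)%N by move: w_gt0; rewrite szw muln_gt0 => /andP [].
  apply: (IHm z); last first.
    apply: leq_trans le_m; rewrite szw -[X in (X < _)%N]mul1n ltn_pmul2r //.
  split=> //; move: adm; rewrite wE -powerM mulnC -[(N * n)%N](subnKC (_ : N <= _)%N).
    by rewrite powerD => /admissible_prefix.
  by rewrite leq_pmulr // ltnW.
exists w; split=> // z n z_even n_gt1 wE; apply: nw; exists z, n; split=> //.
Qed.

End PeriodicWord.

(** * Duality between a word and its dual, and closed paths that pair nontrivially *)

Section DualChains.

Variables (k : closedFieldType) (p : nat).
Hypothesis charp : p \in [pchar k].
Variable M : ufv_module k.
Hypothesis hM : is_unitary_BT1 p M.

Let p_prime : prime p := pcharf_prime charp.
Let symp := unitary_symplectic hM.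

Lemma pairing_gstep g u (x y x' y' : M) :
  gstep g u x y -> gstep (~~ g) (dual_letter u) x' y' ->
  pairing y y' = pairing x x' ^+ p.
Proof.
case: u => -[_ _ e] [_ _ e'].
  by rewrite e e' (pairing_frobl hM).
by rewrite e e' (pairing_frobr charp hM).
Qed.

Lemma pairing_gpath g w (x y x' y' : M) :
  gpath g w x y -> gpath (~~ g) (dual w) x' y' ->
  pairing y y' = pairing x x' ^+ (p ^ size w).
Proof.
elim: w g x x' => [|u w IHw] g x x' /=; first by move=> [<- _] [<- _]; rewrite expr1.
move=> [z xz zy] [z' xz' zy']; rewrite (IHw _ _ _ zy zy') (pairing_gstep xz xz').
by rewrite -exprM expnS.
Qed.

(** This relation passes to images under a word and its dual. Starting from 0 and M_1, it converts a
    vector outside w^n(0) into a vector of the n-th image of M_1 along the dual word that pairs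
    nontrivially with it. *)
Definition mutual_perp (g : bool) (S S' : M -> Prop) : Prop :=
  [/\ subspace S, subspace S',
      forall x, x \in grad M g -> (forall y, S' y -> pairing x y = 0) -> S x
    & forall y, y \in grad M (~~ g) -> (forall x, S x -> pairing x y = 0) -> S' y].

Lemma mutual_perpC g S S' : mutual_perp g S S' -> mutual_perp (~~ g) S' S.
Proof.
case=> sS sS' SP SP'; split=> // [y yg h | x xg h].
  by apply: SP' => // x Sx; rewrite (formC symp) h // oppr0.
by apply: SP; rewrite ?negbK // in xg * => y Sy; rewrite (formC symp) h // oppr0.
Qed.

Lemma image1 g u S (y : M) : gpath_image g [:: u] S y <-> exists2 x, S x & gstep g u x y.
Proof. by split=> -[x Sx /(gpath1 g u x y) xy]; exists x. Qed.

(** The vector given by [form_separation] can be replaced by its component of degree [~~ g], as the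
    other component is orthogonal to all of degree [g]. *)
Lemma grad_separation g (S : M -> Prop) x : subspace S ->
    x \in grad M g -> (forall z, S z -> z \in grad M g) -> ~ S x ->
  exists y, [/\ y \in grad M (~~ g), forall z, S z -> pairing z y = 0 & pairing x y <> 0].
Proof.
move=> sS xg Sg nSx; have [U UE] := subspace_vspace sS.
have [|y y0 xy] := form_separation symp (U := U) (x := x); first by apply/negP => /UE.
have [y1 [y2 [yE y1g y2g]]] := grad_split hM g y.
have pE z : z \in grad M g -> pairing z y2 = pairing z y.
  by move=> zg; rewrite yE (formDr symp) (grad_isotropic hM zg y1g) add0r.
exists y2; split=> // [z Sz|]; first by rewrite pE ?Sg // y0 //; apply/UE.
by rewrite pE //; apply/eqP.
Qed.

(** One inclusion is the adjunction between F and V. The other follows by a double perpendicular: a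
    vector outside F(S) is separated from F(S) by some [y], and the first inclusion puts this [y]
    into V^{-1}(S'). *)
Lemma mutual_perp_frob g S S' : (forall x, S x -> x \in grad M g) ->
    (forall x, S' x -> x \in grad M (~~ g)) -> mutual_perp g S S' ->
  mutual_perp (~~ g) (gpath_image g [:: lf] S) (gpath_image (~~ g) [:: lv] S').
Proof.
move=> Sg Sg' [sS sS' SP SP'].
have dual_step (y : M) : y \in grad M g ->
    (forall x, gpath_image g [:: lf] S x -> pairing x y = 0) -> gpath_image (~~ g) [:: lv] S' y.
  move=> yg y0; apply/image1; exists (vers y); last by split; rewrite ?negbK ?(grad_vers hM).
  apply: SP' => [|x Sx]; first exact: (grad_vers hM yg).
  have : pairing x (vers y) ^+ p = 0.
    rewrite -(pairing_frobl hM); apply: y0; apply/image1; exists x => //.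
    by split; rewrite ?(grad_frob hM) ?Sg.
  by move/eqP; rewrite expf_eq0 => /andP [_ /eqP].
split; rewrite ?negbK //; try exact: (image_subspace charp hM).
move=> x xg x0; apply: NNPP => nx.
have [|y [yg y0 xy]] := grad_separation (image_subspace charp hM g [:: lf] sS) xg _ nx.
  by move=> z /image1 [t _ []].
by apply: xy; apply: x0; apply: dual_step; rewrite ?negbK in yg *.
Qed.

Lemma mutual_perp_ext g (T1 T1' T2 T2' : M -> Prop) :
    (forall y, T1 y <-> T2 y) -> (forall y, T1' y <-> T2' y) ->
    mutual_perp g T2 T2' -> subspace T1 -> subspace T1' -> mutual_perp g T1 T1'.
Proof.
move=> e e' [_ _ TP TP'] sT sT'; split=> // x xg x0.
  by apply/e/TP => // y /e'; apply: x0.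
by apply/e'/TP' => // y /e; apply: x0.
Qed.

Lemma mutual_perp_image g w S S' : (forall x, S x -> x \in grad M g) ->
    (forall x, S' x -> x \in grad M (~~ g)) -> mutual_perp g S S' ->
  mutual_perp (g (+) odd (size w)) (gpath_image g w S) (gpath_image (~~ g) (dual w) S').
Proof.
elim: w g S S' => [|u w IHw] g S S' Sg Sg' h /=.
  have imE g' (T : M -> Prop) (y : M) : (forall x, T x -> x \in grad M g') -> gpath_image g' [::] T y <-> T y.
    by move=> Tg; split=> [[x Tx [<- _]] // | Ty]; exists y => //; split=> //; apply: Tg.
  case: h => sS sS' SP SP'; rewrite addbF; split; try exact: (image_subspace charp hM).
    by move=> x xg x0; apply/imE => //; apply: SP => // y Sy; apply/x0/imE.
  by move=> x xg x0; apply/imE => //; apply: SP' => // y Sy; apply/x0/imE.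
have imE g' u' w' (T : M -> Prop) (y : M) : gpath_image g' (u' :: w') T y <-> gpath_image (~~ g') w' (gpath_image g' [:: u'] T) y.
  split=> [[x Tx [z xz zy]] | [z /image1 [x Tx xz] zy]].
    by exists z => //; apply/image1; exists x.
  by exists x => //; exists z.
apply: (mutual_perp_ext (imE _ _ _ _) (imE _ _ _ _)); try exact: (image_subspace charp hM).
  2,3: by apply: (image_subspace charp hM); case: h.
rewrite addbN -addNb; apply: IHw.
- by move=> x /image1 [t _ []].
- by move=> x /image1 [t _ []].
(* The letter [lv] is the case of [lf] with the two subspaces exchanged. *)
case: u => //=; first exact: mutual_perp_frob.
have := mutual_perp_frob Sg' _ (mutual_perpC h); rewrite negbK => /(_ Sg).
exact: mutual_perpC.
Qed.

Lemma admissible_closed_pair w : (0 < size w)%N -> ~~ odd (size w) ->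
    admissible M false (power w (\dim {:M})) ->
  exists x y, [/\ gpath (M := M) false w x x, gpath (M := M) true (dual w) y y
    & pairing x y <> 0].
Proof.
set D := \dim _ => w_gt0 /negbTE w_even adm.
pose q := (p ^ size w)%N; pose R := gpath (M := M) false w.
pose R' := gpath (M := M) true (dual w).
have sz' : size (dual w) = size w by rewrite size_map.
have q_gt1 : (1 < q)%N by rewrite -(exp1n (size w)) ltn_exp2r // prime_gt1.
have q_pchar : [pchar k].-nat q := pnat_pchar_expn charp _.
have RZ a x y : R x y -> R (a *: x) (a ^+ q *: y) .
  exact: gpathZ.
have RZ' a x y : R' x y -> R' (a *: x) (a ^+ q *: y).
  by rewrite /q -sz'; apply: gpathZ.
have RD x y x' y' : R x y -> R x' y' -> R (x + x') (y + y').
  exact: (gpathD hM).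
have RD' x y x' y' : R' x y -> R' x' y' -> R' (x + x') (y + y').
  exact: (gpathD hM).
have R0 : R 0 0 by apply: (gpath0 hM).
have R0' : R' 0 0 by apply: (gpath0 hM).
have Rg x y : R x y -> y \in grad M false.
  by move/gpath_grad => [_]; rewrite w_even.
have Rg' x y : R' x y -> y \in grad M true.
  by move/gpath_grad => [_]; rewrite sz' w_even.
have powE n x y : gpath false (power w n) x y <-> x \in grad M false /\ iter_rel R n x y.
  elim: n x => [|n IHn] x; first by split=> -[].
  rewrite iter_rel_front powerS; split=> [/gpath_cat [z xz] | [xg [z Rxz zy]]].
    rewrite w_even => /IHn [_ zy]; split; last by exists z.
    by have [] := gpath_grad xz.
  apply/gpath_cat; exists z => //; rewrite w_even; apply/IHn; split=> //.
  exact: Rg Rxz.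
have [x [y [xy n0y]]] := adm.
pose A := iter_image R (fun x => x \in grad M false).
pose A' := iter_image R' (fun x => x \in grad M true).
have sA n : subspace (A n) by apply: (iter_image_subspace q_gt1); rewrite //; apply: grad_subspace.
have sA' n : subspace (A' n) by apply: (iter_image_subspace q_gt1); rewrite //; apply: grad_subspace.
have Ay : A D y by have /powE [xg Ry] := xy; exists x.
have nBy : ~ reach0 R y.
  move/(reach0_dim q_gt1 R0 RD RZ) => h; apply: n0y; apply/powE.
  by split=> //; apply: mem0v.
(* A path from 0 is lengthened by zeros; its last [n] steps then start in [S]. This places [reach0]
   inside the stable image. *)
have down (S : M -> Prop) (T : M -> M -> Prop) n z :
    (forall x y, T x y -> S y) -> S 0 -> T 0 0 -> reach0 T z -> iter_image T S n z.
  move=> TS S0 T0 [m zm].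
  have : iter_rel T (m + n) 0 z.
    by apply: (iter_rel0_leq T0) zm; apply: leq_addr.
  elim: m {zm} (0) S0 => [|m IHm] t St; first by exists t.
  by rewrite addSn => /iter_rel_front [t' /TS St']; apply: IHm.
have [s fs sE] := fixed_vectors_span q_gt1 q_pchar R0 RD RZ (sA D)
  (iter_image_back q_gt1 R0 RD RZ (grad_subspace _ _) Rg) (fun z => down _ _ _ z Rg (mem0v _) R0).
have [s' fs' sE'] := fixed_vectors_span q_gt1 q_pchar R0' RD' RZ' (sA' D)
  (iter_image_back q_gt1 R0' RD' RZ' (grad_subspace _ _) Rg') (fun z => down _ _ _ z Rg' (mem0v _) R0').
(* If all fixed vectors were in [reach0 R], so would be [y], which then lies in w^D(0), contrary to
   admissibility. *)
have [a [as_ nBa]] : exists a, a \in s /\ ~ reach0 R a.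
  apply: NNPP => nex; have [B BE] := subspace_vspace (reach0_subspace q_gt1 R0 RD RZ).
  apply: nBy; have [v vs yv] := sE y Ay; rewrite -(subrK v y).
  apply: (subspaceD (reach0_subspace q_gt1 R0 RD RZ)) => //.
  apply/BE; move: vs; apply/subvP/span_subvP => a as_; apply/BE.
  by apply: NNPP => nBa; apply: nex; exists a.
have [Aa Raa] := fs a as_.
have imS (S : M -> Prop) g v n (z : M) :
  iter_image (gpath g v) S n.+1 z <-> gpath_image g v (iter_image (gpath g v) S n) z.
  split=> [[x0 Sx0 [t x0t tz]] | [t [x0 Sx0 x0t] tz]]; first by exists t => //; exists x0.
  by exists x0 => //; exists t.
have sB n : subspace (iter_image R (@zero_pred k M) n).
  by apply: (iter_image_subspace q_gt1) => //; apply: zero_pred_subspace.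
have Bg n z : iter_image R (@zero_pred k M) n z -> z \in grad M false.
  by case: n => [|n] [_ ->] /= => [<- | [t _ /Rg] //]; apply: mem0v.
have A'g n z : A' n z -> z \in grad M true.
  by case: n => [|n] [x0 x0g] /= => [<- // | [t _ /Rg']].
(* For n = 0 the pair is 0 and M_1. For n = D it shows that [a], not lying in R^D(0), is not
   orthogonal to the stable image [A' D]. *)
have mp n : mutual_perp false (iter_image R (@zero_pred k M) n) (A' n).
  elim: n => [|n IHn]; last first.
    apply: (mutual_perp_ext (imS _ _ _ _) (imS _ _ _ _)) => //.
    by have := mutual_perp_image w (@Bg n) (@A'g n) IHn; rewrite w_even.
  split=> // [x0 x0g h | x0 x0g _]; last by exists x0.
  exists 0 => //=; apply/esym/(grad_nondegenerate hM x0g) => t tg; apply: h.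
  by exists t.
have [y' A'y' ay'] : exists2 y', A' D y' & pairing a y' <> 0.
  apply: NNPP => nex; apply: nBa; exists D.
  have [_ _ mpD _] := mp D; have [||z -> //] := mpD a.
    by have [] := gpath_grad Raa.
  by move=> t A't; apply: NNPP => at0; apply: nex; exists t.
have [v vs [n bn]] := sE' y' A'y'.
(* As [a] is fixed, its pairing with the end of a path is a power of its pairing with the start.
   Hence [a] is orthogonal to [reach0 R'], and [y'] may be replaced by its part in the span of fixed
   vectors. *)
have ab0 z n' : iter_rel R' n' 0 z -> pairing a z = 0.
  elim: n' z => [|n' IHn] z /=; first by move=> <-; apply: form0r symp _.
  by move=> [t /IHn at0 tz]; rewrite (pairing_gpath Raa tz) at0 expr0n expn_eq0 (gtn_eqF (prime_gt0 p_prime)).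
have av : pairing a v <> 0.
  by rewrite -[v](subKr y') (formDr symp) (formNr symp) (ab0 _ _ bn) oppr0 addr0.
have [b bs ab] : exists2 b, b \in s' & pairing a b <> 0.
  apply: NNPP => nex; apply: av.
  have [U UE] := subspace_vspace (form_perp_subspace symp a).
  rewrite (formC symp); apply/eqP; rewrite oppr_eq0; apply/eqP/UE.
  move: vs; apply/subvP/span_subvP => b bs; apply/UE; rewrite (formC symp).
  by apply/eqP; rewrite oppr_eq0; apply/eqP; apply: NNPP => ab; apply: nex; exists b.
by exists a, b; split=> //; case: (fs' b bs).
Qed.

End DualChains.

(** * Straightening of frames *)

Section UnipotentIterates.

Variables (k : closedFieldType) (p : nat) (V : vectType k).
Hypothesis charp : p \in [pchar k].

Lemma linear_sumE (h : V -> V) m (c : 'I_m -> k) (F : 'I_m -> V) : linear h ->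
  h (\sum_i c i *: F i) = \sum_i c i *: h (F i).
Proof.
move=> lin_h; pose H : {linear V -> V} := HB.pack h (GRing.isLinear.Build _ _ _ _ h lin_h).
by rewrite -[h]/(H : V -> V) linear_sum; apply: eq_bigr => i _; rewrite linearZ.
Qed.

Lemma iter_linear (h : V -> V) n : linear h -> linear (iter n h).
Proof. by move=> lin_h; elim: n => // n IHn a x y; rewrite !iterS (IHn a x y) lin_h. Qed.

Lemma iter_binomial (x h : V -> V) : linear h -> (forall v, x v = v + h v) ->
  forall n v, iter n x v = \sum_(i < n.+1) 'C(n, i)%:R *: iter i h v.
Proof.
move=> lin_h xE; elim=> [|n IHn] v; first by rewrite big_ord1 bin0 scale1r.
rewrite iterS xE IHn linear_sumE //.
have -> : \sum_(i < n.+1) 'C(n, i)%:R *: iter i h v =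
          \sum_(i < n.+2) 'C(n, i)%:R *: iter i h v.
  by rewrite [RHS]big_ord_recr /= bin_small // scale0r addr0.
rewrite [RHS]big_ord_recl [in LHS]big_ord_recl !bin0 -addrA; congr (_ + _).
by rewrite -big_split; apply: eq_bigr => i _; rewrite /= binS natrD scalerDl.
Qed.

(** The binomial coefficients strictly between the ends vanish in characteristic p, so (1 + h)^p = 1
    + h^p. *)
Lemma iter_unipotent_p (x h : V -> V) : linear h -> (forall v, x v = v + h v) ->
  forall v, iter p x v = v + iter p h v.
Proof.
move=> lin_h xE v; have p_pr := pcharf_prime charp.
rewrite (iter_binomial lin_h xE) big_ord_recl bin0 scale1r; congr (_ + _).
case: p p_pr charp => // n p_pr charn; rewrite big_ord_recr /= /bump leq0n add1n binn scale1r.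
rewrite big1 ?add0r // => i _; rewrite (_ : _%:R = 0) ?scale0r //.
apply/eqP; rewrite -(dvdn_pcharf charn) prime_dvd_bin // /bump /=.
by have := ltn_ord i; lia.
Qed.

Lemma iter_unipotent (x h : V -> V) : linear h -> (forall v, x v = v + h v) ->
  forall s v, iter (p ^ s) x v = v + iter (p ^ s) h v.
Proof.
move=> lin_h xE; elim=> [|s IHs] v; first by rewrite /= xE.
rewrite expnS !iterM; apply: iter_unipotent_p => //; exact: iter_linear.
Qed.

End UnipotentIterates.

Section FrameCorrection.

Variables (k : closedFieldType) (p : nat).
Hypotheses (charp : p \in [pchar k]) (p_gt2 : (2 < p)%N).
Variable M : ufv_module k.
Hypothesis hM : is_unitary_BT1 p M.
Let symp := unitary_symplectic hM.
Let p_prime : prime p := pcharf_prime charp.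

Variables (I : finType) (e : I -> M) (L : I -> letter) (g : I -> bool).
Variables (st s : I -> I) (kap : I -> k) (r : I -> nat).
Hypotheses (stK : involutive st) (s_inj : injective s).
Hypothesis st_s : forall i, st (s i) = s (st i).
Hypothesis L_st : forall i, L (st i) = dual_letter (L i).
Hypothesis g_st : forall i, g (st i) = ~~ g i.
Hypothesis step : forall i, gstep (g i) (L i) (e i) (e (s i)).
Hypothesis kap_neq0 : forall i, kap i != 0.
Hypothesis kap_st : forall i, kap (st i) = - kap i.
Hypothesis kap_s : forall i, kap (s i) = kap i ^+ p.
Hypothesis e_kap : forall i, pairing (e i) (e (st i)) = kap i.
Hypothesis triangular :
  forall i j, j != i -> pairing (e j) (e (st i)) != 0 -> (r j < r i)%N.

(** For a frame whose Gram matrix is already the standard one, this formula is the expansion of a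
    vector of the span, that is, the identity there. In general it is the quotient of the actual by
    the standard Gram matrix, realised on M. *)
Definition frame_endo (m : M) : M := \sum_i ((kap i)^-1 * pairing m (e (st i))) *: e i.

Lemma frame_endo_linear : linear frame_endo.
Proof.
move=> a x y; rewrite /frame_endo scaler_sumr -big_split; apply: eq_bigr => i _ /=.
by rewrite (formDl symp) (formZl symp) scalerA -scalerDl mulrDr mulrCA.
Qed.

(** Where [L i] is [lf], terms match by adjunction, because [e (s i)] is F of [e i] and [e (st i)]
    is V of [e (s (st i))]. Where it is [lv], both terms vanish since FV = VF = 0. *)
Lemma frame_endo_frob m : frame_endo (frob m) = frob (frame_endo m).
Proof.
have frob_sum (F : I -> M) : frob (\sum_i F i) = \sum_i frob (F i).
  by apply: (big_morph _ (frobD hM) (frob0 hM)).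
rewrite /frame_endo frob_sum (reindex_inj s_inj); apply: eq_bigr => i _.
rewrite (frobZ hM) (pairing_frobl hM) kap_s exprMn exprVn st_s.
have [] := step i; have [] := step (st i); rewrite L_st; case: (L i) => /= _ _ + _ _ +.
  by move=> -> ->.
move=> -> ->; rewrite (vers_frob hM) (frob_vers hM) (form0r symp) expr0n.
by rewrite gtn_eqF ?prime_gt0 // mulr0 scale0r scaler0.
Qed.

Lemma frame_endo_vers m : frame_endo (vers m) = vers (frame_endo m).
Proof.
have vers_sum (F : I -> M) : vers (\sum_i F i) = \sum_i vers (F i).
  by apply: (big_morph _ (versD hM) (vers0 hM)).
rewrite /frame_endo vers_sum [RHS](reindex_inj s_inj); apply: eq_bigr => i _.
rewrite (versZ charp hM) kap_s st_s.
have [] := step i; have [] := step (st i); rewrite L_st; case: (L i) => /= _ _ + _ _ +.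
  move=> -> ->; rewrite (vers_frob hM) scaler0.
  suff -> : pairing (vers m) (vers (e (s (st i)))) = 0 by rewrite mulr0 scale0r.
  have : pairing (vers m) (vers (e (s (st i)))) ^+ p = 0.
    by rewrite -(pairing_frobr charp hM) (frob_vers hM) (form0r symp).
  by move/eqP; rewrite expf_eq0 => /andP [_ /eqP].
move=> -> ->; rewrite (pairing_frobr charp hM) -exprVn -exprMn (prootX charp).
by [].
Qed.

Lemma frame_endo_grad b m : m \in grad M b -> frame_endo m \in grad M b.
Proof.
move=> mb; apply: rpred_sum => i _; have [gi _ _] := step i.
have [<- | nb] := eqVneq (g i) b; first exact: rpredZ.
have [ei _ _] := step (st i); rewrite g_st in ei.
suff -> : pairing m (e (st i)) = 0 by rewrite mulr0 scale0r mem0v.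
by apply: (grad_isotropic hM mb); move: ei nb; case: (g i) b {mb} => -[].
Qed.

(** Exchanging [i] with [st i] changes the sign of [kap], which cancels the sign of the alternating
    form. *)
Lemma frame_endo_adjoint m m' : pairing (frame_endo m) m' = pairing m (frame_endo m').
Proof.
rewrite /frame_endo (form_suml symp) (form_sumr symp) [RHS](reindex_inj (inv_inj stK)).
apply: eq_bigr => i _; rewrite (formZl symp) (formZr symp) kap_st stK invrN.
by rewrite (formC symp m' (e i)) mulrNN mulrAC.
Qed.

Lemma iter_frame_endo_adjoint n m m' :
  pairing (iter n frame_endo m) m' = pairing m (iter n frame_endo m').
Proof. by elim: n m' => // n IHn m'; rewrite iterS frame_endo_adjoint IHn -iterSr. Qed.

Lemma gstep_iter_frame_endo n i : gstep (g i) (L i) (iter n frame_endo (e i)) (iter n frame_endo (e (s i))).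
Proof.
elim: n => [|n [xg yg E]] //=; split; try exact: frame_endo_grad.
by case: (L i) E => ->; rewrite ?frame_endo_frob ?frame_endo_vers.
Qed.

Definition frame_nil (m : M) : M := frame_endo m - m.

Lemma frame_nil_linear : linear frame_nil.
Proof.
move=> a x y; rewrite /frame_nil frame_endo_linear scalerBr opprD addrACA.
by [].
Qed.

Lemma frame_nilE i : frame_nil (e i) =
  \sum_(j | j != i) ((kap j)^-1 * pairing (e i) (e (st j))) *: e j.
Proof.
rewrite /frame_nil /frame_endo (bigD1 i) //= e_kap mulVf // scale1r.
by rewrite addrAC subrr add0r.
Qed.

(** By triangularity [frame_nil] raises the layer, and layers beyond the largest value of [r] are
    zero; this is how nilpotency on the frame is obtained. *)
Definition frame_layer (t : nat) : {vspace M} := (\sum_(i | (t <= r i)%N) <[e i]>)%VS.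

Lemma mem_frame_layer t i : (t <= r i)%N -> e i \in frame_layer t.
Proof. by move=> le_t; rewrite memvE (sumv_sup i). Qed.

Lemma frame_nil_layer t m : m \in frame_layer t -> frame_nil m \in frame_layer t.+1.
Proof.
case/memv_sumP => v v_e ->; have nil0 : frame_nil 0 = 0.
  by have := frame_nil_linear (-1) 0 0; rewrite scaler0 addr0 scaleN1r addNr.
rewrite (big_morph frame_nil (id1 := 0) (op1 := +%R)) //; last first.
  by move=> x y; rewrite -[x]scale1r frame_nil_linear !scale1r.
apply: rpred_sum => i le_t; have /vlineP [c ->] := v_e i le_t.
rewrite -[c *: _]addr0 frame_nil_linear nil0 addr0 rpredZ // frame_nilE.
apply: rpred_sum => j ji.
have [-> | nz] := eqVneq (pairing (e i) (e (st j))) 0.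
  by rewrite mulr0 scale0r mem0v.
rewrite rpredZ // mem_frame_layer // (leq_ltn_trans le_t) //.
by apply: triangular nz; rewrite eq_sym.
Qed.

Lemma iter_frame_nil i : exists n0, forall n, (n0 <= n)%N -> iter n frame_nil (e i) = 0.
Proof.
exists (\sum_j r j).+1 => n le_n.
have : iter n frame_nil (e i) \in frame_layer n.
  elim: n {le_n} => [|n IHn]; first exact: mem_frame_layer.
  exact: frame_nil_layer.
rewrite /frame_layer big_pred0 ?memv0 => [/eqP // | j].
by apply/negbTE; rewrite -ltnNge (leq_trans _ le_n) // ltnS (bigD1 j) //= leq_addr.
Qed.

(** Once p^t exceeds all nilpotency indices, (1 + h)^(p^t) = 1 + h^(p^t) fixes the frame, with h =
    [frame_nil]. *)
Lemma frame_endo_torsion : exists t, forall i, iter (p ^ t) frame_endo (e i) = e i.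
Proof.
have [n0 n0E] := functional_choice _ iter_frame_nil.
exists (\sum_i n0 i)%N => i.
rewrite (iter_unipotent charp frame_nil_linear) => [|v]; last by rewrite addrC subrK.
rewrite n0E ?addr0 // (leq_trans _ (ltnW (ltn_expl _ (prime_gt1 p_prime)))) //.
by rewrite (bigD1 i) //= leq_addr.
Qed.

Lemma frame_independent (c : I -> k) : \sum_i c i *: e i = 0 -> forall i, c i = 0.
Proof.
apply: (@graded_independent _ _ _ e r (fun i m => pairing m (e (st i)) = 0)).
- by move=> i; apply: form_perp_subspace.
- by move=> i; rewrite e_kap; apply/eqP.
- move=> i j ji le_r; apply/eqP/negPn/negP => /(triangular ji).
  by rewrite ltnNge le_r.
Qed.

(* The Gram matrix of [e] is K times the matrix of the unipotent self-adjoint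
   endomorphism [frame_endo], so a square root of its inverse, namely the power
   (p^t - 1) / 2, straightens [e]. *)
Lemma frame_correction : exists f : I -> M,
  (forall i, gstep (g i) (L i) (f i) (f (s i))) /\
  (forall i j, pairing (f i) (f j) = if j == st i then kap i else 0).
Proof.
have [t tE] := frame_endo_torsion; pose m := (p ^ t)./2.
have odd_pt : odd (p ^ t).
  by rewrite oddX; case: (even_prime p_prime) p_gt2 => [-> | ->] //; rewrite orbT.
have ptE : (p ^ t = (m + m).+1)%N.
  by rewrite addnn -[LHS]odd_double_half odd_pt.
exists (fun i => iter m frame_endo (e i)); split=> [i | i j].
  exact: gstep_iter_frame_endo.
rewrite -iter_frame_endo_adjoint -iterD.
set y := iter (m + m) _ _; have yE : frame_endo y = e i by rewrite /y -iterS -ptE tE.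
(* Writing [frame_endo y = e i] in the independent frame gives the pairings of [y] with all
   [e (st l)]; these are the wanted Gram entries, as 2m + 1 = p^t. *)
have /frame_independent h : \sum_l ((kap l)^-1 * pairing y (e (st l)) - (l == i)%:R) *: e l = 0.
  under eq_bigr do rewrite scalerBl; rewrite sumrB -/(frame_endo y) yE.
  rewrite (bigD1 i) //= eqxx scale1r big1 ?addr0 ?subrr // => l /negbTE ->.
  by rewrite scale0r.
have /eqP := h (st j); rewrite stK subr_eq0 => /eqP hj.
have -> : pairing y (e j) = kap (st j) * (st j == i)%:R by rewrite -hj mulVKf.
rewrite (inv_eq stK); have [-> | _] := eqVneq j (st i); last by rewrite mulr0.
by rewrite stK mulr1.
Qed.

End FrameCorrection.

(** * Chains along infinite words *)

Definition periodic_word (w : word) (i : nat) : letter := letter_at w (i %% size w).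

Definition dual_seq (u : nat -> letter) (i : nat) : letter := dual_letter (u i).

Definition shift (T : Type) (i : nat) (u : nat -> T) (l : nat) : T := u (i + l)%N.

Definition periodic (T : Type) (n : nat) (u : nat -> T) : Prop :=
  forall i, u (i + n)%N = u i.

Lemma dual_letterK : involutive dual_letter.
Proof. by case. Qed.

Lemma periodic_mod (T : Type) n (u : nat -> T) i : periodic n u -> u (i %% n)%N = u i.
Proof.
move=> per_u; rewrite {2}(divn_eq i n) addnC; elim: (i %/ n)%N => [|m IHm].
  by rewrite mul0n addn0.
by rewrite mulSn addnCA addnC per_u.
Qed.

Lemma periodic_word_periodic w : periodic (size w) (periodic_word w).
Proof. by move=> i; rewrite /periodic_word modnDr. Qed.

Lemma periodic_word_dual w i : (0 < size w)%N ->
  periodic_word (dual w) i = dual_letter (periodic_word w i).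
Proof.
move=> w_gt0; rewrite /periodic_word /letter_at size_map -map_rev (nth_map lf) //.
by rewrite size_rev ltn_mod.
Qed.

(* Truncation of the forward lexicographic order, with [lf] before [lv]. *)
Fixpoint lex_code (n : nat) (u : nat -> letter) : nat :=
  if n is m.+1 then ((u 0 == lv) * 2 ^ m + lex_code m (shift 1 u))%N else 0%N.

Lemma eq_lex_code n u u' : u =1 u' -> lex_code n u = lex_code n u'.
Proof.
by elim: n u u' => //= n IHn u u' e; rewrite e (IHn _ (shift 1 u')) // => l; apply: e.
Qed.

Lemma lex_code_lt n u : (lex_code n u < 2 ^ n)%N.
Proof.
elim: n u => //= n IHn u; have := IHn (shift 1 u); rewrite expnS.
by case: (u 0 == lv); lia.
Qed.

(** It says that [u] precedes or equals [u']. The negative form avoids having to locate a first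
    difference of two infinite words. *)
Definition lex_above (u u' : nat -> letter) : Prop :=
  forall m, (forall l, (l < m)%N -> u l = u' l) -> ~ (u m = lv /\ u' m = lf).

Lemma lex_code_above n u u' : lex_above u u' ->
  (lex_code n u <= lex_code n u')%N /\
  (lex_code n u = lex_code n u' -> forall l, (l < n)%N -> u l = u' l).
Proof.
elim: n u u' => // n IHn u u' ab /=.
have [e | ne] := eqVneq (u 0) (u' 0).
  have [|le eq] := IHn (shift 1 u) (shift 1 u').
    by move=> m lm; apply: (ab m.+1) => -[|l] //; apply: lm.
  rewrite e; split; first by rewrite leq_add2l.
  by move/addnI/eq => eql [|l] //; apply: eql.
have := lex_code_lt n (shift 1 u); have := lex_code_lt n (shift 1 u').
have := ab 0; case: (u 0) (u' 0) ne => -[] //=.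
  by rewrite mul0n mul1n => _ _; lia.
by move=> _ [].
Qed.

Section Chains.

Variables (k : closedFieldType) (p : nat).
Hypotheses (charp : p \in [pchar k]) (p_gt2 : (2 < p)%N).
Variable M : ufv_module k.
Hypothesis hM : is_unitary_BT1 p M.
Let symp := unitary_symplectic hM.
Let p_prime : prime p := pcharf_prime charp.

Definition chain (g : bool) (u : nat -> letter) (a : nat -> M) : Prop :=
  forall i, gstep (g (+) odd i) (u i) (a i) (a i.+1).

Lemma chain_grad g u a i : chain g u a -> a i \in grad M (g (+) odd i).
Proof. by move=> /(_ i) []. Qed.

Lemma chain_shift g u a i : chain g u a -> chain (g (+) odd i) (shift i u) (shift i a).
Proof. by move=> ch j; have := ch (i + j)%N; rewrite oddD addbA /shift addnS. Qed.

Lemma chainD g u a b : chain g u a -> chain g u b -> chain g u (fun i => a i + b i).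
Proof. by move=> ca cb i; apply: (gstepD hM). Qed.

Lemma chainZ g u a t : chain g u a -> chain g u (fun i => t ^+ (p ^ i) *: a i).
Proof. by move=> ca i; rewrite expnSr exprM; apply: (gstepZ hM). Qed.

Lemma eq_chain g u u' a : u =1 u' -> chain g u a -> chain g u' a.
Proof. by move=> e ca i; rewrite -e. Qed.

Lemma chain_pairing g u a b i : chain g u a -> chain (~~ g) (dual_seq u) b ->
  pairing (a i) (b i) = pairing (a 0) (b 0) ^+ (p ^ i).
Proof.
move=> ca cb; elim: i => [|i IHi]; first by rewrite expr1.
have := cb i; rewrite addNb => cbi.
by rewrite (pairing_gstep charp hM (ca i) cbi) IHi -exprM expnSr.
Qed.

(* The values of the pairing along two chains are Frobenius powers of each other
   as long as the letters are dual; they vanish when both letters are [lv], since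
   the image of V is isotropic. *)
Lemma chain_lex_above g u a g' u' b : chain g u a -> chain g' u' b ->
  pairing (a 0) (b 0) != 0 -> lex_above u (dual_seq u').
Proof.
move=> ca cb ab0 m; elim: m g u a g' u' b ca cb ab0 => [|m IHm] g u a g' u' b ca cb ab0 e.
  case=> u0 u0'; have [_ _ a0] := ca 0; have [_ _ b0] := cb 0.
  have u'0 : u' 0 = lv by move: u0'; rewrite /dual_seq; case: (u' 0).
  rewrite u0 in a0; rewrite u'0 in b0; case/eqP: ab0; rewrite a0 b0.
  have : pairing (vers (a 1)) (vers (b 1)) ^+ p = 0.
    by rewrite -(pairing_frobr charp hM) (frob_vers hM) (form0r symp).
  by move/eqP; rewrite expf_eq0 => /andP [_ /eqP].
apply: (IHm _ _ _ _ _ _ (chain_shift 1 ca) (chain_shift 1 cb)); last first.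
  by move=> l lm; apply: (e l.+1).
have u'0 : u' 0 = dual_letter (u 0) by rewrite (e 0) // /dual_seq dual_letterK.
have [_ _ a0] := ca 0; have [_ _ b0] := cb 0; rewrite /shift u'0 in b0 *.
apply: contra ab0 => /eqP ab1.
have : pairing (a 0) (b 0) ^+ p = 0.
  case: (u 0) a0 b0 => /= a0 b0.
    by rewrite b0 -(pairing_frobl hM) -a0.
  by rewrite a0 -(pairing_frobr charp hM) -b0.
by move/eqP; rewrite expf_eq0 => /andP [_].
Qed.

Lemma gpath_chain g w x y : gpath (M := M) g w x y -> exists a : nat -> M,
  [/\ a 0 = x, a (size w) = y
    & forall i, (i < size w)%N -> gstep (g (+) odd i) (nth lf w i) (a i) (a i.+1)].
Proof.
elim: w g x => [|u w IHw] g x /=; first by move=> [-> _]; exists (fun=> y).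
move=> [z xz /IHw [a [a0 an aS]]].
exists (fun i => if i is j.+1 then a j else x); split=> // -[|i] /=.
  by rewrite addbF a0.
by rewrite ltnS addbN -addNb; apply: aS.
Qed.

Lemma closed_chain g w x : (0 < size w)%N -> ~~ odd (size w) ->
    gpath (M := M) g (rev w) x x ->
  exists a, [/\ a 0 = x, chain g (periodic_word w) a & periodic (size w) a].
Proof.
move=> w_gt0 /negbTE w_even /gpath_chain [a [a0 an aS]]; rewrite size_rev in an aS.
exists (fun i => a (i %% size w)%N); split=> [|i|i]; rewrite ?mod0n ?modnDr //.
have lt : (i %% size w < size w)%N by rewrite ltn_mod.
have := aS _ lt; rewrite odd_mod // -/(letter_at w _) -/(periodic_word w i).
suff -> : a (i %% size w).+1 = a (i.+1 %% size w)%N by [].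
rewrite -addn1 -[in RHS]addn1 -modnDml addn1.
move: lt; rewrite leq_eqVlt => /predU1P [-> | lt]; first by rewrite modnn an a0.
by rewrite (modn_small lt).
Qed.

End Chains.

(** Only positions of equal parity are compared: in a word zz with z odd, shifts by the length of z
    look alike but start in different degrees. *)
Definition separated (n : nat) (u : nat -> letter) : Prop :=
  forall i j, (i < n)%N -> (j < n)%N -> odd i = odd j ->
  (forall l, shift i u l = shift j u l) -> i = j.

Lemma shift_periodic (T : Type) n i (u : nat -> T) : periodic n u -> periodic n (shift i u).
Proof. by move=> per_u j; rewrite /shift addnA per_u. Qed.

Lemma dual_seq_periodic n u : periodic n u -> periodic n (dual_seq u).
Proof. by move=> per_u j; rewrite /dual_seq per_u. Qed.

Lemma eq_periodic (T : Type) n (u u' : nat -> T) : (0 < n)%N -> periodic n u -> periodic n u' ->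
  (forall l, (l < n)%N -> u l = u' l) -> u =1 u'.
Proof.
by move=> n_gt0 pu pu' e l; rewrite -(periodic_mod l pu) -(periodic_mod l pu') e ?ltn_mod.
Qed.

(** * Cycles with standard Gram matrix *)

Section ExactCycles.

Variables (k : closedFieldType) (p : nat).
Hypotheses (charp : p \in [pchar k]) (p_gt2 : (2 < p)%N).
Variable M : ufv_module k.
Hypothesis hM : is_unitary_BT1 p M.
Let symp := unitary_symplectic hM.
Let p_prime : prime p := pcharf_prime charp.

Variables (n : nat) (u : nat -> letter).
Hypotheses (n_gt0 : (0 < n)%N) (n_even : odd n = false) (per_u : periodic n u).
Hypothesis sep_u : separated n u.

Let idx (i : nat) : 'I_n := Ordinal (ltn_pmod i n_gt0).

Let idxS i : idx i.+1 = ordS (idx i).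
Proof. by apply/val_inj; rewrite /= -addn1 -modnDml addn1. Qed.

(** A nonzero pairing gives a lexicographic inequality. The words have period [n], so equality of
    their codes of length [n] already means equality of the infinite words. *)
Lemma lex_code_triangular g g' (v v' w : nat -> letter) (a b : nat -> M) :
    periodic n v -> periodic n v' -> w =1 dual_seq v' -> chain g v a -> chain g' v' b ->
    pairing (a 0) (b 0) != 0 ->
  (lex_code n v < lex_code n w)%N \/ v =1 w.
Proof.
move=> pv pv' e_w ca cb ab; have ab' := chain_lex_above charp hM ca cb ab.
have [] := lex_code_above n ab'; rewrite -(eq_lex_code n e_w) leq_eqVlt.
case/predU1P=> [e | ]; last by left.
move=> /(_ e) eql; right=> l; rewrite e_w.
by apply: (eq_periodic _ _ _ eql) => //; apply: dual_seq_periodic.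
Qed.

Lemma exact_pair_of_chains (a b : nat -> M) :
    (forall i j, odd i != odd j -> ~ (forall l, shift i u l = dual_letter (shift j u l))) ->
    chain false u a -> chain true (dual_seq u) b -> periodic n a -> periodic n b ->
    pairing (a 0) (b 0) = 1 ->
  exists a' b' : nat -> M,
    [/\ chain false u a', chain true (dual_seq u) b', periodic n a' /\ periodic n b',
        forall i j, pairing (a' i) (b' j) = (i == j %[mod n])%:R
      & forall i j, pairing (a' i) (a' j) = 0 /\ pairing (b' i) (b' j) = 0].
Proof.
move=> nd ca cb pa pb ab.
(* The flag selects between the two chains, [st] exchanges them, and the sign in [kap] records that
   the form is alternating. *)
pose e (x : bool * 'I_n) := if x.1 then b x.2 else a x.2.
pose W (x : bool) := if x then dual_seq u else u.
have ce (x : bool * 'I_n) : chain (x.1 (+) odd x.2) (shift x.2 (W x.1)) (shift x.2 (if x.1 then b else a)).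
  by case: x => -[] i; [apply: (chain_shift i cb) | apply: (chain_shift i ca)].
have pW x : periodic n (W x) by case: x => //; apply: dual_seq_periodic.
have odd_mod_n i : odd (i %% n) = odd i by rewrite odd_mod.
pose st (x : bool * 'I_n) := (~~ x.1, x.2); pose s (x : bool * 'I_n) := (x.1, ordS x.2).
pose kap (x : bool * 'I_n) : k := if x.1 then -1 else 1.
have ab1 i : pairing (a i) (b i) = 1 by rewrite (chain_pairing charp hM i ca cb) ab expr1n.
have eS x : e (s x) = (if x.1 then b else a) x.2.+1.
  by rewrite /e /=; case: (x.1); rewrite periodic_mod.
have eg x : e x \in grad M (x.1 (+) odd x.2).
  have := chain_grad 0 (ce x); rewrite /= addbF /shift addn0 /e.
  by case: (x.1).
have [|||||||||||f [fS fP]] := @frame_correction k p charp p_gt2 M hM _ e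
  (fun x => W x.1 x.2) (fun x => x.1 (+) odd x.2) st s kap
  (fun x => lex_code n (shift x.2 (W x.1))).
- by move=> [x i]; rewrite /st /= negbK.
- by move=> [x i] [y j] e'; have /= -> := congr1 fst e'; have /= /ordS_inj -> := congr1 snd e'.
- by [].
- by move=> [x i]; rewrite /W /=; case: x => //=; rewrite /dual_seq dual_letterK.
- by move=> [x i] /=; rewrite addNb.
- move=> x; rewrite eS /e; have := ce x 0; rewrite /shift addn0 addn1 addbF.
  by case: (x.1).
- by move=> [[] i]; rewrite /kap /= ?oppr_eq0 oner_eq0.
- by move=> [[] i]; rewrite /kap /= ?opprK.
- by move=> [[] i]; rewrite /kap /= ?expr1n // -[X in _ ^+ X]expn1 frob_powerN // expr1n.
- by move=> [[] i]; rewrite /kap /e /= ?ab1 // (formC symp) ab1.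
- move=> x y yx pxy; have gxy : y.1 (+) odd y.2 = x.1 (+) odd x.2.
    have [|ne] := eqVneq (y.1 (+) odd y.2) ((st x).1 (+) odd (st x).2).
      move=> e_g; case/eqP: pxy; apply: (grad_isotropic hM (eg y)).
      by rewrite e_g; apply: eg.
    by move: ne; rewrite /= addNb; case: (_ (+) _) (_ (+) _) => -[].
  have pe (z : bool * 'I_n) : (if z.1 then b else a) z.2 = e z by case: z => -[].
  have sP (z : bool * 'I_n) : periodic n (shift z.2 (W z.1)) by apply/shift_periodic/pW.
  have dW : shift x.2 (W x.1) =1 dual_seq (shift (st x).2 (W (st x).1)).
    by move=> l; rewrite /shift /dual_seq /=; case: (x.1); rewrite /W //= /dual_seq dual_letterK.
  have := lex_code_triangular (sP y) (sP (st x)) dW (ce y) (ce (st x)).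
  case=> [| // | eq_xy]; first by rewrite /shift !addn0 !pe.
  case/eqP: yx.
  (* Equal words on the same chain contradict separation unless the positions agree. On different
     chains equality of degrees makes the parities of the positions differ, which [nd] excludes. *)
  case: x y gxy {pxy dW} eq_xy => -[] i [[] j] /= gxy eq_xy.
  - congr (_, _); apply/val_inj/sep_u; rewrite ?ltn_ord //; first exact: negb_inj.
    move=> l; have := eq_xy l; rewrite /shift /dual_seq.
    by move/(can_inj dual_letterK).
  - case: (nd j i) => [|l]; last exact: eq_xy.
    by rewrite gxy; case: (odd i).
  - case: (nd i j) => [|l]; last exact/esym/eq_xy.
    by rewrite -gxy; case: (odd j).
  - by congr (_, _); apply/val_inj/sep_u; rewrite ?ltn_ord.
pose h x i := f (x, idx i).
exists (h false), (h true).
have ch x : chain x (W x) (h x).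
  move=> i; have := fS (x, idx i); rewrite /s /= odd_mod_n /h idxS.
  by rewrite (periodic_mod i (pW x)).
split.
- exact: ch.
- exact: ch.
- by split=> i; rewrite /h; congr (f (_, _)); apply/val_inj; rewrite /= modnDr.
- move=> i j; rewrite /h fP /st /kap xpair_eqE /= eq_sym.
  by rewrite -(inj_eq val_inj) /=; case: eqP.
- by move=> i j; rewrite /h !fP /st !xpair_eqE.
Qed.

(** As [l] is an odd antiperiod, the chain shifted by [l] runs along the dual word in the opposite
    degree, so one chain serves as its own partner. From c^(p^l) = -c the values c^(p^i) change sign
    under i -> i + l and have period [n]. *)
Lemma exact_self_chain (l : nat) (c : k) (a : nat -> M) :
    n = l.*2 -> odd l -> (forall i, u (i + l)%N = dual_letter (u i)) ->
    c != 0 -> c ^+ (p ^ l) = - c ->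
    chain false u a -> periodic n a -> pairing (a 0) (a l) = c ->
  exists a' : nat -> M, [/\ chain false u a', periodic n a'
    & forall i j, pairing (a' i) (a' j) =
        if j == i + l %[mod n] then c ^+ (p ^ (i %% n)) else 0].
Proof.
move=> nE l_odd u_l c0 cl ca pa al.
pose K i := c ^+ (p ^ i).
have K_l i : K (i + l)%N = - K i.
  by rewrite /K addnC expnD exprM cl frob_powerN.
have K_mod i : K (i %% n)%N = K i.
  by apply: periodic_mod => j; rewrite nE -addnn addnA !K_l opprK.
have odd_mod_n i : odd (i %% n) = odd i by rewrite odd_mod.
pose st (i : 'I_n) := idx (i + l).
have a_st (i : 'I_n) : a (st i) = a (i + l)%N by rewrite /= (periodic_mod _ pa).
have stS (i : 'I_n) : st (ordS i) = ordS (st i).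
  by apply/val_inj; rewrite /= modnDml -[in RHS]addn1 modnDml addn1 addSn.
have ci i : chain (odd i) (shift i u) (shift i a) := chain_shift i ca.
have al' i : pairing (a i) (a (i + l)%N) = K i.
  have cal : chain true (dual_seq u) (fun j => a (j + l)%N).
    by move=> j; have := ci l j; rewrite l_odd /shift addnS (addnC l) /dual_seq u_l addSn.
  by rewrite (chain_pairing charp hM i ca cal) /= add0n al.
have [|||||||||||f [fS fP]] := @frame_correction k p charp p_gt2 M hM _
  (fun i : 'I_n => a i) (fun i => u i) (fun i => odd i) st (@ordS n) (fun i => K i)
  (fun i => lex_code n (shift i u)).
- by move=> i; apply/val_inj; rewrite /= modnDml -addnA addnn -nE modnDr modn_small.
- exact: ordS_inj.
- exact: stS.
- by move=> i; rewrite /= (periodic_mod _ per_u) u_l.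
- by move=> i; rewrite /= odd_mod_n oddD l_odd addbT.
- move=> i; have := ci i 0; rewrite /shift addn0 addn1 addbF /=.
  by rewrite (periodic_mod _ pa).
- by move=> i; rewrite expf_neq0.
- by move=> i; rewrite /= K_mod K_l.
- by move=> i; rewrite /= K_mod /K expnSr exprM.
- by move=> i; rewrite a_st al'.
- move=> i j ji; rewrite a_st => pij.
  have gij : odd j = odd i.
    apply/eqP/negPn/negP => ne; case/eqP: pij; apply: (grad_isotropic hM (g := odd j)).
      by have [] := ca j.
    have [] := ca (i + l)%N; rewrite oddD l_odd addbT /= => + _ _.
    by case: (odd i) (odd j) ne => -[].
  have dW : shift i u =1 dual_seq (shift (i + l) u).
    by move=> m; rewrite /dual_seq /shift addnAC u_l dual_letterK.
  have sP m : periodic n (shift m u) by apply: shift_periodic.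
  case: (lex_code_triangular (sP j) (sP (i + l)%N) dW (ci j) (ci (i + l)%N)) => [|//|e].
    by rewrite /shift !addn0.
  by case/eqP: ji; apply/val_inj/sep_u; rewrite ?ltn_ord.
have fc : chain false u (fun i => f (idx i)).
  by move=> i; have := fS (idx i); rewrite /= odd_mod_n (periodic_mod _ per_u) idxS.
exists (fun i => f (idx i)); split=> // [i | i j].
  by congr f; apply/val_inj; rewrite /= modnDr.
rewrite fP -(inj_eq val_inj) /= modnDml.
by [].
Qed.

End ExactCycles.

(** * The standard modules *)

Section CyclicModule.

Variables (k : closedFieldType) (p : nat).
Hypothesis charp : p \in [pchar k].
Let p_prime : prime p := pcharf_prime charp.
Let p_gt0 : (0 < p)%N := prime_gt0 p_prime.

Lemma prootD (x y : k) : proot p (x + y) = proot p x + proot p y.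
Proof.
apply: (@frob_power_inj _ _ charp 1).
by rewrite frob_powerD // expn1 !prootK.
Qed.

Lemma prootM (x y : k) : proot p (x * y) = proot p x * proot p y.
Proof. by apply: (@frob_power_inj _ _ charp 1); rewrite /= expn1 exprMn !prootK. Qed.

Lemma frob_power1D (x y : k) : (x + y) ^+ p = x ^+ p + y ^+ p.
Proof. by have := frob_powerD charp 1 x y; rewrite expn1. Qed.

Variable w : word.
Local Notation n := (size w).

Lemma reindex_ordS (R : Type) (idx : R) (op : Monoid.com_law idx) m (F : 'I_m -> R) :
  \big[op/idx]_i F i = \big[op/idx]_i F (ordS i).
Proof. by rewrite (reindex_inj (@ordS_inj m)). Qed.

Lemma bvecE (i j : 'I_n) : bvec k i 0 j = (j == i)%:R.
Proof. by rewrite /bvec mxE eqxx. Qed.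

Lemma Mbar_frobE (x : Mbar k p w) (j : 'I_n) :
  (frob x : 'rV[k]_n) 0 (ordS j) =
    if letter_at w j == lf then (x : 'rV[k]_n) 0 j ^+ p else 0.
Proof.
rewrite /= summxE big_mkcond /= (bigD1 j) //= big1 ?addr0 => [|i /negbTE ij].
  by case: ifP => // _; rewrite !mxE !eqxx mulr1.
by case: ifP => // _; rewrite !mxE eqxx /= (inj_eq (@ordS_inj n)) eq_sym ij mulr0.
Qed.

Lemma Mbar_versE (x : Mbar k p w) (j : 'I_n) :
  (vers x : 'rV[k]_n) 0 j =
    if letter_at w j == lv then proot p ((x : 'rV[k]_n) 0 (ordS j)) else 0.
Proof.
rewrite /= summxE big_mkcond /= (bigD1 j) //= big1 ?addr0 => [|i /negbTE ij].
  by case: ifP => // _; rewrite !mxE !eqxx mulr1.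
by case: ifP => // _; rewrite !mxE eqxx /= eq_sym ij mulr0.
Qed.

Lemma ordS_rowP (x y : 'rV[k]_n) : (forall j, x 0 (ordS j) = y 0 (ordS j)) -> x = y.
Proof. by move=> e; apply/rowP => j; rewrite -(ord_predK j). Qed.

(** F shifts the coordinates at [lf] and kills those at [lv], and V acts backwards at [lv] alone;
    kernels and images are therefore matching coordinate subspaces. *)
Lemma Mbar_BT1 : is_BT1 p (Mbar k p w).
Proof.
split.
- split=> [x y | a x]; apply: ordS_rowP => j; rewrite Mbar_frobE !mxE !Mbar_frobE.
    by case: ifP; rewrite ?addr0 // frob_power1D.
  by case: ifP; rewrite ?mulr0 // exprMn.
- split=> [x y | a x]; apply/rowP => j; rewrite Mbar_versE !mxE !Mbar_versE.
    by case: ifP; rewrite ?addr0 // prootD.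
  by case: ifP; rewrite ?mulr0 // prootM (prootX charp).
- move=> x; split=> [/rowP x0 | [y ->]].
    exists (\row_j ((x : 'rV[k]_n) 0 (ord_pred j)) ^+ p); apply/rowP => j.
    rewrite Mbar_versE !mxE ordSK (prootX charp).
    have := x0 (ordS j); rewrite Mbar_frobE mxE; case: (letter_at w j) => //= /eqP.
    by rewrite expf_eq0 => /andP [_ /eqP].
  apply: ordS_rowP => j; rewrite Mbar_frobE Mbar_versE mxE.
  by case: (letter_at w j) => //=; rewrite expr0n gtn_eqF.
- move=> x; split=> [/rowP x0 | [y ->]].
    exists (\row_j proot p ((x : 'rV[k]_n) 0 (ordS j))); apply: ordS_rowP => j.
    rewrite Mbar_frobE !mxE prootK //.
    have := x0 j; rewrite Mbar_versE mxE; case: (letter_at w j) => //= /eqP.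
    by rewrite -(inj_eq (@frob_power_inj _ _ charp 1)) /= expn1 prootK // expr0n gtn_eqF // => /eqP.
  apply/rowP => j; rewrite Mbar_versE Mbar_frobE mxE.
  by case: (letter_at w j) => //=; rewrite (proot0 charp).
Qed.

Lemma mem_parity_span b (x : 'rV[k]_n) :
  reflect (forall j : 'I_n, odd j != b -> x 0 j = 0)
    (x \in (\sum_(j < n | odd j == b) <[bvec k j]>)%VS).
Proof.
apply: (iffP idP) => [/memv_sumP [v v_e ->] j jb | x0].
  rewrite summxE big1 // => i ib; have /vlineP [a ->] := v_e i ib.
  rewrite !mxE eqxx /=; case: eqP => [ji | _]; last by rewrite mulr0.
  by rewrite ji ib in jb.
rewrite [x]row_sum_delta (bigID (fun j : 'I_n => odd j == b)) /= [X in _ + X]big1 ?addr0.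
  by apply: memv_sumr => j _; rewrite memvZ ?memv_line.
by move=> j jb; rewrite x0 // scale0r.
Qed.

Variable M : ufv_module k.
Hypothesis hM : is_unitary_BT1 p M.

Definition chain_map (a : nat -> M) (x : 'rV[k]_n) : M := \sum_j x 0 j *: a j.

Lemma chain_map_linear a : linear (chain_map a).
Proof.
move=> t x y; rewrite /chain_map scaler_sumr -big_split; apply: eq_bigr => j _ /=.
by rewrite !mxE scalerDl scalerA.
Qed.

Lemma pairing_chain_map (w' : word) a b (x : 'rV[k]_n) (y : 'rV[k]_(size w')) :
  pairing (chain_map a x) (\sum_j y 0 j *: b j) =
  \sum_i \sum_j x 0 i * y 0 j * pairing (a i) (b j).
Proof.
have symp := unitary_symplectic hM; rewrite /chain_map (form_suml symp).
apply: eq_bigr => i _; rewrite (form_sumr symp); apply: eq_bigr => j _.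
by rewrite (formZl symp) (formZr symp) mulrA.
Qed.

Variables (g : bool) (a : nat -> M).
Hypotheses (ca : chain g (periodic_word w) a) (pa : periodic n a).

Lemma periodic_word_ord (j : 'I_n) : periodic_word w j = letter_at w j.
Proof. by rewrite /periodic_word modn_small. Qed.

Lemma chain_map_frob x : chain_map a (frob (x : Mbar k p w)) = frob (chain_map a x).
Proof.
rewrite /chain_map (big_morph _ (frobD hM) (frob0 hM)) reindex_ordS.
apply: eq_bigr => j _; rewrite (frobZ hM) Mbar_frobE /= (periodic_mod _ pa).
have [_ _] := ca j; rewrite periodic_word_ord.
by case: (letter_at w j) => //= ->; rewrite ?(frob_vers hM) ?scaler0 ?scale0r.
Qed.

Lemma chain_map_vers x : chain_map a (vers (x : Mbar k p w)) = vers (chain_map a x).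
Proof.
rewrite /chain_map (big_morph _ (versD hM) (vers0 hM)) [RHS]reindex_ordS.
apply: eq_bigr => j _; rewrite (versZ charp hM) Mbar_versE /= (periodic_mod _ pa).
have [_ _] := ca j; rewrite periodic_word_ord.
by case: (letter_at w j) => //= ->; rewrite ?(vers_frob hM) ?scaler0 ?scale0r.
Qed.

Lemma chain_map_grad b x :
  x \in (\sum_(j < n | odd j == b) <[bvec k j]>)%VS -> chain_map a x \in grad M (g (+) b).
Proof.
move/mem_parity_span => x0; apply: rpred_sum => j _.
have [<- | nb] := eqVneq (odd j) b; last by rewrite x0 // scale0r mem0v.
by rewrite rpredZ // (chain_grad _ ca).
Qed.

End CyclicModule.

Lemma mem_vspace_prod (K : closedFieldType) (U V : vectType K) (A : {vspace U}) (B : {vspace V})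
  (x : U * V) : (x \in vspace_prod A B) = (x.1 \in A) && (x.2 \in B).
Proof. by rewrite memv_cap -!memv_preim !linfunE_of_linear. Qed.

Section UnitaryCriterion.

Variables (k : closedFieldType) (p : nat) (M : ufv_module k).

(** Two isotropic subspaces that together span M are complementary and Lagrangian as soon as the
    form is nondegenerate. *)
Lemma unitary_criterion :
    is_BT1 p M -> symplectic (@pairing k M) ->
    (forall x y : M, pairing (frob x) y = pairing x (vers y) ^+ p) ->
    (forall x : M, exists x0 x1, [/\ x = x0 + x1, x0 \in grad M false & x1 \in grad M true]) ->
    (forall i (x : M), x \in grad M i -> frob x \in grad M (~~ i) /\ vers x \in grad M (~~ i)) ->
    (forall i (x y : M), x \in grad M i -> y \in grad M i -> pairing x y = 0) ->
  is_unitary_BT1 p M.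
Proof.
move=> bt symp pFV split_M exch iso; have [_ _ nd] := symp.
have disj x : x \in grad M false -> x \in grad M true -> x = 0.
  move=> x0 x1; apply: nd => y; have [y0 [y1 [-> y0g y1g]]] := split_M y.
  by rewrite (formDr symp) (iso false) // (iso true) // addr0.
have lag i (x y : M) : x \in grad M (~~ i) -> (forall y, y \in grad M i -> pairing x y = 0) -> x = 0.
  move=> xg x0; apply: nd => z; have [z0 [z1 [-> z0g z1g]]] := split_M z.
  rewrite (formDr symp); case: i xg x0 => /= xg x0.
    by rewrite (iso false) // x0 // addr0.
  by rewrite x0 // (iso true) // addr0.
split; [by [] | split | exact: exch | ].
- apply/eqP; rewrite eqEsubv subvf /=; apply/subvP => x _.
  by have [x0 [x1 [-> x0g x1g]]] := split_M x; rewrite memv_add.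
- apply/eqP; rewrite -subv0; apply/subvP => x; rewrite memv_cap memv0 => /andP [x0 x1].
  exact/eqP/disj.
move=> i x; split=> [xg y | x0]; first exact: iso.
have [y [z [xE yg zg]]] : exists y z, [/\ x = y + z, y \in grad M i & z \in grad M (~~ i)].
  have [y [z [-> yg zg]]] := split_M x.
  by case: i {x0}; [exists z, y; rewrite addrC | exists y, z].
suff z0 : z = 0 by rewrite xE z0 addr0.
apply: (lag i z z zg) => t tg; rewrite -[z](addKr y) -xE (formDl symp) x0 //.
by rewrite (formNl symp) (iso i) // oppr0 addr0.
Qed.

End UnitaryCriterion.

(** Injectivity comes from the pairing: a vector of the kernel is orthogonal to the nondegenerate
    source. *)
Definition unitary_embedding (k : closedFieldType) (T N : ufv_module k)
    (psi : {linear T -> N}) : Prop :=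
  [/\ (forall x, psi (frob x) = frob (psi x)) /\ (forall x, psi (vers x) = vers (psi x)),
      forall x y, pairing (psi x) (psi y) = pairing x y
    & forall i x, x \in grad T i -> psi x \in grad N i].

Section ParityPart.

Variables (k : closedFieldType) (n : nat).

Definition parity_part (b : bool) (x : 'rV[k]_n) : 'rV[k]_n :=
  \row_j (if odd j == b then x 0 j else 0).

Lemma parity_partE (x : 'rV[k]_n) : x = parity_part false x + parity_part true x.
Proof.
by apply/rowP => j; rewrite !mxE; case: (odd j); rewrite /= ?addr0 ?add0r.
Qed.

End ParityPart.

Section Bicycle.

Variables (k : closedFieldType) (p : nat).
Hypotheses (charp : p \in [pchar k]) (p_gt2 : (2 < p)%N).
Let p_prime : prime p := pcharf_prime charp.
Variable w : word.
Local Notation n := (size w).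
Hypothesis w_even : odd n = false.

Let sz : n = size (dual w) := esym (size_map _ _).
Let cd (j : 'I_n) : 'I_(size (dual w)) := cast_ord sz j.

Let cdS j : ordS (cd j) = cd (ordS j).
Proof. by apply/val_inj; rewrite /= size_map. Qed.

Let cdK (j : 'I_(size (dual w))) : cd (cast_ord (esym sz) j) = j.
Proof. exact: cast_ordKV. Qed.

Let dual_cd (j : 'I_n) : letter_at (dual w) (cd j) = dual_letter (letter_at w j).
Proof. by rewrite /letter_at -map_rev (nth_map lf) // size_rev; apply: (ltn_ord j). Qed.

Implicit Types x y : Mtilde2 k p w.

Lemma Mtilde2_pairingE x y : pairing x y =
  \sum_i ((x.1 : 'rV[k]_n) 0 i * (y.2 : 'rV[k]_(size (dual w))) 0 (cd i) -
          (x.2 : 'rV[k]_(size (dual w))) 0 (cd i) * (y.1 : 'rV[k]_n) 0 i).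
Proof.
by rewrite /=; apply: eq_bigr => i _; rewrite (big_pred1 (cd i)).
Qed.

Lemma Mtilde2_unitary : is_unitary_BT1 p (Mtilde2 k p w).
Proof.
have [[FD FZ] [VD VZ] kF kV] := Mbar_BT1 charp w.
have [[FD' FZ'] [VD' VZ'] kF' kV'] := Mbar_BT1 charp (dual w).
have memE b (x : Mtilde2 k p w) : x \in grad (Mtilde2 k p w) b <->
    (forall j : 'I_n, odd j != b -> (x.1 : 'rV[k]_n) 0 j = 0) /\
    (forall j : 'I_n, odd j == b -> (x.2 : 'rV[k]_(size (dual w))) 0 (cd j) = 0).
  rewrite mem_vspace_prod; split=> [/andP [/mem_parity_span x1 /mem_parity_span x2] | [x1 x2]].
    by split=> // j /eqP jb; apply: x2; rewrite /= jb; case: (b).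
  apply/andP; split; apply/mem_parity_span => // j jb; rewrite -[j]cdK; apply: x2 => /=.
  by move: jb; case: (odd j) b {x1} => -[].
have symp : symplectic (@pairing k (Mtilde2 k p w)).
  split.
  - split=> [y a x x' | x a y y']; rewrite !Mtilde2_pairingE mulr_sumr -big_split.
      by apply: eq_bigr => i _; rewrite /= !mxE; ring.
    by apply: eq_bigr => i _; rewrite /= !mxE; ring.
  - by move=> x; rewrite Mtilde2_pairingE big1 // => i _; rewrite mulrC subrr.
  - move=> [x1 x2] x0; congr (_, _); apply/rowP => j; rewrite mxE.
      have := x0 (0, delta_mx 0 (cd j)); rewrite Mtilde2_pairingE (bigD1 j) //= big1.
        by rewrite !mxE !eqxx mulr0 subr0 mulr1 addr0.
      move=> i ij; rewrite !mxE eqxx /= (inj_eq (@cast_ord_inj _ _ _)) (negbTE ij).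
      by rewrite !mulr0 subrr.
    have := x0 (delta_mx 0 (cast_ord (esym sz) j), 0); rewrite Mtilde2_pairingE.
    rewrite (bigD1 (cast_ord (esym sz) j)) //= big1.
      rewrite !mxE !eqxx cdK mulr0 sub0r mulr1 addr0 => /eqP; rewrite oppr_eq0.
      by move/eqP.
    by move=> i ij; rewrite !mxE eqxx /= (negbTE ij) !mulr0 subrr.
apply: unitary_criterion => //.
- have pairP (x y : Mtilde2 k p w) : x.1 = y.1 -> x.2 = y.2 -> x = y.
    by case: x y => [x1 x2] [y1 y2] /= -> ->.
  split.
  + by split=> *; apply: pairP; rewrite ?FD ?FZ ?FD' ?FZ'; [apply: FD | apply: FD' | apply: FZ | apply: FZ'].
  + by split=> *; apply: pairP; [apply: VD | apply: VD' | apply: VZ | apply: VZ'].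
  + move=> [x1 x2]; split=> [e | [[y1 y2] e]].
      have /kF [y1 ->] : frob x1 = 0 := congr1 fst e.
      by have /kF' [y2 ->] : frob x2 = 0 := congr1 snd e; exists (y1, y2).
    by apply: pairP; [apply/kF; exists y1 | apply/kF'; exists y2]; rewrite e.
  + move=> [x1 x2]; split=> [e | [[y1 y2] e]].
      have /kV [y1 ->] : vers x1 = 0 := congr1 fst e.
      by have /kV' [y2 ->] : vers x2 = 0 := congr1 snd e; exists (y1, y2).
    by apply: pairP; [apply/kV; exists y1 | apply/kV'; exists y2]; rewrite e.
- move=> x y; rewrite !Mtilde2_pairingE reindex_ordS.
  rewrite (big_morph (fun t : k => t ^+ p) (frob_power1D charp) (id1 := 0)); last first.
    by rewrite expr0n gtn_eqF // prime_gt0.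
  apply: eq_bigr => i _; rewrite -cdS !Mbar_frobE !Mbar_versE dual_cd cdS.
  rewrite frob_power1D // -[p in (- _) ^+ p]expn1 frob_powerN // expn1 !exprMn.
  case: (letter_at w i); rewrite /= ?prootK ?prime_gt0 // ?expr0n ?gtn_eqF ?prime_gt0 //.
    by rewrite !mul0r !mulr0.
  by rewrite !mul0r !mulr0.
- move=> [x1 x2]; exists (parity_part false x1, parity_part true x2).
  exists (parity_part true x1, parity_part false x2); split.
  + by congr (_, _); rewrite /= [LHS]parity_partE // addrC.
  + by apply/memE; split=> j /= jb; rewrite mxE; case: (odd j) jb.
  + by apply/memE; split=> j /= jb; rewrite mxE; case: (odd j) jb.
(* Even length makes the parity alternate also at the passage from the last index to 0, so F and V
   exchange the two pieces. *)
- have oddS (j : 'I_n) : odd (ordS j) = ~~ odd j by rewrite /= odd_mod.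
  move=> b x /memE [x1 x2]; split; apply/memE; split=> j jb /=.
  + rewrite -(ord_predK j) Mbar_frobE x1 ?expr0n ?gtn_eqF ?prime_gt0 ?if_same //.
    by move: jb; rewrite -{1}(ord_predK j) oddS; case: (odd _) b {x1 x2} => -[].
  + rewrite -(ord_predK j) -cdS Mbar_frobE x2 ?expr0n ?gtn_eqF ?prime_gt0 ?if_same //.
    by move: jb; rewrite -{1}(ord_predK j) oddS; case: (odd _) b {x1 x2} => -[].
  + rewrite Mbar_versE x1 ?(proot0 charp) ?if_same //.
    by move: jb; rewrite oddS; case: (odd _) b {x1 x2} => -[].
  + rewrite Mbar_versE cdS x2 ?(proot0 charp) ?if_same //.
    by move: jb; rewrite oddS; case: (odd _) b {x1 x2} => -[].
- move=> b x y /memE [x1 x2] /memE [y1 y2]; rewrite Mtilde2_pairingE big1 // => i _.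
  have [ib | ib] := boolP (odd i == b); first by rewrite x2 ?y2 // mulr0 mul0r subrr.
  by rewrite x1 ?y1 // mulr0 mul0r subrr.
Qed.

Variable N : ufv_module k.
Hypothesis hN : is_unitary_BT1 p N.
Let symp := unitary_symplectic hN.

Lemma Mtilde2_embedding (a b : nat -> N) :
    (0 < n)%N ->
    chain false (periodic_word w) a -> chain true (dual_seq (periodic_word w)) b ->
    periodic n a -> periodic n b ->
    (forall i j, pairing (a i) (b j) = (i == j %[mod n])%:R) ->
    (forall i j, pairing (a i) (a j) = 0 /\ pairing (b i) (b j) = 0) ->
  exists psi : {linear Mtilde2 k p w -> N}, unitary_embedding psi.
Proof.
move=> n_gt0 ca cb pa pb ab aabb.
have cb' : chain true (periodic_word (dual w)) b.
  by apply: eq_chain cb => i; rewrite periodic_word_dual.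
have pb' : periodic (size (dual w)) b by rewrite -sz.
pose f (x : Mtilde2 k p w) : N := chain_map a x.1 + chain_map b x.2.
have lin_f : linear f.
  move=> t x y; rewrite /f !chain_map_linear scalerDr !addrA; congr (_ + _).
  by rewrite addrAC.
pose psi : {linear Mtilde2 k p w -> N} := HB.pack f (GRing.isLinear.Build _ _ _ _ f lin_f).
have psiE x : psi x = f x by [].
exists psi; split.
- split=> x; rewrite !psiE /f.
    by rewrite (chain_map_frob hN ca pa) (chain_map_frob hN cb' pb') (frobD hN).
  by rewrite (chain_map_vers charp hN ca pa) (chain_map_vers charp hN cb' pb') (versD hN).
- move=> x y; rewrite Mtilde2_pairingE !psiE /f !(formDl symp) !(formDr symp).
  rewrite !(pairing_chain_map hN) [X in X + _]addrC.
  rewrite [X in _ + X + _]big1 => [|i _]; last first.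
    by rewrite big1 // => j _; have [-> _] := aabb i j; rewrite mulr0.
  rewrite [X in _ + (_ + X)]big1 => [|i _]; last first.
    by rewrite big1 // => j _; have [_ ->] := aabb i j; rewrite mulr0.
  rewrite !addr0 big_split /=; congr (_ + _).
    apply: eq_bigr => i _; rewrite (bigD1 (cd i)) //= ab eqxx mulr1 big1 ?addr0 // => j ji.
    rewrite ab; case: eqP => [ij | _]; last by rewrite mulr0.
    case/eqP: ji; apply/val_inj => /=; move: ij; rewrite !modn_small //.
    by rewrite [X in (_ < X)%N]sz.
  rewrite (reindex cd) /=; last by exists (cast_ord (esym sz)) => i _; rewrite ?cast_ordK ?cdK.
  apply: eq_bigr => i _; rewrite (bigD1 i) //= (formC symp) ab eqxx mulrN1 big1 ?addr0 // => j ji.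
  rewrite (formC symp) ab; case: eqP => [ij | _]; last by rewrite oppr0 mulr0.
  by case/eqP: ji; apply/val_inj; move: ij; rewrite !modn_small.
- move=> i x; rewrite psiE mem_vspace_prod => /andP [x1 x2]; rewrite memvD //.
    exact: (chain_map_grad ca x1).
  by have := chain_map_grad cb' x2; rewrite addTb negbK.
Qed.

End Bicycle.

Section Unicycle.

Variables (k : closedFieldType) (p : nat).
Hypotheses (charp : p \in [pchar k]) (p_gt2 : (2 < p)%N).
Let p_prime : prime p := pcharf_prime charp.
Variables (w : word) (l : nat) (c : k).
Local Notation n := (size w).
Hypotheses (nE : n = l.*2) (l_odd : odd l).
Hypothesis anti : forall i, periodic_word w (i + l) = dual_letter (periodic_word w i).
Hypotheses (c_neq0 : c != 0) (cl : c ^+ (p ^ l) = - c).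

Let n_even : odd n = false. Proof. by rewrite nE odd_double. Qed.
Let n_gt0 : (0 < n)%N. Proof. by rewrite nE double_gt0 odd_gt0. Qed.

Let K i := c ^+ (p ^ i).
Let K_neq0 i : K i != 0. Proof. exact: expf_neq0. Qed.
Let K_l i : K (i + l)%N = - K i.
Proof. by rewrite /K addnC expnD exprM cl frob_powerN. Qed.
Let K_periodic : periodic n K.
Proof. by move=> j; rewrite nE -addnn addnA !K_l opprK. Qed.

Let half (i : 'I_n) : 'I_n := Ordinal (ltn_pmod (i + l) n_gt0).

Let halfK : involutive half.
Proof.
by move=> i; apply/val_inj; rewrite /= modnDml -addnA addnn -nE modnDr modn_small.
Qed.

Let halfS i : half (ordS i) = ordS (half i).
Proof.
by apply/val_inj; rewrite /= modnDml -[in RHS]addn1 modnDml addn1 addSn.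
Qed.

Let K_half i : K (half i) = - K i.
Proof. by rewrite /= (periodic_mod _ K_periodic) K_l. Qed.

Let letter_half (i : 'I_n) : letter_at w (half i) = dual_letter (letter_at w i).
Proof.
by rewrite -!periodic_word_ord -anti /= (periodic_mod _ (@periodic_word_periodic w)).
Qed.

Let odd_half (i : 'I_n) : odd (half i) = ~~ odd i.
Proof. by rewrite /= odd_mod // oddD l_odd addbT. Qed.

Implicit Types x y : Mtilde1 p c w.

Lemma Mtilde1_pairingE x y :
  pairing x y = \sum_(i < n) K i * (x : 'rV[k]_n) 0 i * (y : 'rV[k]_n) 0 (half i).
Proof.
rewrite /=; apply: eq_bigr => i _; rewrite (big_pred1 (half i)) // => j.
have n2 : n./2 = l by rewrite nE doubleK.
by rewrite /= n2 -(inj_eq val_inj) /= (modn_small (ltn_ord j)).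
Qed.

(** Since c^(p^l) = -c, exchanging [i] with [half i] shows that pairing x with itself gives a value
    equal to its negative, which vanishes for p odd. Dual letters at [i] and [half i] give the
    adjunction, and odd [l] makes both pieces isotropic. *)
Lemma Mtilde1_unitary : is_unitary_BT1 p (Mtilde1 p c w).
Proof.
have memE b x : x \in grad (Mtilde1 p c w) b <->
    (forall j : 'I_n, odd j != b -> (x : 'rV[k]_n) 0 j = 0).
  by split=> [/mem_parity_span | h]; last apply/mem_parity_span.
have two_neq0 : (2%:R : k) != 0.
  rewrite -(dvdn_pcharf charp); apply/negP => /dvdn_leq -/(_ isT).
  by rewrite leqNgt p_gt2.
have symp : symplectic (@pairing k (Mtilde1 p c w)).
  split.
  - split=> [y a x x' | x a y y']; rewrite !Mtilde1_pairingE mulr_sumr -big_split.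
      by apply: eq_bigr => i _; rewrite /= !mxE; ring.
    by apply: eq_bigr => i _; rewrite /= !mxE; ring.
  - move=> x; rewrite Mtilde1_pairingE; set S := \sum_(i < n) _.
    suff : S = - S.
      by move/eqP; rewrite -addr_eq0 -mulr2n -mulr_natl mulf_eq0 (negbTE two_neq0) => /eqP.
    rewrite {1}/S (reindex_inj (inv_inj halfK)) -sumrN; apply: eq_bigr => i _.
    by rewrite halfK K_half; ring.
  - move=> x x0; apply/rowP => j; rewrite mxE; have := x0 (delta_mx 0 (half j)).
    rewrite Mtilde1_pairingE (bigD1 j) //= big1 => [|i ij].
      rewrite !mxE !eqxx mulr1 addr0 => /eqP; rewrite mulf_eq0 (negbTE (K_neq0 _)).
      by move/eqP.
    by rewrite !mxE eqxx /= (inj_eq (inv_inj halfK)) (negbTE ij) mulr0.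
apply: unitary_criterion => //.
- exact: Mbar_BT1.
- move=> x y; rewrite !Mtilde1_pairingE reindex_ordS.
  rewrite (big_morph (fun t : k => t ^+ p) (frob_power1D charp) (id1 := 0)); last first.
    by rewrite expr0n gtn_eqF // prime_gt0.
  apply: eq_bigr => i _; rewrite halfS Mbar_frobE Mbar_versE letter_half !exprMn.
  have -> : K (ordS i) = K i ^+ p by rewrite /= (periodic_mod _ K_periodic) /K expnSr exprM.
  case: (letter_at w i); rewrite /= ?prootK ?prime_gt0 //.
  by rewrite expr0n gtn_eqF ?prime_gt0 // mulr0 mul0r mulr0.
- move=> x; exists (parity_part false x), (parity_part true x); split.
  + exact: parity_partE.
  + by apply/memE => j /= jb; rewrite mxE (negbTE jb).
  + by apply/memE => j /= jb; rewrite mxE (negbTE jb).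
- have oddS (j : 'I_n) : odd (ordS j) = ~~ odd j by rewrite /= odd_mod.
  move=> b x /memE x0; split; apply/memE => j jb.
  + rewrite -(ord_predK j) Mbar_frobE x0 ?expr0n ?gtn_eqF ?prime_gt0 ?if_same //.
    by move: jb; rewrite -{1}(ord_predK j) oddS; case: (odd _) b {x0} => -[].
  + rewrite Mbar_versE x0 ?(proot0 charp) ?if_same //.
    by move: jb; rewrite oddS; case: (odd _) b {x0} => -[].
- move=> b x y /memE x0 /memE y0; rewrite Mtilde1_pairingE big1 // => i _.
  have [ib | ib] := boolP (odd i == b); last by rewrite x0 // mulr0 mul0r.
  by rewrite y0 ?mulr0 // odd_half; move: ib; case: (odd i) b {x0 y0} => -[].
Qed.

Variable N : ufv_module k.
Hypothesis hN : is_unitary_BT1 p N.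

Lemma Mtilde1_embedding (a : nat -> N) :
    chain false (periodic_word w) a -> periodic n a ->
    (forall i j, pairing (a i) (a j) =
       if j == i + l %[mod n] then c ^+ (p ^ (i %% n)) else 0) ->
  exists psi : {linear Mtilde1 p c w -> N}, unitary_embedding psi.
Proof.
move=> ca pa aa; pose f (x : Mtilde1 p c w) : N := chain_map a x.
have lin_f : linear f by move=> t x y; apply: chain_map_linear.
pose psi : {linear Mtilde1 p c w -> N} := HB.pack f (GRing.isLinear.Build _ _ _ _ f lin_f).
have psiE x : psi x = f x by [].
exists psi; split.
- split=> x; rewrite !psiE /f.
    by rewrite (chain_map_frob hN ca pa).
  by rewrite (chain_map_vers charp hN ca pa).
- move=> x y; rewrite Mtilde1_pairingE !psiE /f (pairing_chain_map hN).
  apply: eq_bigr => i _; rewrite (bigD1 (half i)) //= big1 ?addr0 => [|j ji].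
    by rewrite aa modn_mod eqxx modn_small // [RHS]mulrC mulrA [LHS]mulrC mulrA mulrC mulrA.
  rewrite aa; case: eqP => [ij | _]; last by rewrite mulr0.
  by case/eqP: ji; apply/val_inj; rewrite /= -ij modn_small.
- by move=> i x x_i; have := chain_map_grad ca x_i.
Qed.

End Unicycle.

(** * Direct sums and orthogonal complements *)

Section Isomorphisms.

Variable k : closedFieldType.
Implicit Types M N P : ufv_module k.

(** The point is that degrees are reflected: a component of the wrong degree has its image in both
    pieces of [N], hence is zero. *)
Lemma embedding_iso M N (psi : {linear M -> N}) : unitary_embedding psi -> bijective psi ->
    (forall x : M, exists x0 x1, [/\ x = x0 + x1, x0 \in grad M false & x1 \in grad M true]) ->
    (forall x : N, x \in grad N false -> x \in grad N true -> x = 0) ->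
  unitary_iso M N.
Proof.
move=> [comm pair gr] bij split_M disj; exists psi; split=> // i x.
apply/idP/idP => [px | /gr //]; have inj := bij_inj bij.
have [x0 [x1 [xE x0g x1g]]] := split_M x; have p0 := gr _ _ x0g; have p1 := gr _ _ x1g.
have pxE : psi x = psi x0 + psi x1 by rewrite xE linearD.
case: i px => px.
  have e : psi x0 = 0 by apply: disj; rewrite // -[psi x0](addrK (psi x1)) -pxE memvB.
  by rewrite xE (inj x0 0) ?linear0 // add0r.
have e : psi x1 = 0 by apply: disj; rewrite // -[psi x1](addKr (psi x0)) -pxE addrC memvB.
by rewrite xE (inj x1 0) ?linear0 // addr0.
Qed.

Lemma unitary_iso_refl M : unitary_iso M M.
Proof. by exists idfun; split=> //; exists id. Qed.

Lemma unitary_iso_sym M N : unitary_iso M N -> unitary_iso N M.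
Proof.
case=> phi [[g phiK gK] [pF pV] pp pg].
have lin_g : linear g.
  by move=> a x y; apply: (can_inj phiK); rewrite linearP !gK.
pose psi : {linear N -> M} := HB.pack g (GRing.isLinear.Build _ _ _ _ g lin_g).
have psiE x : psi x = g x by [].
exists psi; split.
- by exists phi.
- by split=> x; rewrite !psiE; apply: (can_inj phiK); rewrite ?pF ?pV !gK.
- by move=> x y; rewrite !psiE -pp !gK.
- by move=> i x; rewrite psiE -pg gK.
Qed.

Lemma unitary_iso_trans M N P : unitary_iso M N -> unitary_iso N P -> unitary_iso M P.
Proof.
case=> phi [bphi [pF pV] pp pg] [psi [bpsi [qF qV] qp qg]].
exists (psi \o phi); split=> /=.
- exact: bij_comp.
- by split=> x; rewrite ?pF ?pV ?qF ?qV.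
- by move=> x y; rewrite qp pp.
- by move=> i x; rewrite qg pg.
Qed.

Lemma unitary_iso_of M N (f : M -> N) (g : N -> M) :
    linear f -> cancel f g -> cancel g f ->
    (forall x, f (frob x) = frob (f x)) -> (forall x, f (vers x) = vers (f x)) ->
    (forall x y, pairing (f x) (f y) = pairing x y) ->
    (forall i x, (f x \in grad N i) = (x \in grad M i)) ->
  unitary_iso M N.
Proof.
move=> lin_f fK gK fF fV fp fg.
pose psi : {linear M -> N} := HB.pack f (GRing.isLinear.Build _ _ _ _ f lin_f).
by exists psi; split=> //; exists g.
Qed.

Lemma ufv_sum_iso M M' N N' : unitary_iso M M' -> unitary_iso N N' ->
  unitary_iso (ufv_sum M N) (ufv_sum M' N').
Proof.
case=> phi [[g phiK gK] [pF pV] pp pg] [psi [[h psiK hK] [qF qV] qp qg]].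
apply: (@unitary_iso_of (ufv_sum M N) (ufv_sum M' N')
  (fun x => (phi x.1, psi x.2)) (fun x => (g x.1, h x.2))).
- by move=> a [x1 x2] [y1 y2] /=; rewrite !linearP.
- by move=> [x1 x2] /=; rewrite phiK psiK.
- by move=> [x1 x2] /=; rewrite gK hK.
- by move=> [x1 x2] /=; rewrite pF qF.
- by move=> [x1 x2] /=; rewrite pV qV.
- by move=> [x1 x2] [y1 y2] /=; rewrite pp qp.
- by move=> i [x1 x2]; rewrite !mem_vspace_prod pg qg.
Qed.

Lemma ufv_sumC M N : unitary_iso (ufv_sum M N) (ufv_sum N M).
Proof.
apply: (@unitary_iso_of (ufv_sum M N) (ufv_sum N M) (fun x => (x.2, x.1)) (fun x => (x.2, x.1))) => //.
- by case.
- by case.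
- by move=> x y /=; rewrite addrC.
- by move=> i [x1 x2]; rewrite !mem_vspace_prod andbC.
Qed.

Lemma ufv_sumA M N P : unitary_iso (ufv_sum M (ufv_sum N P)) (ufv_sum (ufv_sum M N) P).
Proof.
apply: (@unitary_iso_of (ufv_sum M (ufv_sum N P)) (ufv_sum (ufv_sum M N) P)
  (fun x => ((x.1, x.2.1), x.2.2)) (fun x => (x.1.1, (x.1.2, x.2)))) => //.
- by move=> [x1 [x2 x3]].
- by move=> [[x1 x2] x3].
- by move=> x y /=; rewrite addrA.
- by move=> i [x1 [x2 x3]]; rewrite !mem_vspace_prod /= andbA.
Qed.

Lemma ufv_sum0 M : unitary_iso (ufv_sum M (ufv_zero k)) M.
Proof.
apply: (@unitary_iso_of (ufv_sum M (ufv_zero k)) M fst (fun x => (x, 0))) => //.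
- by move=> [x y] /=; congr (_, _); rewrite [y]thinmx0.
- by move=> x y /=; rewrite addr0.
- by move=> i [x y]; rewrite mem_vspace_prod /= [y]thinmx0 mem0v andbT.
Qed.

End Isomorphisms.

Section OrthogonalComplement.

Variables (k : closedFieldType) (p : nat).
Hypothesis charp : p \in [pchar k].
Let p_prime : prime p := pcharf_prime charp.
Variables (T N : ufv_module k) (psi : {linear T -> N}).
Hypotheses (hT : is_unitary_BT1 p T) (hN : is_unitary_BT1 p N).
Hypothesis emb : unitary_embedding psi.
Let sT := unitary_symplectic hT.
Let sN := unitary_symplectic hN.

Let psi_frob x : psi (frob x) = frob (psi x). Proof. by case: emb => [[]]. Qed.
Let psi_vers x : psi (vers x) = vers (psi x). Proof. by case: emb => [[]]. Qed.
Let psi_pair x y : pairing (psi x) (psi y) = pairing x y. Proof. by case: emb. Qed.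
Let psi_grad i x : x \in grad T i -> psi x \in grad N i. Proof. by case: emb => _ _; apply. Qed.

Lemma embedding_inj : injective psi.
Proof.
move=> x y e; apply/eqP; rewrite -subr_eq0; apply/eqP; case: sT => _ _; apply => z.
by rewrite -psi_pair linearB e subrr (form0l sN).
Qed.

Lemma orthogonal_complement_exists :
  exists W : {vspace N}, forall x, x \in W <-> forall t, pairing (psi t) x = 0.
Proof.
apply: subspace_vspace; split=> [t | a x y xW yW t]; first exact: form0r.
by rewrite (formDr sN) (formZr sN) xW yW mulr0 addr0.
Qed.

Variable W : {vspace N}.
Hypothesis WE : forall x, x \in W <-> forall t, pairing (psi t) x = 0.

(** The functional [t |-> pairing (psi t) x] on [T] is represented by a vector of [T]; subtracting
    its image makes [x] orthogonal. *)
Lemma complement_split x : exists t, x - psi t \in W.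
Proof.
have [|t tE] := form_repr sT (f := fun t => pairing (psi t) x).
  by move=> a t t'; rewrite linearP (formDl sN) (formZl sN).
exists t; apply/WE => t'.
by rewrite (formDr sN) (formNr sN) psi_pair tE subrr.
Qed.

Lemma image_complement t : psi t \in W -> t = 0.
Proof.
move/WE => h; case: sT => _ _; apply => t'.
by rewrite (formC sT) -psi_pair h oppr0.
Qed.

Lemma complement_frob x : x \in W -> frob x \in W.
Proof.
move=> /WE xW; apply/WE => t.
by rewrite (pairing_frobr charp hN) -psi_vers xW expr0n gtn_eqF // prime_gt0.
Qed.

Lemma complement_vers x : x \in W -> vers x \in W.
Proof.
move=> /WE xW; apply/WE => t; have : pairing (psi t) (vers x) ^+ p = 0.
  by rewrite -(pairing_frobl hN) -psi_frob xW.
by move/eqP; rewrite expf_eq0 => /andP [_ /eqP].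
Qed.

(** [W] is stable under F and V, so [vsproj] merely retypes a vector that already lies in [W]. *)
Definition orthogonal_complement : ufv_module k :=
  @UFVModule k (@FVModule k (subvs_of W)
      (fun x => vsproj W (frob (vsval x))) (fun x => vsproj W (vers (vsval x))))
    (fun x y => pairing (vsval x) (vsval y))
    (fun i => (linfun (vsval : subvs_of W -> N) @^-1: grad N i)%VS).

Let val_frob (x : orthogonal_complement) : vsval (frob x) = frob (vsval x).
Proof. by rewrite vsprojK //; apply/complement_frob/subvsP. Qed.

Let val_vers (x : orthogonal_complement) : vsval (vers x) = vers (vsval x).
Proof. by rewrite vsprojK //; apply/complement_vers/subvsP. Qed.

Let mem_complement i (x : orthogonal_complement) : (x \in grad orthogonal_complement i) = (vsval x \in grad N i).
Proof. by rewrite -memv_preim linfunE_of_linear //; apply: linearP. Qed.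

Let val_inj' (x y : orthogonal_complement) : vsval x = vsval y -> x = y.
Proof. exact: val_inj. Qed.

Let val_D (x y : orthogonal_complement) : vsval (x + y) = vsval x + vsval y.
Proof. exact: (linearD vsval). Qed.

Let val_pair (x y : orthogonal_complement) : pairing x y = pairing (vsval x) (vsval y).
Proof. by []. Qed.

Let val_Z a (x : orthogonal_complement) : vsval (a *: x) = a *: vsval x.
Proof. exact: (linearZZ vsval). Qed.

Lemma complement_unitary : is_unitary_BT1 p orthogonal_complement.
Proof.
have splitW x : exists t w : N, [/\ x = t + w, w \in W & exists t', t = psi t'].
  have [t tW] := complement_split x; exists (psi t), (x - psi t).
  by rewrite addrC subrK; split=> //; exists t.
have WI x t : x \in W -> pairing x (psi t) = 0.
  by move=> /WE h; rewrite (formC sN) h oppr0.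
apply: unitary_criterion.
- split.
  + split=> [x y | a x]; apply: val_inj'; rewrite val_frob.
      by rewrite !val_D (frobD hN) -!val_frob.
    by rewrite !val_Z (frobZ hN) -val_frob.
  + split=> [x y | a x]; apply: val_inj'; rewrite val_vers.
      by rewrite !val_D (versD hN) -!val_vers.
    by rewrite !val_Z (versXZ hN) -val_vers.
  + move=> x; split=> [x0 | [y ->]]; last first.
      by apply: val_inj'; rewrite val_frob val_vers (frob_vers hN) linear0.
    have : frob (vsval x) = 0 by rewrite -val_frob x0 linear0.
    (* A preimage [y] under V is found in [N] and split as t + w. Then V t lies both in [W] and in
       the image of [T], hence is 0, and [w] is a preimage inside [W]. *)
    case/(frob_eq0 hN) => y xE; have [t [w [yE wW [t' tE]]]] := splitW y.
    exists (vsproj W w); apply: val_inj'; rewrite val_vers vsprojK //.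
    have /image_complement t0 : psi (vers t') \in W.
      rewrite psi_vers -tE -[vers t](addrK (vers w)) -(versD hN) -yE -xE.
      by rewrite memvB ?subvsP ?complement_vers.
    by rewrite xE yE tE (versD hN) -psi_vers t0 linear0 add0r.
  + move=> x; split=> [x0 | [y ->]]; last first.
      by apply: val_inj'; rewrite val_vers val_frob (vers_frob hN) linear0.
    have : vers (vsval x) = 0 by rewrite -val_vers x0 linear0.
    case/(vers_eq0 hN) => y xE; have [t [w [yE wW [t' tE]]]] := splitW y.
    exists (vsproj W w); apply: val_inj'; rewrite val_frob vsprojK //.
    have /image_complement t0 : psi (frob t') \in W.
      rewrite psi_frob -tE -[frob t](addrK (frob w)) -(frobD hN) -yE -xE.
      by rewrite memvB ?subvsP ?complement_frob.
    by rewrite xE yE tE (frobD hN) -psi_frob t0 linear0 add0r.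
- split.
  + split=> [y a x x' | x a y y']; rewrite !val_pair val_D val_Z.
      by rewrite (formDl sN) (formZl sN).
    by rewrite (formDr sN) (formZr sN).
  + by move=> x /=; case: sN => _ alt _; apply: alt.
  + move=> x x0; apply: val_inj'; rewrite linear0; case: sN => _ _; apply => y.
    have [t [w [-> wW [t' ->]]]] := splitW y; rewrite (formDr sN) WI ?subvsP // add0r.
    by have := x0 (vsproj W w); rewrite /= vsprojK.
- by move=> x y; rewrite !val_pair val_frob val_vers (pairing_frobl hN).
- move=> x; have [x0 [x1 [xE x0g x1g]]] := grad_split hN false (vsval x).
  (* The space [W] is graded: against a test vector, one homogeneous part pairs to 0 with [x0] by
     isotropy, and the other pairs with [x0] as it does with [x]. *)
  have x0W : x0 \in W.
    apply/WE => t; have [t0 [t1 [-> t0g t1g]]] := grad_split hT false t.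
    rewrite linearD (formDl sN) (grad_isotropic hN (psi_grad t0g) x0g) add0r.
    have /WE/(_ t1) := subvsP x; rewrite xE (formDr sN).
    by rewrite (grad_isotropic hN (psi_grad t1g) x1g) addr0.
  have x1W : x1 \in W by rewrite -[x1](addKr x0) -xE addrC memvB ?subvsP.
  exists (vsproj W x0), (vsproj W x1); rewrite !mem_complement !vsprojK //; split=> //.
  by apply: val_inj'; rewrite linearD /= !vsprojK.
- move=> i x; rewrite !mem_complement val_frob val_vers => xg.
  by split; [apply: (grad_frob hN) | apply: (grad_vers hN)].
- by move=> i x y; rewrite !mem_complement; apply: (grad_isotropic hN).
Qed.

Lemma complement_iso : unitary_iso N (ufv_sum T orthogonal_complement).
Proof.
apply: unitary_iso_sym.
pose f (x : ufv_sum T orthogonal_complement) : N := psi x.1 + vsval x.2.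
have lin_f : linear f.
  by move=> a x y; rewrite /f /= !linearP scalerDr addrACA.
pose phi : {linear ufv_sum T orthogonal_complement -> N} :=
  HB.pack f (GRing.isLinear.Build _ _ _ _ f lin_f).
have phiE x : phi x = f x by [].
have WI x t : x \in W -> pairing x (psi t) = 0.
  by move=> /WE h; rewrite (formC sN) h oppr0.
have [g gE] := functional_choice _ complement_split.
apply: (@embedding_iso _ _ _ phi).
- split.
  + split=> -[x1 x2]; rewrite !phiE /f; apply/esym.
      by rewrite (frobD hN) -psi_frob -val_frob.
    by rewrite (versD hN) -psi_vers -val_vers.
  + move=> [x1 x2] [y1 y2]; rewrite !phiE /f /= (formDl sN) !(formDr sN) psi_pair.
    have /WE/(_ x1) -> := subvsP y2; rewrite WI ?subvsP //.
    by rewrite addr0 add0r.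
  + move=> i [x1 x2]; rewrite mem_vspace_prod mem_complement => /andP [x1g x2g].
    by rewrite phiE /f memvD // psi_grad.
- exists (fun x => (g x, vsproj W (x - psi (g x)))) => [[t w] | x].
    have gf : g (f (t, w)) = t.
      apply/eqP; rewrite -subr_eq0; apply/eqP/image_complement.
      have -> : psi (g (f (t, w)) - t) = vsval w - (f (t, w) - psi (g (f (t, w)))).
        by rewrite linearB /= opprB {2}/f opprD addrCA (addrC (vsval w)) subrK.
      by rewrite memvB ?subvsP // gE.
    rewrite phiE gf; congr (_, _); apply: val_inj'.
    by rewrite /f /= [_ + _ - _]addrAC subrr add0r vsprojK ?subvsP.
  by rewrite phiE /f /= vsprojK ?gE // addrC subrK.
- move=> [x1 x2]; have [y [z [-> yg zg]]] := grad_split hT false x1.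
  have [y' [z' [-> y'g z'g]]] := grad_split complement_unitary false x2.
  by exists (y, y'), (z, z'); rewrite !mem_vspace_prod yg zg y'g z'g.
- by move=> x; apply: (grad_disjoint hN).
Qed.

Lemma complement_dim : (\dim {:orthogonal_complement} <= \dim {:N} - \dim {:T})%N.
Proof.
have inj_psi : lker (linfun psi) == 0%VS.
  by apply/lker0P => x y; rewrite !lfunE; apply: embedding_inj.
have dim_im : \dim (limg (linfun psi)) = \dim {:T}.
  by rewrite limg_dim_eq // (eqP inj_psi) capv0.
have : (limg (linfun psi) :&: W)%VS = 0%VS.
  apply/eqP; rewrite -subv0; apply/subvP => x; rewrite memv_cap memv0.
  case/andP=> /memv_imgP [t _ ->]; rewrite lfunE => /image_complement ->.
  by rewrite linear0.
move/dimv_disjoint_sum => dim_sum; have dimW : \dim {:orthogonal_complement} = \dim W.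
  by rewrite dimvf.
rewrite dimW -dim_im -(addKn (\dim (limg (linfun psi))) (\dim W)) -dim_sum.
by apply: leq_sub2r; rewrite dimvS // subvf.
Qed.

End OrthogonalComplement.

(** * Periods and antiperiods of words *)

Lemma size_dual w : size (dual w) = size w.
Proof. exact: size_map. Qed.

Lemma size_tau w : size (tau w) = size w.
Proof. exact: size_rotr. Qed.

Lemma size_iter_tau m w : size (iter m tau w) = size w.
Proof. by elim: m => //= m IHm; rewrite size_tau. Qed.

Lemma dualK : involutive dual.
Proof. by move=> w; rewrite /dual -map_comp map_id_in // => x _; apply: dual_letterK. Qed.

Lemma periodic_word_tau w i : periodic_word (tau w) i = periodic_word w i.+1.
Proof.
case: (posnP (size w)) => [/size0nil -> | w_gt0].
  by rewrite /periodic_word /letter_at !nth_nil.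
rewrite /periodic_word /letter_at size_tau /tau rev_rotr.
set s := rev w; have sz : size s = size w by rewrite size_rev.
rewrite -sz; have s_gt0 : (0 < size s)%N by rewrite sz.
case: s s_gt0 {sz} => // x s _; rewrite rot1_cons nth_rcons /=.
rewrite -[in RHS]addn1 -modnDml addn1.
have := ltn_pmod i (ltn0Sn (size s)); rewrite ltnS leq_eqVlt => /predU1P [-> | lt].
  by rewrite ltnn eqxx modnn.
by rewrite lt [in RHS]modn_small.
Qed.

Lemma periodic_word_iter_tau m w i : periodic_word (iter m tau w) i = periodic_word w (m + i).
Proof. by elim: m i => // m IHm i; rewrite /= periodic_word_tau IHm addnS addSn. Qed.

Lemma periodic_word_inj w w' : size w = size w' -> periodic_word w =1 periodic_word w' -> w = w'.
Proof.
move=> sz e; apply: (inv_inj revK); apply: (@eq_from_nth _ lf); first by rewrite !size_rev.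
move=> i; rewrite size_rev => lt; have := e i; rewrite /periodic_word /letter_at.
by rewrite !modn_small // -sz.
Qed.

Lemma nth_power z n i : (i < n * size z)%N -> nth lf (power z n) i = nth lf z (i %% size z).
Proof.
elim: n i => // n IHn i; rewrite powerS nth_cat mulSn => lt.
case: ltnP => [lt_i | le_i]; first by rewrite modn_small.
by rewrite IHn ?ltn_subLR // -[in RHS](subnK le_i) modnDr.
Qed.

Lemma rev_power z n : rev (power z n) = power (rev z) n.
Proof.
elim: n => // n IHn; rewrite -addn1 powerD rev_cat IHn addn1 powerS; congr (_ ++ _).
by rewrite /power /= !cats0.
Qed.

Lemma power2 z : power z 2 = z ++ z.
Proof. by rewrite /power /= cats0. Qed.

Lemma periodic_word_power z n : (0 < n)%N -> periodic_word (power z n) =1 periodic_word z.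
Proof.
move=> n_gt0 i; case: (posnP (size z)) => [/size0nil -> | z_gt0].
  by rewrite /periodic_word (size0nil (_ : size (power [::] n) = 0%N)) // size_power muln0.
rewrite /periodic_word /letter_at rev_power nth_power size_power size_rev.
  by rewrite modn_dvdm // dvdn_mull.
by rewrite ltn_pmod // muln_gt0 n_gt0.
Qed.

Lemma periodic_mul (T : Type) a d (u : nat -> T) : periodic d u -> periodic (a * d) u.
Proof.
move=> pu i; elim: a => [|a IHa]; first by rewrite addn0.
by rewrite mulSn addnCA addnC pu.
Qed.

Lemma periodic_gcd (T : Type) (u : nat -> T) n m : (0 < m)%N ->
  periodic n u -> periodic m u -> periodic (gcdn n m) u.
Proof.
move=> m_gt0 pn pm i; have [a _ /dvdnP [b bE]] := Bezoutr n m_gt0.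
by rewrite -[LHS](periodic_mul a pn) -addnA bE periodic_mul.
Qed.

Lemma power_of_period w d : (0 < d)%N -> (d %| size w)%N -> periodic d (periodic_word w) ->
  exists2 z, size z = d & w = power z (size w %/ d).
Proof.
move=> d_gt0 dn pd; pose z := rev (mkseq (periodic_word w) d).
have sz : size z = d by rewrite size_rev size_mkseq.
exists z => //; apply: periodic_word_inj; first by rewrite size_power sz divnK.
case: (posnP (size w)) => [/size0nil -> | w_gt0] i; first by rewrite div0n.
rewrite periodic_word_power; last by rewrite divn_gt0 // dvdn_leq.
by rewrite [in RHS]/periodic_word sz /letter_at revK nth_mkseq ?ltn_pmod // periodic_mod.
Qed.

(** The class of words delivered by the descent on admissible powers: besides primitive words it
    contains the words zz with z primitive of odd length. *)
Definition even_primitive (w : word) : Prop :=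
  [/\ (0 < size w)%N, ~~ odd (size w)
    & forall z n, ~~ odd (size z) -> (1 < n)%N -> w <> power z n].

Lemma dvdn_period_power w m : (0 < size w)%N -> (0 < m)%N -> periodic m (periodic_word w) ->
  ~~ (size w %| m)%N ->
  exists z n, [/\ (1 < n)%N, w = power z n & size z = gcdn (size w) m].
Proof.
move=> w_gt0 m_gt0 pm ndv; set d := gcdn (size w) m.
have d_gt0 : (0 < d)%N by rewrite gcdn_gt0 w_gt0.
have [||z sz wE] := @power_of_period w d d_gt0; first exact: dvdn_gcdl.
  by apply: periodic_gcd => //; apply: periodic_word_periodic.
exists z, (size w %/ d)%N; split=> //; rewrite ltn_divRL ?dvdn_gcdl // mul1n.
rewrite ltn_neqAle dvdn_leq ?dvdn_gcdl // andbT.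
by apply: contra ndv => /eqP <-; apply: dvdn_gcdr.
Qed.

Lemma primitive_gt0 w : primitive w -> (0 < size w)%N.
Proof. by case=> w0 _; rewrite lt0n size_eq0; apply/eqP. Qed.

Lemma primitive_period w m : primitive w -> periodic m (periodic_word w) -> (size w %| m)%N.
Proof.
move=> pw; case: (posnP m) => [-> // | m_gt0] pm; apply/negPn/negP => ndv.
have [z [n [n_gt1 wE _]]] := dvdn_period_power (primitive_gt0 pw) m_gt0 pm ndv.
by case: pw => _ /(_ z n n_gt1).
Qed.

(** Equal tails at positions of the same parity give an even period smaller than the length; its gcd
    with the even length is even as well, so w would be a power of a shorter even word. *)
Lemma even_primitive_separated w : even_primitive w -> separated (size w) (periodic_word w).
Proof.
move=> [w_gt0 w_even nw] i j; wlog lt : i j / (i < j)%N => [wl lti ltj odd_ij e | lti ltj odd_ij e].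
  case: (ltngtP i j) => // lt; first exact: wl.
  by apply/esym/wl => // l; rewrite e.
have m_gt0 : (0 < j - i)%N by rewrite subn_gt0.
have pm : periodic (j - i) (periodic_word w).
  move=> l; have pw := @periodic_word_periodic w.
  have le_i : (i <= size w)%N by apply: ltnW.
  have := e (l + (size w - i))%N; rewrite /shift addnCA subnKC // pw => ->.
  rewrite -[in LHS]pw; congr periodic_word; lia.
have ndv : ~~ (size w %| j - i)%N.
  by apply/negP => /(dvdn_leq m_gt0); rewrite leqNgt; case/negP; lia.
have [z [n [n_gt1 wE sz]]] := dvdn_period_power w_gt0 m_gt0 pm ndv.
case: (nw z n) => //; rewrite sz; have m_even : ~~ odd (j - i).
  by rewrite oddB ?odd_ij ?addbb // ltnW.
by rewrite -dvdn2 dvdn_gcd !dvdn2 w_even.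
Qed.

Definition odd_antiperiodic (u : nat -> letter) : Prop :=
  exists2 m, odd m & forall i, u (i + m)%N = dual_letter (u i).

Lemma not_odd_antiperiodic_shift n u : periodic n u -> ~~ odd n -> (0 < n)%N ->
    ~ odd_antiperiodic u ->
  forall i j, odd i != odd j -> ~ (forall l, shift i u l = dual_letter (shift j u l)).
Proof.
(* The number [n * j - j] represents -j modulo [n] and, [n] being even, has the parity of [j]. *)
move=> pu n_even n_gt0 na i j odd_ij e; apply: na; exists (i + (n * j - j))%N.
  have le : (j <= n * j)%N by rewrite leq_pmull.
  by rewrite oddD oddB // oddM (negbTE n_even) /=; case: (odd i) (odd j) odd_ij => -[].
move=> l; have le : (j <= n * j)%N by rewrite leq_pmull.
have := e (l + (n * j - j))%N; rewrite /shift addnCA => ->; congr dual_letter.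
rewrite addnCA subnKC //; elim: (j) => [|a IHa]; first by rewrite muln0 addn0.
by rewrite mulnS addnCA addnC pu.
Qed.

Lemma antiperiodic_period (u : nat -> letter) m :
  (forall i, u (i + m)%N = dual_letter (u i)) -> periodic m.*2 u.
Proof. by move=> e i; rewrite -addnn addnA !e dual_letterK. Qed.

Lemma antiperiodic_not_period (u : nat -> letter) m :
  (forall i, u (i + m)%N = dual_letter (u i)) -> ~ periodic m u.
Proof. by move=> e /(_ 0); rewrite e; case: (u 0). Qed.

Lemma self_dualP w : (0 < size w)%N ->
  self_dual w <-> exists m, forall i, periodic_word w (i + m) = dual_letter (periodic_word w i).
Proof.
move=> w_gt0; split=> -[m e]; exists m.
  by move=> i; rewrite addnC -periodic_word_iter_tau -e periodic_word_dual.
apply: periodic_word_inj; first by rewrite size_iter_tau size_dual.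
by move=> i; rewrite periodic_word_iter_tau periodic_word_dual // addnC e.
Qed.

(** Twice an antiperiod is a period, hence a multiple of the length. An even multiple would make the
    antiperiod itself a period, which no letter allows. *)
Lemma primitive_antiperiod w m : primitive w ->
    (forall i, periodic_word w (i + m) = dual_letter (periodic_word w i)) ->
  exists2 a, odd a & (m.*2 = a * size w)%N.
Proof.
move=> pw e; have /dvdnP [a aE] := primitive_period pw (antiperiodic_period e).
exists a => //; apply/negPn/negP => a_even; case: (antiperiodic_not_period e).
have -> : m = (a./2 * size w)%N.
  by apply: double_inj; rewrite aE doubleMl -{1}(odd_double_half a) (negbTE a_even) add0n.
exact/periodic_mul/periodic_word_periodic.
Qed.

Lemma primitive_half_antiperiod w m : primitive w ->
    (forall i, periodic_word w (i + m) = dual_letter (periodic_word w i)) ->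
  forall l, size w = l.*2 ->
  forall i, periodic_word w (i + l) = dual_letter (periodic_word w i).
Proof.
move=> pw e l wE i; have [a a_odd aE] := primitive_antiperiod pw e.
have mE : m = (l + a./2 * size w)%N.
  have aE1 : a = (1 + a./2.*2)%N by rewrite -{1}(odd_double_half a) a_odd.
  by apply: double_inj; rewrite aE {1}aE1 wE -!muln2; ring.
by rewrite -e mE addnA periodic_mul //; apply: periodic_word_periodic.
Qed.

Lemma antiperiodic_split w l : size w = l.*2 ->
    (forall i, periodic_word w (i + l) = dual_letter (periodic_word w i)) ->
  exists2 y, w = y ++ dual y & size y = l.
Proof.
move=> wE e; pose s := rev w; have ss : size s = l.*2 by rewrite size_rev.
have le_l : (l <= size s)%N by rewrite ss -addnn leq_addr.
have dropE : drop l s = dual (take l s).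
  apply: (@eq_from_nth _ lf) => [|i]; first by rewrite size_dual size_drop size_takel // ss; lia.
  rewrite size_drop => lt; have lt_i : (i < l)%N by move: lt; rewrite ss; lia.
  rewrite nth_drop (nth_map lf) ?size_takel // nth_take //.
  have := e i; rewrite /periodic_word /letter_at -/s !modn_small ?wE 1?addnC //; lia.
exists (rev (drop l s)); last by rewrite size_rev size_drop ss; lia.
rewrite {2}dropE /dual map_rev -/(dual _) dualK -rev_cat cat_take_drop.
by rewrite revK.
Qed.

Lemma antiperiodic_cat_dual y i : (0 < size y)%N ->
  periodic_word (y ++ dual y) (i + size y) = dual_letter (periodic_word (y ++ dual y) i).
Proof.
move=> y_gt0; rewrite -periodic_word_dual ?size_cat ?addn_gt0 ?y_gt0 //.
have -> : dual (y ++ dual y) = dual y ++ y.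
  by rewrite /dual map_cat -!/(dual _) dualK.
suff iter_tau_cat (s t : word) : iter (size t) tau (s ++ t) = t ++ s.
  by rewrite -(iter_tau_cat y (dual y)) periodic_word_iter_tau size_dual addnC.
elim/last_ind: t s => [|t u IHt] s; first by rewrite cats0.
by rewrite size_rcons iterSr -rcons_cat /tau rotr1_rcons -cat_cons IHt cat_rcons.
Qed.

(** * Existence of the decomposition *)

(** If w = z^n with n > 1, then z is odd and n is even, so w is a power of the even word zz; this
    forces n = 2. *)
Lemma even_primitive_cases w : even_primitive w -> primitive w \/ in_W4 w.
Proof.
move=> [w_gt0 w_even nw]; have [pw | npw] := classic (primitive w); first by left.
right; have [z [n [n_gt1 wE]]] : exists z n, (1 < n)%N /\ w = power z n.
  apply: NNPP => nex; apply: npw; split=> [w0 | z n n_gt1 wE]; first by rewrite w0 in w_gt0.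
  by apply: nex; exists z, n.
have z_odd : odd (size z) by apply/negPn/negP => z_even; apply: (nw z n z_even n_gt1 wE).
have n_even : ~~ odd n by move: w_even; rewrite wE size_power oddM z_odd andbT.
have nE : (n = 2 * n./2)%N by rewrite mul2n -[LHS]odd_double_half (negbTE n_even).
have {nE} nE : n = 2.
  have := nw (power z 2) n./2; rewrite -powerM -nE size_power oddM /= => /(_ isT) h.
  by case: (ltnP 1 n./2) => [/h // | ]; move: n_gt1 nE; clear; lia.
exists z; split=> //; first by rewrite wE nE power2.
split=> [z0 | y m m_gt1 zE].
  by rewrite z0 in z_odd.
case: (nw (power y 2) m) => //; first by rewrite size_power oddM.
by rewrite wE nE zE -!powerM mulnC.
Qed.

(** The form zz is excluded, since twice an antiperiod of z would be a product of two odd numbers.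
    For w primitive, the odd antiperiod is a multiple of half the length, so that half is odd. *)
Lemma even_primitive_odd_antiperiodic w : even_primitive w ->
  odd_antiperiodic (periodic_word w) -> in_W1 w.
Proof.
move=> ew [m m_odd mE]; have [w_gt0 w_even _] := ew.
have pw : primitive w.
  case: (even_primitive_cases ew) => // -[z [wE pz z_odd]].
  have zE : periodic_word w =1 periodic_word z.
    by move=> i; rewrite wE -power2 periodic_word_power.
  have mE' i : periodic_word z (i + m) = dual_letter (periodic_word z i) by rewrite -!zE.
  have [a a_odd aE] := primitive_antiperiod pz mE'.
  by have := congr1 odd aE; rewrite odd_double oddM a_odd z_odd.
have [a a_odd aE] := primitive_antiperiod pw mE.
have wE : size w = (size w)./2.*2 by rewrite -[LHS]odd_double_half (negbTE w_even).
have anti := primitive_half_antiperiod pw mE wE.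
have l_odd : odd (size w)./2.
  move: m_odd; have -> : m = (a * (size w)./2)%N.
    by apply: double_inj; rewrite doubleMr -wE.
  by rewrite oddM => /andP [].
have [y yE sy] := antiperiodic_split wE anti.
split=> //; last by exists y; rewrite ?sy.
by apply/self_dualP => //; exists m.
Qed.

Lemma even_primitive_not_odd_antiperiodic w : even_primitive w ->
  ~ odd_antiperiodic (periodic_word w) -> [\/ in_W2 w, in_W3 w | in_W4 w].
Proof.
move=> ew na; have [w_gt0 w_even _] := ew.
case: (even_primitive_cases ew) => [pw | ]; last by constructor 3.
have [sd | nsd] := classic (self_dual w); last by constructor 1.
constructor 2; have [m mE] := (self_dualP w_gt0).1 sd.
have wE : size w = (size w)./2.*2 by rewrite -[LHS]odd_double_half (negbTE w_even).
have anti := primitive_half_antiperiod pw mE wE.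
have [y yE sy] := antiperiodic_split wE anti; split=> //; exists y; rewrite ?sy //.
by apply/negP => l_odd; apply: na; exists (size w)./2.
Qed.

Section HermitianForm.

Variables (k : closedFieldType) (p : nat).
Hypotheses (charp : p \in [pchar k]) (p_gt2 : (2 < p)%N).
Let p_prime : prime p := pcharf_prime charp.
Variable M : ufv_module k.
Hypothesis hM : is_unitary_BT1 p M.
Let symp := unitary_symplectic hM.
Variables (l : nat) (u : nat -> letter) (c : k).
Hypotheses (l_odd : odd l) (anti : forall i, u (i + l)%N = dual_letter (u i)).
Hypotheses (c_neq0 : c != 0) (cl : c ^+ (p ^ l) = - c).

(** Closed chains form a vector space over the field with p^(2l) elements, t acting at index i by
    t^(p^i). On it [H] is skew-Hermitian for the conjugation t -> t^(p^l). *)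
Let H (a b : nat -> M) := pairing (a 0) (b l).

Definition closed_along (a : nat -> M) := chain false u a /\ periodic l.*2 a.

Lemma chain_antishift (b : nat -> M) : chain false u b -> chain true (dual_seq u) (shift l b).
Proof.
move=> cb i; have := cb (l + i)%N; rewrite oddD l_odd /= addnC anti /dual_seq.
by rewrite /shift addnS addnC.
Qed.

Lemma hermitian_skew a b : closed_along a -> closed_along b -> H b a = - H a b ^+ (p ^ l).
Proof.
move=> [ca pa] [cb pb]; rewrite /H (formC symp); congr (- _).
have := chain_pairing charp hM l ca (chain_antishift cb).
by rewrite /shift addn0 addnn -[l.*2]add0n pb.
Qed.

Lemma twist_period t : t ^+ (p ^ l.*2) = t ->
  forall a, closed_along a -> closed_along (fun i => t ^+ (p ^ i) *: a i).
Proof.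
move=> tE a [ca pa]; split=> [|i]; first exact: chainZ.
by rewrite pa addnC expnD exprM tE.
Qed.

Lemma closed_scaled_pairing t (a : nat -> M) : H (fun i => t ^+ (p ^ i) *: a i) (fun i => t ^+ (p ^ i) *: a i) =
  t ^+ (p ^ l).+1 * H a a.
Proof. by rewrite /H (formZl symp) (formZr symp) mulrA exprS expn0 expr1. Qed.

(* Polarization: one of a, b, a + b and a + c b is anisotropic. *)
Lemma anisotropic_chain a b : closed_along a -> closed_along b -> H a b != 0 ->
  exists2 d, closed_along d & H d d != 0.
Proof.
move=> ha hb ab; have [aa | ?] := eqVneq (H a a) 0; last by exists a.
have [bb | ?] := eqVneq (H b b) 0; last by exists b.
have cE : c ^+ (p ^ l.*2) = c.
  by rewrite -addnn expnD exprM cl frob_powerN // cl opprK.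
have two_neq0 : (2%:R : k) != 0.
  rewrite -(dvdn_pcharf charp); apply/negP => /dvdn_leq -/(_ isT).
  by rewrite leqNgt p_gt2.
pose d t i := a i + t ^+ (p ^ i) *: b i.
have hd t : t ^+ (p ^ l.*2) = t -> closed_along (d t).
  move=> tE; have [ct pt] := twist_period tE hb; have [ca pa] := ha.
  by split=> [|i]; [apply: (chainD hM) | rewrite /d pa pt].
have dd t : H (d t) (d t) = t ^+ (p ^ l) * H a b - t * H a b ^+ (p ^ l).
  rewrite /d {1}/H (formDl symp) !(formDr symp) !(formZl symp) !(formZr symp).
  rewrite -/(H a a) -/(H a b) -/(H b a) -/(H b b) aa bb (hermitian_skew ha hb) expn0 expr1.
  by ring.
(* With h = H a b, the vector a + t b has value t^(p^l) h - t h^(p^l). For h self-conjugate the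
   choice t = c gives -2ch; otherwise t = 1 gives a nonzero value. *)
have [abE | ne] := eqVneq (H a b) (H a b ^+ (p ^ l)).
  exists (d c); first exact: hd.
  rewrite dd -abE cl mulNr -opprD -mulr2n -mulr_natl oppr_eq0 !mulf_neq0 //.
by exists (d 1); [apply: hd; rewrite expr1n | rewrite dd expr1n !mul1r subr_eq0].
Qed.

(** Scaling by t multiplies the value by t^(p^l + 1). Both [c] and [H d d] are negated by
    conjugation, so their quotient is fixed by it; this yields t^(p^(2l)) = t, and the scaled chain
    is still closed. *)
Lemma normalized_chain d : closed_along d -> H d d != 0 ->
  exists2 a, closed_along a & pairing (a 0) (a l) = c.
Proof.
move=> hd dd; have ddE : H d d ^+ (p ^ l) = - H d d by rewrite [in RHS](hermitian_skew hd hd) opprK.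
have [t tE] := expr_surj (c / H d d) (ltn0Sn (p ^ l)).
have t_neq0 : t != 0.
  by apply: contraNneq c_neq0 => t0; move/eqP: tE; rewrite t0 expr0n eq_sym mulf_eq0 invr_eq0 (negbTE dd) orbF.
exists (fun i => t ^+ (p ^ i) *: d i); last first.
  by rewrite -/(H (fun i => t ^+ (p ^ i) *: d i) (fun i => t ^+ (p ^ i) *: d i))
    closed_scaled_pairing tE divfK.
apply: twist_period hd; apply: (mulfI (expf_neq0 (p ^ l) t_neq0)).
have : (t ^+ (p ^ l).+1) ^+ (p ^ l) = t ^+ (p ^ l).+1.
  by rewrite tE exprMn exprVn cl ddE invrN mulrNN.
by rewrite exprS exprMn -addnn expnD exprM => ->; rewrite mulrC.
Qed.

End HermitianForm.

Section Existence.

Variables (k : closedFieldType) (p : nat).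
Hypotheses (charp : p \in [pchar k]) (p_gt2 : (2 < p)%N).
Let p_prime : prime p := pcharf_prime charp.
Variable c : word -> k.
Hypothesis hc : unicycle_const p c.

Lemma in_W1_half w : in_W1 w -> exists l, [/\ size w = l.*2, odd l,
  forall i, periodic_word w (i + l) = dual_letter (periodic_word w i),
  c w != 0 & c w ^+ (p ^ l) = - c w].
Proof.
case=> pw _ [y wE y_odd]; exists (size y); rewrite wE in pw *; have [c0 cl] := hc pw y_odd.
split=> //; first by rewrite size_cat size_dual addnn.
by move=> i; apply: antiperiodic_cat_dual; rewrite odd_gt0.
Qed.

Lemma exists_embedded_cycle (M : ufv_module k) : is_unitary_BT1 p M -> (0 < \dim {:M})%N ->
  exists w, (in_W1 w /\ exists psi : {linear Mtilde1 p (c w) w -> M}, unitary_embedding psi) \/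
    ([\/ in_W2 w, in_W3 w | in_W4 w] /\
     exists psi : {linear Mtilde2 k p w -> M}, unitary_embedding psi).
Proof.
move=> hM dim_gt0; have symp := unitary_symplectic hM.
have [v [v_gt0 v_even nv adm]] := primitive_admissible_power charp hM (\dim {:M}) dim_gt0.
have [x [y [xx yy xy]]] := admissible_closed_pair charp hM v_gt0 v_even adm.
pose w := rev v; have sw : size w = size v by rewrite size_rev.
have ew : even_primitive w.
  split; rewrite ?sw // => z n z_even n_gt1 wE; apply: (nv (rev z) n) => //.
    by rewrite size_rev.
  by rewrite -rev_power -wE revK.
have [w_gt0 w_even _] := ew; have sep := even_primitive_separated ew.
have pw := @periodic_word_periodic w.
have [a [a0 ca pa]] : exists a, [/\ a 0 = x, chain false (periodic_word w) a & periodic (size w) a].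
  by apply: closed_chain; rewrite ?sw ?revK.
have [b [b0 cb pb]] : exists b, [/\ b 0 = y, chain true (periodic_word (dual w)) b
    & periodic (size (dual w)) b].
  by apply: closed_chain; rewrite ?size_dual ?sw // /w /dual map_rev revK.
rewrite size_dual in pb; have {}cb : chain true (dual_seq (periodic_word w)) b.
  by apply: eq_chain cb => i; rewrite periodic_word_dual.
exists w; have [oa | noa] := classic (odd_antiperiodic (periodic_word w)).
  left; have w1 := even_primitive_odd_antiperiodic ew oa; split=> //.
  have [l [wE l_odd anti c0 cl]] := in_W1_half w1; rewrite wE in pa pb.
  (* Along the dual word, shifting by the odd antiperiod gives a chain along w starting in degree 0,
     so both chains live in the same skew-Hermitian space. *)
  have hb : closed_along l (periodic_word w) (shift l b).
    split; last exact: shift_periodic.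
    move=> i; have := cb (l + i)%N; rewrite oddD l_odd /= negbK.
    by rewrite /dual_seq /shift addnS (addnC l) anti dual_letterK.
  have ha : closed_along l (periodic_word w) a by [].
  have ab : pairing (a 0) (shift l b l) != 0.
    by rewrite /shift addnn -[l.*2]add0n pb a0 b0; apply/eqP.
  have [d hd dd] := anisotropic_chain charp p_gt2 hM l_odd anti c0 cl ha hb ab.
  have [e [ce pe] ee] := normalized_chain charp hM l_odd anti c0 cl hd dd.
  rewrite -wE in pe; have n_even := negbTE w_even.
  have [e' [ce' pe' ee']] := exact_self_chain charp p_gt2 hM w_gt0 n_even pw sep
    wE l_odd anti c0 cl ce pe ee.
  exact: (Mtilde1_embedding charp wE l_odd hM ce' pe' ee').
right; split; first exact: even_primitive_not_odd_antiperiodic.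
have nd := not_odd_antiperiodic_shift pw w_even w_gt0 noa.
(* The pairing of two closed chains is fixed by the power p^|w|, so scaling by its inverse keeps the
   chain periodic. *)
pose t := (pairing x y)^-1.
have tE : t ^+ (p ^ size w) = t.
  rewrite /t exprVn -a0 -b0 -(chain_pairing charp hM _ ca cb).
  by rewrite -[size w]add0n pa pb.
have [||||a' [b' [ca' cb' [pa' pb'] ab' aabb']]] :=
    @exact_pair_of_chains k p charp p_gt2 M hM _ _ w_gt0 (negbTE w_even) pw sep
      a (fun i => t ^+ (p ^ i) *: b i) nd ca.
- exact: chainZ.
- exact: pa.
- by move=> i; rewrite pb addnC expnD exprM tE.
- rewrite (formZr symp) expn0 expr1 a0 b0 mulVf //; exact/eqP.
exact: (Mtilde2_embedding charp hM w_gt0 ca' cb' pa' pb' ab' aabb').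
Qed.

End Existence.

Section Decomposition.

Variables (k : closedFieldType) (p : nat).
Hypotheses (charp : p \in [pchar k]) (p_gt2 : (2 < p)%N).
Variable c : word -> k.
Hypothesis hc : unicycle_const p c.

Lemma ufv_sum_swap (M N P : ufv_module k) :
  unitary_iso (ufv_sum M (ufv_sum N P)) (ufv_sum N (ufv_sum M P)).
Proof.
apply: unitary_iso_trans (ufv_sumA _ _ _) _; apply: unitary_iso_sym.
apply: unitary_iso_trans (ufv_sumA _ _ _) _.
by apply: ufv_sum_iso; [apply: ufv_sumC | apply: unitary_iso_refl].
Qed.

Lemma Mtilde1_in_W1_unitary w : in_W1 w -> is_unitary_BT1 p (Mtilde1 p (c w) w).
Proof.
case/(in_W1_half hc) => l [wE l_odd anti c0 cl].
exact: (Mtilde1_unitary charp p_gt2 wE l_odd anti c0 cl).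
Qed.

Lemma W234_even w : [\/ in_W2 w, in_W3 w | in_W4 w] -> odd (size w) = false /\ (0 < size w)%N.
Proof.
case=> [[/primitive_gt0 w_gt0 _ /negbTE] // | [/primitive_gt0 w_gt0 _ [y wE _]] |
  [z [-> /primitive_gt0 z_gt0 z_odd]]].
  by split; rewrite // wE size_cat size_dual addnn odd_double.
by rewrite size_cat addnn odd_double double_gt0.
Qed.

Lemma unitary_decomposition (M : ufv_module k) : is_unitary_BT1 p M ->
  exists W1 W2 W3 W4 : seq word, cycle_multisets W1 W2 W3 W4 /\
    unitary_iso M (cycle_sum p c W1 W2 W3 W4).
Proof.
have [n] := ubnP (\dim {:M}); elim: n M => // n IHn M; rewrite ltnS => le_n hM.
have [dim0 | dim_gt0] := posnP (\dim {:M}).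
  exists [::], [::], [::], [::]; split; first by [].
  have M0 (x : M) : x = 0.
    by apply/eqP; rewrite -memv0 -(eqP (_ : fullv == 0%VS)) ?memvf // -dimv_eq0 dim0.
  rewrite /cycle_sum !big_nil.
  apply: (@unitary_iso_trans _ _ (ufv_zero k)).
    apply: (@unitary_iso_of _ M (ufv_zero k) (fun=> 0) (fun=> 0)).
    - by move=> a x y; rewrite scaler0 addr0.
    - by move=> x; rewrite (M0 x).
    - by move=> x; rewrite [x]thinmx0.
    - by [].
    - by [].
    - by move=> x y; rewrite (M0 x) (form0l (unitary_symplectic hM)).
    - by move=> i x; rewrite (M0 x) !mem0v.
  have sum0 (N : ufv_module k) : unitary_iso (ufv_zero k) N -> unitary_iso (ufv_zero k) (ufv_sum (ufv_zero k) N).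
    move=> iN; apply: unitary_iso_trans (unitary_iso_sym (ufv_sum0 _)) _.
    by apply: ufv_sum_iso iN; apply: unitary_iso_refl.
  by do 3![apply: (sum0)]; apply: unitary_iso_refl.
have split_off (T : ufv_module k) (psi : {linear T -> M}) : is_unitary_BT1 p T ->
    unitary_embedding psi -> (0 < \dim {:T})%N ->
    exists W1 W2 W3 W4, cycle_multisets W1 W2 W3 W4 /\
      unitary_iso M (ufv_sum T (cycle_sum p c W1 W2 W3 W4)).
  move=> hT emb T_gt0; have [W WE] := orthogonal_complement_exists psi hM.
  have hC := complement_unitary charp hT hM emb WE.
  have [|W1 [W2 [W3 [W4 [msW iC]]]]] := IHn _ _ hC.
    apply: leq_ltn_trans (complement_dim hT hM emb WE) _.
    by apply: leq_trans le_n; rewrite ltn_subrL T_gt0.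
  exists W1, W2, W3, W4; split=> //.
  apply: unitary_iso_trans (complement_iso charp hT hM emb WE) _.
  by apply: ufv_sum_iso iC; apply: unitary_iso_refl.
have dim_rV m : \dim {:'rV[k]_m} = m by rewrite dimvf /dim /= mul1n.
have memS (P : word -> Prop) w (W : seq word) : P w -> {in W, forall v, P v} -> {in w :: W, forall v, P v}.
  by move=> Pw PW v; rewrite inE => /predU1P [-> // | /PW].
have [w [[w1 [psi emb]] | [w234 [psi emb]]]] := exists_embedded_cycle charp p_gt2 hc hM dim_gt0.
  have hT := Mtilde1_in_W1_unitary w1.
  have [|W1 [W2 [W3 [W4 [[m1 m2 m3 m4] iM]]]]] := split_off _ psi hT emb.
    by rewrite [\dim _]dim_rV; case: w1 => /primitive_gt0.
  exists (w :: W1), W2, W3, W4; split; first by split=> //; apply: memS.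
  apply: unitary_iso_trans iM _; rewrite /cycle_sum big_cons; exact: ufv_sumA.
have [w_even w_gt0] := W234_even w234; have hT := Mtilde2_unitary charp w_even.
have [|W1 [W2 [W3 [W4 [[m1 m2 m3 m4] iM]]]]] := split_off _ psi hT emb.
  by rewrite dimvf /dim /= {1}/dim /= mul1n addn_gt0 w_gt0.
have congr_sum (A X Y : ufv_module k) : unitary_iso X Y -> unitary_iso (ufv_sum A X) (ufv_sum A Y).
  by move=> iXY; apply: ufv_sum_iso iXY; apply: unitary_iso_refl.
have push (A X Y : ufv_module k) : unitary_iso (ufv_sum (Mtilde2 k p w) X) Y ->
    unitary_iso (ufv_sum (Mtilde2 k p w) (ufv_sum A X)) (ufv_sum A Y).
  by move=> iXY; apply: unitary_iso_trans (ufv_sum_swap _ _ _) _; apply: congr_sum.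
case: w234 => wW.
- exists W1, (w :: W2), W3, W4; split; first by split=> //; apply: memS.
  apply: unitary_iso_trans iM _; apply: (push); rewrite big_cons; exact: ufv_sumA.
- exists W1, W2, (w :: W3), W4; split; first by split=> //; apply: memS.
  apply: unitary_iso_trans iM _; do 2![apply: (push)]; rewrite big_cons; exact: ufv_sumA.
- exists W1, W2, W3, (w :: W4); split; first by split=> //; apply: memS.
  apply: unitary_iso_trans iM _; do 3![apply: (push)]; rewrite big_cons; exact: unitary_iso_refl.
Qed.

End Decomposition.

(** * Multiplicities *)

Section Multiplicity.

Variable k : closedFieldType.
Implicit Types (M N : ufv_module k) (u : nat -> letter).

Definition chain_start M (g : bool) u (x : M) : Prop :=
  exists2 a : nat -> M, a 0 = x & chain g u a.

(** What a zero component must satisfy in a direct sum: it starts a chain along every word and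
    contributes nothing to the pairing. *)
Definition pointed M : Prop :=
  [/\ frob (0 : M) = 0, vers (0 : M) = 0, forall x : M, pairing 0 x = 0
    & forall x : M, pairing x 0 = 0].

(* r is the rank of the pairing between first terms of chains along u and first
   terms of chains along the dual word. *)
Definition multiplicity M u (r : nat) : Prop :=
  [/\ pointed M,
      forall m (x y : 'I_m -> M), (forall i, chain_start false u (x i)) ->
        (forall i, chain_start true (dual_seq u) (y i)) ->
        (\rank (\matrix_(i, j) pairing (x i) (y j)) <= r)%N
    & exists x y : 'I_r -> M, [/\ forall i, chain_start false u (x i),
        forall i, chain_start true (dual_seq u) (y i)
      & forall i j, pairing (x i) (y j) = (i == j)%:R]].

Lemma multiplicity_unique M u r r' : multiplicity M u r -> multiplicity M u r' -> r = r'.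
Proof.
suff le s s' : multiplicity M u s -> multiplicity M u s' -> (s <= s')%N.
  by move=> h h'; apply/anti_leq; rewrite !le.
move=> [_ _ [x [y [xs ys xy]]]] [_ /(_ s x y xs ys) + _].
by rewrite (_ : \matrix_(_, _) _ = 1%:M) ?mxrank1 //; apply/matrixP => i j; rewrite !mxE.
Qed.

Lemma chain_start_iso M N (phi : {linear M -> N}) g u x :
    (forall x, phi (frob x) = frob (phi x)) -> (forall x, phi (vers x) = vers (phi x)) ->
    (forall i x, (phi x \in grad N i) = (x \in grad M i)) ->
  chain_start g u x -> chain_start g u (phi x).
Proof.
move=> pF pV pg [a a0 ca]; exists (fun i => phi (a i)); first by rewrite a0.
move=> i; have [x1 x2 x3] := ca i; split; rewrite ?pg //.
by case: (u i) x3 => ->; rewrite ?pF ?pV.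
Qed.

Lemma multiplicity_iso M N u r : unitary_iso M N -> multiplicity M u r -> multiplicity N u r.
Proof.
move=> iMN; case: (iMN) => phi [[g phiK gK] [pF pV] pp pg].
case: (unitary_iso_sym iMN) => psi [_ [qF qV] qp qg].
move=> [[F0 V0 p0l p0r] le [x [y [xs ys xy]]]]; split.
- split; rewrite -?(linear0 phi) -?pF -?pV ?F0 ?V0 //.
    by move=> z; rewrite -(gK z) linear0 -(linear0 phi) pp p0l.
  by move=> z; rewrite -(gK z) linear0 -(linear0 phi) pp p0r.
- move=> m x' y' xs' ys'; have := le m (fun i => psi (x' i)) (fun i => psi (y' i)).
  rewrite (_ : \matrix_(_, _) _ = \matrix_(i, j) pairing (x' i) (y' j)); last first.
    by apply/matrixP => i j; rewrite !mxE qp.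
  by apply=> i; apply: chain_start_iso.
- exists (fun i => phi (x i)), (fun i => phi (y i)); split=> [i|i|i j].
  + exact: chain_start_iso.
  + exact: chain_start_iso.
  + by rewrite pp.
Qed.

Lemma multiplicity_zero u : multiplicity (ufv_zero k) u 0.
Proof.
split.
- by split=> //=.
- move=> m x y _ _; rewrite (_ : \matrix_(_, _) _ = 0) ?mxrank0 //.
  by apply/matrixP => i j; rewrite !mxE.
- by exists (fun=> 0), (fun=> 0); split=> -[].
Qed.

Lemma chain_start_zero M g u : pointed M -> chain_start g u (0 : M).
Proof.
move=> [F0 V0 _ _]; exists (fun=> 0) => // i; split; rewrite ?mem0v //.
by case: (u i).
Qed.

Lemma chain_start_sum M N g u (x : ufv_sum M N) :
  chain_start g u x <-> chain_start g u x.1 /\ chain_start g u x.2.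
Proof.
split=> [[a a0 ca] | [[a a0 ca] [b b0 cb]]].
  have c12 i : gstep (g (+) odd i) (u i) (a i).1 (a i.+1).1 /\
               gstep (g (+) odd i) (u i) (a i).2 (a i.+1).2.
    have [] := ca i; rewrite !mem_vspace_prod => /andP [x1 x2] /andP [y1 y2].
    by case: (u i) => e; do 2![split=> //]; rewrite e.
  by split; [exists (fun i => (a i).1) | exists (fun i => (a i).2)];
    rewrite ?a0 // => i; case: (c12 i).
exists (fun i => (a i, b i)); first by rewrite a0 b0; case: (x).
move=> i; have [x1 x2 x3] := ca i; have [y1 y2 y3] := cb i.
split; rewrite ?mem_vspace_prod /= ?x1 ?x2 //.
by case: (u i) x3 y3 => -> ->.
Qed.

(** The upper bound is subadditivity of the rank of a matrix; dual systems of the summands, padded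
    with zeros, form a dual system of the sum. *)
Lemma multiplicity_sum M N u r s :
  multiplicity M u r -> multiplicity N u s -> multiplicity (ufv_sum M N) u (r + s).
Proof.
move=> [pM leM [x [y [xs ys xy]]]] [pN leN [x' [y' [xs' ys' xy']]]].
case: (pM) (pN) => [F0 V0 p0l p0r] [F0' V0' p0l' p0r']; split.
- split; rewrite /= ?F0 ?F0' ?V0 ?V0' //.
    by move=> z; rewrite p0l p0l' addr0.
  by move=> z; rewrite p0r p0r' addr0.
- move=> m z t zs ts.
  have -> : \matrix_(i, j) pairing (z i) (t j) =
      \matrix_(i, j) pairing (z i).1 (t j).1 + \matrix_(i, j) pairing (z i).2 (t j).2.
    by apply/matrixP => i j; rewrite !mxE.
  apply: leq_trans (mxrank_add _ _) _; apply: leq_add.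
    apply: (leM m (fun i => (z i).1) (fun i => (t i).1)) => i.
      by case: (chain_start_sum false u (z i)) => /(_ (zs i)) [].
    by case: (chain_start_sum true (dual_seq u) (t i)) => /(_ (ts i)) [].
  apply: (leN m (fun i => (z i).2) (fun i => (t i).2)) => i.
    by case: (chain_start_sum false u (z i)) => /(_ (zs i)) [].
  by case: (chain_start_sum true (dual_seq u) (t i)) => /(_ (ts i)) [].
pose z (i : 'I_(r + s)) : ufv_sum M N := match split i with inl j => (x j, 0) | inr j => (0, x' j) end.
pose t (i : 'I_(r + s)) : ufv_sum M N := match split i with inl j => (y j, 0) | inr j => (0, y' j) end.
exists z, t; split=> [i|i|i j].
- by apply/chain_start_sum; rewrite /z; case: split => j /=; split=> //; apply: chain_start_zero.
- by apply/chain_start_sum; rewrite /t; case: split => j /=; split=> //; apply: chain_start_zero.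
rewrite /z /t -(inj_eq (can_inj (@splitK r s))).
by case: (split i) => a; case: (split j) => b /=; rewrite ?xy ?xy' ?p0l ?p0r ?p0l' ?p0r' ?addr0 ?add0r.
Qed.

Lemma multiplicity_big (W : seq word) (T : word -> ufv_module k) (m : word -> nat) u :
    {in W, forall w, multiplicity (T w) u (m w)} ->
  multiplicity (\big[@ufv_sum k/ufv_zero k]_(w <- W) T w) u (\sum_(w <- W) m w).
Proof.
elim: W => [|w W IHW] h; first by rewrite !big_nil; apply: multiplicity_zero.
rewrite !big_cons; apply: multiplicity_sum; first by apply: h; rewrite mem_head.
by apply: IHW => v vW; apply: h; rewrite inE vW orbT.
Qed.

End Multiplicity.

(** * Multiplicities of the standard modules *)

Lemma mxrank_sum_outer (K : fieldType) (I : finType) (P : pred I) m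
    (x : I -> 'I_m -> K) (y : I -> 'I_m -> K) :
  (\rank (\matrix_(i, j) (\sum_(l | P l) x l i * y l j))%R <= #|P|)%N.
Proof.
have -> : \matrix_(i, j) (\sum_(l | P l) x l i * y l j) =
    \sum_(l | P l) (\col_i (x l i)) *m (\row_j (y l j)).
  by apply/matrixP => i j; rewrite mxE summxE; apply: eq_bigr => l _; rewrite !mxE big_ord1 !mxE.
rewrite -sum1_card; apply: (big_ind2 (fun (A : 'M_m) n => \rank A <= n)%N).
- by rewrite mxrank0.
- by move=> A n B n' le le'; apply: leq_trans (mxrank_add _ _) _; apply: leq_add.
- by move=> l _; apply: leq_trans (mxrankM_maxl _ _) (rank_leq_col _).
Qed.

(** Dualising letters reverses the lexicographic order, so the two inequalities are opposite. *)
Lemma lex_above_dual_eq u v : lex_above u v -> lex_above (dual_seq u) (dual_seq v) -> u =1 v.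
Proof.
move=> ab ab' m; have [n] := ubnP m; elim: n m => // n IHn m; rewrite ltnS => le_m.
have e l : (l < m)%N -> u l = v l by move=> lt; apply: IHn; apply: leq_trans le_m.
have e' l : (l < m)%N -> dual_seq u l = dual_seq v l by move=> /e; rewrite /dual_seq => ->.
have := ab m e; have := ab' m e'; rewrite /dual_seq.
by case: (u m) (v m) => -[] //= h1 h2; [case: h1 | case: h2].
Qed.

Lemma lex_above_ext u u' v v' : u =1 u' -> v =1 v' -> lex_above u v -> lex_above u' v'.
Proof. by move=> e e' ab m lm; rewrite -e -e'; apply: ab => l /lm; rewrite e e'. Qed.

Section CyclicChains.

Variables (k : closedFieldType) (p : nat).
Hypothesis charp : p \in [pchar k].
Let p_prime : prime p := pcharf_prime charp.
Variable w : word.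
Local Notation n := (size w).
Hypotheses (n_gt0 : (0 < n)%N).

Definition cycle_index (i : nat) : 'I_n := Ordinal (ltn_pmod i n_gt0).

Lemma cycle_indexS i : cycle_index i.+1 = ordS (cycle_index i).
Proof. by apply/val_inj; rewrite /= -addn1 -modnDml addn1. Qed.

Lemma cycle_index_periodic : periodic n cycle_index.
Proof. by move=> i; apply/val_inj; rewrite /= modnDr. Qed.

Lemma letter_cycle_index i : letter_at w (cycle_index i) = periodic_word w i.
Proof. by []. Qed.

Lemma bvec_step i : if periodic_word w i is lf
  then bvec k (cycle_index i.+1) = frob (bvec k (cycle_index i) : Mbar k p w)
  else bvec k (cycle_index i) = vers (bvec k (cycle_index i.+1) : Mbar k p w).
Proof.
rewrite cycle_indexS; case e: (periodic_word w i).
  apply: ordS_rowP => j; rewrite Mbar_frobE !bvecE (inj_eq (@ordS_inj n)).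
  have [-> | _] := eqVneq; first by rewrite letter_cycle_index e eqxx expr1n.
  by rewrite expr0n gtn_eqF ?prime_gt0 // if_same.
apply/rowP => j; rewrite Mbar_versE !bvecE (inj_eq (@ordS_inj n)).
have [-> | _] := eqVneq; last by rewrite (proot0 charp) if_same.
rewrite letter_cycle_index e eqxx -[in LHS](prootX charp 1) expr1n.
by [].
Qed.

Lemma bvec_parity b i : odd n = false ->
  b = odd i -> bvec k (cycle_index i) \in (\sum_(j < n | odd j == b) <[bvec k j]>)%VS.
Proof.
move=> n_even ->; apply/mem_parity_span => j jb; rewrite bvecE; case: eqP => // ij.
by move: jb; rewrite ij /= odd_mod // eqxx.
Qed.

(* Together with its dual this forces u to be the word read off at any index where
   the coordinates of both starting vectors are nonzero. *)
Lemma Mbar_chain_coord (u : nat -> letter) (a : nat -> Mbar k p w) i :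
    (forall l, if u l is lf then a l.+1 = frob (a l) else a l = vers (a l.+1)) ->
    (a 0 : 'rV[k]_n) 0 (cycle_index i) != 0 ->
  lex_above u (shift i (periodic_word w)).
Proof.
move=> sa a0 m; elim: m u a i sa a0 => [|m IHm] u a i sa a0 e.
  case=> u0 wi; case/eqP: a0; have := sa 0; rewrite u0 => ->.
  rewrite Mbar_versE letter_cycle_index; move: wi; rewrite /shift addn0 => ->.
  by [].
move=> h; apply: (IHm (shift 1 u) (fun l => a l.+1) i.+1).
- by move=> l; apply: (sa l.+1).
- have := sa 0; have := e 0 (ltn0Sn m); rewrite /shift addn0 => ->.
  case ei: (periodic_word w i) => sa0.
    by rewrite sa0 cycle_indexS Mbar_frobE letter_cycle_index ei eqxx expf_neq0.
  apply: contra a0 => /eqP a1; rewrite sa0 Mbar_versE letter_cycle_index ei eqxx.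
  by rewrite -cycle_indexS a1 (proot0 charp).
- by move=> l lm; have := e l.+1 lm; rewrite /shift addnS addSn.
- by move: h; rewrite /shift addnS addSn.
Qed.

End CyclicChains.

Section BicycleChains.

Variables (k : closedFieldType) (p : nat).
Hypotheses (charp : p \in [pchar k]).
Let p_prime : prime p := pcharf_prime charp.
Variable w : word.
Local Notation n := (size w).
Hypotheses (n_gt0 : (0 < n)%N) (n_even : odd n = false).

Let n_gt0' : (0 < size (dual w))%N. Proof. by rewrite size_dual. Qed.

Definition bicycle_a (i : nat) : Mtilde2 k p w := (bvec k (cycle_index n_gt0 i), 0).
Definition bicycle_b (i : nat) : Mtilde2 k p w := (0, bvec k (cycle_index n_gt0' i)).

Let hT : is_unitary_BT1 p (Mtilde2 k p w) := Mtilde2_unitary charp n_even.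

Lemma bicycle_a_chain : chain false (periodic_word w) bicycle_a.
Proof.
have [F0 V0] : frob (0 : Mtilde2 k p w) = 0 /\ vers (0 : Mtilde2 k p w) = 0.
  by rewrite (frob0 hT) (vers0 hT).
move=> i; split.
- by rewrite mem_vspace_prod /= mem0v bvec_parity.
- by rewrite mem_vspace_prod mem0v andbT bvec_parity.
- have := bvec_step charp n_gt0 i; case: (periodic_word w i) => e; congr (_, _) => //.
    by have := congr1 snd F0.
  by have := congr1 snd V0.
Qed.

Lemma bicycle_b_chain : chain true (dual_seq (periodic_word w)) bicycle_b.
Proof.
have [F0 V0] : frob (0 : Mtilde2 k p w) = 0 /\ vers (0 : Mtilde2 k p w) = 0.
  by rewrite (frob0 hT) (vers0 hT).
apply: (@eq_chain _ _ _ (periodic_word (dual w))) => [i|]; first by rewrite periodic_word_dual.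
move=> i; split.
- by rewrite mem_vspace_prod /= mem0v bvec_parity ?size_dual //= negbK.
- by rewrite mem_vspace_prod mem0v bvec_parity ?size_dual //= !negbK.
- have := bvec_step charp n_gt0' i; case: (periodic_word _ i) => e; congr (_, _) => //.
    by have := congr1 fst F0.
  by have := congr1 fst V0.
Qed.

Lemma bicycle_periodic : periodic n bicycle_a /\ periodic n bicycle_b.
Proof.
split=> i; first by rewrite /bicycle_a cycle_index_periodic.
by rewrite /bicycle_b -[X in (i + X)%N](size_dual w) cycle_index_periodic.
Qed.

Lemma bicycle_pairing i j :
  [/\ pairing (bicycle_a i) (bicycle_b j) = (i == j %[mod n])%:R,
      pairing (bicycle_a i) (bicycle_a j) = 0 & pairing (bicycle_b i) (bicycle_b j) = 0].
Proof.
split; rewrite Mtilde2_pairingE; last first.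
- by rewrite big1 // => l _; rewrite /= !mxE mul0r mulr0 subrr.
- by rewrite big1 // => l _; rewrite /= !mxE mul0r mulr0 subrr.
rewrite (bigD1 (cycle_index n_gt0 i)) //= big1 => [|l li].
  rewrite !mxE !eqxx mul0r subr0 mul1r addr0 -(inj_eq val_inj) /= size_map.
  by [].
by rewrite !mxE (negbTE li) andbF mul0r mul0r subr0.
Qed.

End BicycleChains.

Section UnicycleChains.

Variables (k : closedFieldType) (p : nat).
Hypothesis charp : p \in [pchar k].
Variables (w : word) (l : nat) (c : k).
Local Notation n := (size w).
Hypotheses (n_gt0 : (0 < n)%N) (nE : n = l.*2).

Definition unicycle_a (i : nat) : Mtilde1 p c w := bvec k (cycle_index n_gt0 i).

Lemma unicycle_a_chain : chain false (periodic_word w) unicycle_a.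
Proof.
have n_even : odd n = false by rewrite nE odd_double.
move=> i; split; first exact: bvec_parity.
  by apply: bvec_parity.
exact: bvec_step.
Qed.

Lemma unicycle_periodic : periodic n unicycle_a.
Proof. by move=> i; rewrite /unicycle_a cycle_index_periodic. Qed.

Lemma unicycle_pairing i j : pairing (unicycle_a i) (unicycle_a j) =
  if j == i + l %[mod n] then c ^+ (p ^ (i %% n)) else 0.
Proof.
have n2 : n./2 = l by rewrite nE doubleK.
rewrite /= (bigD1 (cycle_index n_gt0 i)) //= [X in _ + X]big1 ?addr0 => [|a ai]; last first.
  by rewrite big1 // => b _; rewrite bvecE (negbTE ai) mulr0 mul0r.
rewrite n2 modnDml; case: ifP => e.
  rewrite (bigD1 (cycle_index n_gt0 j)) /= ?modn_mod ?(eqP e) //= big1 ?addr0 => [|b /andP [_ bj]].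
    by rewrite !bvecE !eqxx !mulr1.
  by rewrite !bvecE (negbTE bj) mulr0.
rewrite big1 // => b eb; rewrite [X in _ * X]bvecE.
have [bj | _] := eqVneq b; last by rewrite mulr0.
by move: eb; rewrite bj /= modn_mod e.
Qed.

End UnicycleChains.

Section CycleMultiplicity.

Variables (k : closedFieldType) (p : nat).
Hypotheses (charp : p \in [pchar k]) (p_gt2 : (2 < p)%N).
Let p_prime : prime p := pcharf_prime charp.
Variables (w : word) (u : nat -> letter).
Local Notation n := (size w).
Hypothesis n_gt0 : (0 < n)%N.

(** The coordinates outside [J] never contribute, so Gram matrices are sums of #|J| matrices of rank
    at most one; the vectors [e] and [f] attain this bound. *)
Lemma multiplicity_of_coordinates (T : ufv_module k) (I : finType) (J : pred I)
    (X Y : I -> T -> k) (e f : I -> T) :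
    pointed T ->
    (forall x y : T, pairing x y = \sum_i X i x * Y i y) ->
    (forall i x y, chain_start false u x -> chain_start true (dual_seq u) y ->
       ~~ J i -> X i x * Y i y = 0) ->
    (forall i, J i -> chain_start false u (e i) /\ chain_start true (dual_seq u) (f i)) ->
    (forall i j, pairing (e i) (f j) = (i == j)%:R) ->
  multiplicity T u #|J|.
Proof.
move=> pT pE XY0 ef pef; split=> //.
  move=> m x y xs ys.
  have -> : \matrix_(i, j) pairing (x i) (y j) =
      \matrix_(i, j) (\sum_(a | J a) X a (x i) * Y a (y j)).
    apply/matrixP => i j; rewrite !mxE pE (bigID J) /= [X in _ + X]big1 ?addr0 // => a Ja.
    exact: XY0.
  exact: (mxrank_sum_outer J (fun a i => X a (x i)) (fun a j => Y a (y j))).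
exists (fun i => e (enum_val i)), (fun i => f (enum_val i)); split=> [i|i|i j].
- by have [] := ef _ (enum_valP i).
- by have [] := ef _ (enum_valP i).
by rewrite pef (inj_eq enum_val_inj).
Qed.

Lemma unitary_pointed (T : ufv_module k) : is_unitary_BT1 p T -> pointed T.
Proof.
move=> hT; have symp := unitary_symplectic hT.
by split=> [||x|x]; rewrite ?(frob0 hT) ?(vers0 hT) ?(form0l symp) ?(form0r symp).
Qed.

Section Bicycle.

Hypothesis n_even : odd n = false.

Definition bicycle_word (b : bool) : nat -> letter :=
  if b then dual_seq (periodic_word w) else periodic_word w.

(** The pair (false, i) stands for a_i and (true, i) for b_i. These have degree 0 for i even and i
    odd respectively, whence the condition [odd x.2 = x.1]. *)
Lemma Mtilde2_multiplicity (J : pred (bool * 'I_n)) :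
    (forall x : bool * 'I_n, reflect (odd x.2 = x.1 /\ shift x.2 (bicycle_word x.1) =1 u) (J x)) ->
  multiplicity (Mtilde2 k p w) u #|J|.
Proof.
move=> JP; have hT := Mtilde2_unitary charp n_even.
pose sz : n = size (dual w) := esym (size_map dual_letter w).
pose cd (j : 'I_n) := cast_ord sz j.
pose X (i : bool * 'I_n) (x : Mtilde2 k p w) : k :=
  if i.1 then - (x.2 : 'rV[k]_(size (dual w))) 0 (cd i.2) else (x.1 : 'rV[k]_n) 0 i.2.
pose Y (i : bool * 'I_n) (x : Mtilde2 k p w) : k :=
  if i.1 then (x.1 : 'rV[k]_n) 0 i.2 else (x.2 : 'rV[k]_(size (dual w))) 0 (cd i.2).
have n_gt0' : (0 < size (dual w))%N by rewrite -sz.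
have cdE (i : 'I_n) : cd i = cycle_index n_gt0' i.
  by apply/val_inj; rewrite /= -sz modn_small.
have idE (i : 'I_n) : i = cycle_index n_gt0 i by apply/val_inj; rewrite /= modn_small.
(* The sign makes the system dual: the pairing of b_i with a_i is -1. *)
pose e (i : bool * 'I_n) : Mtilde2 k p w :=
  if i.1 then (-1) *: bicycle_b k p n_gt0 i.2 else bicycle_a k p n_gt0 i.2.
pose f (i : bool * 'I_n) : Mtilde2 k p w :=
  if i.1 then bicycle_a k p n_gt0 i.2 else bicycle_b k p n_gt0 i.2.
have above1 g v (x : Mtilde2 k p w) (i : 'I_n) : chain_start g v x -> (x.1 : 'rV[k]_n) 0 i != 0 ->
    lex_above v (shift i (periodic_word w)) /\ odd i = g.
  move=> [a a0 ca] xi; split.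
    apply: (@Mbar_chain_coord _ _ charp w n_gt0 v (fun l => (a l).1)); last by rewrite a0 -idE.
    by move=> l; have [_ _] := ca l; case: (v l) => ->.
  have [] := ca 0; rewrite a0 mem_vspace_prod => /andP [/mem_parity_span h _] _ _.
  by apply/eqP; apply: contraNT xi => oi; rewrite h //= addbF.
have above2 g v (x : Mtilde2 k p w) (i : 'I_n) : chain_start g v x ->
    (x.2 : 'rV[k]_(size (dual w))) 0 (cd i) != 0 ->
    lex_above v (shift i (dual_seq (periodic_word w))) /\ odd i = ~~ g.
  move=> [a a0 ca] xi; split.
    have : lex_above v (shift i (periodic_word (dual w))).
      apply: (@Mbar_chain_coord _ _ charp (dual w) n_gt0' v (fun l => (a l).2)); last by rewrite a0 -cdE.
      by move=> l; have [_ _] := ca l; case: (v l) => ->.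
    move=> ab m h1 h2; apply: (ab m) => [l lm | ]; rewrite /shift periodic_word_dual //.
    exact: h1.
  have [] := ca 0; rewrite a0 mem_vspace_prod => /andP [_ /mem_parity_span h] _ _.
  by apply/eqP; apply: contraNT xi => oi; rewrite h //= addbF.
apply: (multiplicity_of_coordinates (X := X) (Y := Y) (e := e) (f := f)).
- exact: unitary_pointed.
- move=> x y; rewrite Mtilde2_pairingE -(pair_bigA _ (fun b j => X (b, j) x * Y (b, j) y)).
  rewrite big_bool /= addrC -big_split; apply: eq_bigr => i _ /=.
  by rewrite /X /Y /= mulNr.
(* If both coordinates are nonzero, [Mbar_chain_coord] bounds [u] by the word read at this position
   and the dual of [u] by the dual of that word. *)
- move=> [b i] x y xs ys; apply: contraNeq; rewrite mulf_eq0 negb_or => /andP [].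
  rewrite /X /Y /=; case: b => xi yi; apply/JP => /=.
    rewrite oppr_eq0 in xi; have [ab oi] := above2 _ _ _ _ xs xi; have [ab' _] := above1 _ _ _ _ ys yi.
    split=> // l; apply/esym; apply: lex_above_dual_eq l => //.
    by apply: lex_above_ext ab' => // l; rewrite /dual_seq /shift dual_letterK.
  have [ab oi] := above1 _ _ _ _ xs xi; have [ab' _] := above2 _ _ _ _ ys yi.
  by split=> // l; apply/esym; apply: lex_above_dual_eq l.
- have ca (i : 'I_n) := chain_shift i (bicycle_a_chain charp n_gt0 n_even).
  have cb (i : 'I_n) := chain_shift i (bicycle_b_chain charp n_gt0 n_even).
  have start0 g v (a : nat -> Mtilde2 k p w) (i : nat) : chain g v (shift i a) -> chain_start g v (a i).
    by move=> h; exists (shift i a); rewrite // /shift addn0.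
  move=> [[] i] /JP [] /= oi ui; split.
  + exists (fun l => (-1) ^+ (p ^ l) *: shift i (bicycle_b k p n_gt0) l).
      by rewrite expn0 expr1 /shift addn0.
    by apply: (chainZ hT); apply: eq_chain ui _; have := cb i; rewrite oi.
  + apply: start0; have := ca i; rewrite oi; apply: eq_chain => l.
    by rewrite /dual_seq -ui /shift /= /dual_seq dual_letterK.
  + by apply: start0; have := ca i; rewrite oi; apply: eq_chain.
  + apply: start0; have := cb i; rewrite oi; apply: eq_chain => l.
    by rewrite /dual_seq -ui.
- have symp := unitary_symplectic hT.
  have modE (i j : 'I_n) : (i == j %[mod n]) = (i == j) by rewrite !modn_small.
  pose A := bicycle_a k p n_gt0; pose B := bicycle_b k p n_gt0.
  move=> [b i] [b' j]; have [ab aa bb] := bicycle_pairing k p n_gt0 i j.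
  have [ab' _ _] := bicycle_pairing k p n_gt0 j i; rewrite xpair_eqE.
  case: b b' => -[].
  + rewrite -[LHS]/(pairing ((-1) *: B i) (A j)) (formZl symp) (formC symp) ab' modE.
    by rewrite mulN1r opprK eq_sym.
  + by rewrite -[LHS]/(pairing ((-1) *: B i) (B j)) (formZl symp) bb mulr0.
  + by rewrite -[LHS]/(pairing (A i) (A j)) aa.
  + by rewrite -[LHS]/(pairing (A i) (B j)) ab modE.
Qed.

End Bicycle.

Lemma Mtilde1_multiplicity (l : nat) (c : k) (J : pred 'I_n) :
    n = l.*2 -> odd l ->
    (forall i, periodic_word w (i + l) = dual_letter (periodic_word w i)) ->
    c != 0 -> c ^+ (p ^ l) = - c ->
    (forall i : 'I_n, reflect (~~ odd i /\ shift i (periodic_word w) =1 u) (J i)) ->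
  multiplicity (Mtilde1 p c w) u #|J|.
Proof.
move=> nE l_odd anti c0 cl JP; have hT := Mtilde1_unitary charp p_gt2 nE l_odd anti c0 cl.
have n_even : odd n = false by rewrite nE odd_double.
pose half (i : 'I_n) := cycle_index n_gt0 (i + l).
have idE (i : 'I_n) : i = cycle_index n_gt0 i by apply/val_inj; rewrite /= modn_small.
pose A := unicycle_a p c n_gt0; have symp := unitary_symplectic hT.
have cA : chain false (periodic_word w) A := unicycle_a_chain charp c n_gt0 nE.
pose X (i : 'I_n) (x : Mtilde1 p c w) : k := c ^+ (p ^ i) * (x : 'rV[k]_n) 0 i.
pose Y (i : 'I_n) (x : Mtilde1 p c w) : k := (x : 'rV[k]_n) 0 (half i).
pose t (i : 'I_n) := (c ^+ (p ^ i))^-1.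
have above g v (x : Mtilde1 p c w) (i : 'I_n) : chain_start g v x -> (x : 'rV[k]_n) 0 i != 0 ->
    lex_above v (shift i (periodic_word w)) /\ odd i = g.
  move=> [a a0 ca] xi; split.
    apply: (@Mbar_chain_coord _ _ charp w n_gt0 v a); last by rewrite a0 -idE.
    by move=> j; have [_ _] := ca j; case: (v j) => ->.
  have [] := ca 0; rewrite a0 => /mem_parity_span h _ _.
  by apply/eqP; apply: contraNT xi => oi; rewrite h //= addbF.
apply: (multiplicity_of_coordinates (X := X) (Y := Y) (e := A) (f := fun i => t i *: A (i + l)%N)).
- exact: unitary_pointed.
- move=> x y; rewrite (Mtilde1_pairingE nE); apply: eq_bigr => i _.
  by congr (_ * (y : 'rV[k]_n) 0 _); apply/val_inj.
- move=> i x y xs ys; apply: contraNeq; rewrite mulf_eq0 negb_or => /andP [].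
  rewrite mulf_eq0 negb_or => /andP [_ xi] yi; apply/JP.
  (* The coordinate of [y] sits half a turn further, where by antiperiodicity the dual word is
     read. *)
  have [ab oi] := above _ _ _ _ xs xi; have [ab' _] := above _ _ _ _ ys yi.
  rewrite oi; split=> // j; apply/esym; apply: lex_above_dual_eq j => //.
  apply: lex_above_ext ab' => // j; rewrite /dual_seq /shift /=.
  have pw := @periodic_word_periodic w; have := shift_periodic j pw.
  by move/(periodic_mod (i + l)); rewrite /shift ![(j + _)%N]addnC addnAC anti.
- move=> i /JP [oi ui]; split.
    by exists (shift i A) => [|]; [rewrite /shift addn0 | apply: eq_chain ui _; have := chain_shift i cA; rewrite (negbTE oi)].
  exists (fun j => t i ^+ (p ^ j) *: shift (i + l) A j); first by rewrite expn0 expr1 /shift addn0.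
  apply: (chainZ hT); have := chain_shift (i + l) cA; rewrite oddD l_odd (negbTE oi).
  by apply: eq_chain => j; rewrite /shift addnAC anti /dual_seq -ui.
- move=> i j; rewrite (formZr symp) (unicycle_pairing p c n_gt0 nE) eqn_modDr.
  rewrite !modn_small // eq_sym -[(i == j :> nat)]/(i == j).
  have [-> | _] := eqVneq i j; last by rewrite mulr0.
  by rewrite mulVf // expf_neq0.
Qed.

End CycleMultiplicity.

(** * Uniqueness of the decomposition *)

Definition linked (v w : word) (b : bool) (i : nat) : Prop :=
  shift i (bicycle_word v b) =1 periodic_word w.

Lemma bicycle_word_dual v b l : (0 < size v)%N ->
  bicycle_word v b l = periodic_word (if b then dual v else v) l.
Proof. by case: b => //= v_gt0; rewrite periodic_word_dual. Qed.

Lemma bicycle_word_periodic v b : periodic (size v) (bicycle_word v b).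
Proof.
by case: b; [apply: dual_seq_periodic | ]; apply: periodic_word_periodic.
Qed.

Lemma linked_refl v : linked v v false 0.
Proof. by []. Qed.

Lemma linked_trans v w x b b' i i' :
  linked v w b i -> linked w x b' i' -> linked v x (b (+) b') (i + i').
Proof.
move=> vw wx l; rewrite -wx /shift -addnA.
by case: b b' vw wx => -[] vw wx /=; rewrite /dual_seq -?vw /shift /= /dual_seq ?dual_letterK.
Qed.

Lemma linked_sym v w b i : ~~ odd (size v) -> (0 < size v)%N ->
  linked v w b i -> exists2 i', odd i' = odd i & linked w v b i'.
Proof.
(* The inverse shift is [i * size v - i], a representative of -i; even length preserves the
   parity. *)
move=> v_even v_gt0 vw; have le : (i <= i * size v)%N by rewrite leq_pmulr.
exists (i * size v - i)%N; first by rewrite oddB // oddM (negbTE v_even) andbF.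
move=> l; have e : shift (i * size v - i) (periodic_word w) l = bicycle_word v b l.
  rewrite /shift -vw /shift addnA subnKC // addnC.
  by rewrite periodic_mul //; apply: bicycle_word_periodic.
by case: b e {vw} => //=; rewrite /shift /dual_seq => ->; rewrite dual_letterK.
Qed.

Lemma linked_iter_tau v i : linked v (iter i tau v) false i.
Proof. by move=> l; rewrite periodic_word_iter_tau. Qed.

Lemma linked_dual v : (0 < size v)%N -> linked v (dual v) true 0.
Proof. by move=> v_gt0 l; rewrite periodic_word_dual. Qed.

Lemma linkedE v w b i : (0 < size v)%N -> size v = size w -> linked v w b i ->
  w = iter i tau (if b then dual v else v).
Proof.
move=> v_gt0 sz vw; apply: periodic_word_inj.
  by rewrite size_iter_tau; case: (b); rewrite ?size_dual.
by move=> l; rewrite periodic_word_iter_tau -vw /shift bicycle_word_dual.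
Qed.

Definition odd_periodic (u : nat -> letter) : Prop := exists2 m, odd m & periodic m u.

Definition antiperiodic (u : nat -> letter) : Prop :=
  exists m, forall i, u (i + m)%N = dual_letter (u i).

Lemma linked_odd_periodic v w b i :
  linked v w b i -> odd_periodic (periodic_word v) -> odd_periodic (periodic_word w).
Proof.
move=> vw [m m_odd pm]; exists m => // l; rewrite -!vw /shift addnA.
by case: (b); rewrite /= /dual_seq pm.
Qed.

Lemma linked_antiperiod v w b i m : linked v w b i ->
  (forall l, periodic_word v (l + m) = dual_letter (periodic_word v l)) ->
  forall l, periodic_word w (l + m) = dual_letter (periodic_word w l).
Proof.
by move=> vw pm l; rewrite -!vw /shift addnA; case: (b); rewrite /= /dual_seq pm.
Qed.

Lemma linked_antiperiodic v w b i :
  linked v w b i -> antiperiodic (periodic_word v) -> antiperiodic (periodic_word w).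
Proof. by move=> vw [m pm]; exists m; apply: linked_antiperiod vw pm. Qed.

Lemma linked_odd_antiperiodic v w b i :
  linked v w b i -> odd_antiperiodic (periodic_word v) -> odd_antiperiodic (periodic_word w).
Proof. by move=> vw [m m_odd pm]; exists m => //; apply: linked_antiperiod vw pm. Qed.

Lemma primitive_even_primitive w : primitive w -> ~~ odd (size w) -> even_primitive w.
Proof.
by move=> pw w_even; split=> //; [apply: primitive_gt0 | move=> z n _; case: pw => _; apply].
Qed.

Lemma periodic_word_square z : periodic_word (z ++ z) =1 periodic_word z.
Proof. by move=> l; rewrite -power2 periodic_word_power. Qed.

Lemma primitive_not_odd_periodic w : primitive w -> ~~ odd (size w) -> ~ odd_periodic (periodic_word w).
Proof.
move=> pw w_even [m m_odd pm]; have /dvdnP [a aE] := primitive_period pw pm.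
by move: m_odd; rewrite aE oddM (negbTE w_even) andbF.
Qed.

Lemma in_W1_even w : in_W1 w -> ~~ odd (size w).
Proof. by case=> _ _ [y -> _]; rewrite size_cat size_dual addnn odd_double. Qed.

Lemma in_W3_even w : in_W3 w -> ~~ odd (size w).
Proof. by case=> _ _ [y -> _]; rewrite size_cat size_dual addnn odd_double. Qed.

Lemma in_W1_odd_antiperiodic w : in_W1 w -> odd_antiperiodic (periodic_word w).
Proof.
case=> _ _ [y -> y_odd]; exists (size y) => // i.
by apply: antiperiodic_cat_dual; apply: odd_gt0.
Qed.

Lemma in_W2_not_antiperiodic w : in_W2 w -> ~ antiperiodic (periodic_word w).
Proof. by case=> pw nsd _ ap; apply: nsd; apply/self_dualP => //; apply: primitive_gt0. Qed.

Lemma odd_antiperiodicW u : odd_antiperiodic u -> antiperiodic u.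
Proof. by case=> m _ um; exists m. Qed.

Lemma in_W3_antiperiodic w : in_W3 w -> antiperiodic (periodic_word w).
Proof. by case=> pw sd _; apply/self_dualP => //; apply: primitive_gt0. Qed.

Lemma in_W3_antiperiod_even w m : in_W3 w ->
  (forall i, periodic_word w (i + m) = dual_letter (periodic_word w i)) -> ~~ odd m.
Proof.
case=> pw _ [y wE y_even] mE; have [a a_odd aE] := primitive_antiperiod pw mE.
have -> : m = (a * size y)%N.
  by apply: double_inj; rewrite aE wE size_cat size_dual addnn doubleMr.
by rewrite oddM negb_and y_even orbT.
Qed.

Lemma in_W3_not_odd_antiperiodic w : in_W3 w -> ~ odd_antiperiodic (periodic_word w).
Proof. by move=> w3 [m m_odd mE]; have := in_W3_antiperiod_even w3 mE; rewrite m_odd. Qed.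

Lemma in_W4_odd_periodic w : in_W4 w -> odd_periodic (periodic_word w).
Proof.
case=> z [-> _ z_odd]; exists (size z) => // i.
by rewrite !periodic_word_square periodic_word_periodic.
Qed.

Lemma in_W4_not_odd_antiperiodic w : in_W4 w -> ~ odd_antiperiodic (periodic_word w).
Proof.
case=> z [-> pz z_odd] [m m_odd mE].
have mE' i : periodic_word z (i + m) = dual_letter (periodic_word z i).
  have zE j : periodic_word z j = periodic_word (z ++ z) j by rewrite periodic_word_square.
  by rewrite !zE.
have [a a_odd aE] := primitive_antiperiod pz mE'.
by have := congr1 odd aE; rewrite odd_double oddM a_odd z_odd.
Qed.

(** If zz = y^m with y even, the length of y is a period of z, hence an even multiple a of the odd
    length of z. Then m * a = 2 with a even leaves no room for m > 1. *)
Lemma in_W4_even_primitive w : in_W4 w -> even_primitive w.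
Proof.
case=> z [-> pz z_odd]; have z_gt0 := primitive_gt0 pz.
split; rewrite ?size_cat ?addn_gt0 ?z_gt0 ?addnn ?odd_double // => y m y_even m_gt1 e.
have szE : (m * size y = (size z).*2)%N by rewrite -size_power -e size_cat addnn.
have y_gt0 : (0 < size y)%N.
  by rewrite lt0n; apply: contraL z_gt0 => /eqP y0; move: szE; rewrite y0 muln0; lia.
have : periodic (size y) (periodic_word z).
  move=> i; rewrite -(periodic_word_square z i) -(periodic_word_square z (i + _)) e.
  by rewrite !periodic_word_power ?(ltnW m_gt1) // periodic_word_periodic.
case/(primitive_period pz)/dvdnP => a aE; move: y_even; rewrite aE oddM z_odd andbT => a_even.
have : (m * a = 2)%N.
  apply/eqP; rewrite -(eqn_pmul2r z_gt0) -mulnA -aE szE mul2n.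
  by [].
by case: a a_even {aE} => [|[|a]] //= _; [rewrite muln0 | move: m_gt1; nia].
Qed.

Lemma in_W1_even_primitive w : in_W1 w -> even_primitive w.
Proof. by move=> w1; apply: primitive_even_primitive (in_W1_even w1); case: w1. Qed.

Lemma W234_even_primitive w : [\/ in_W2 w, in_W3 w | in_W4 w] -> even_primitive w.
Proof.
case=> [[pw _ w_even] | w3 | ]; last exact: in_W4_even_primitive.
  exact: primitive_even_primitive.
by apply: primitive_even_primitive (in_W3_even w3); case: w3.
Qed.

Lemma W234_not_odd_antiperiodic w : [\/ in_W2 w, in_W3 w | in_W4 w] ->
  ~ odd_antiperiodic (periodic_word w).
Proof.
case; [ | exact: in_W3_not_odd_antiperiodic | exact: in_W4_not_odd_antiperiodic].
by move=> w2 /odd_antiperiodicW; apply: in_W2_not_antiperiodic.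
Qed.

(** Each length is a period of the other word, and periods of a primitive word are multiples of its
    length. *)
Lemma linked_primitive_size v w b i : primitive v -> primitive w -> ~~ odd (size v) ->
  linked v w b i -> size v = size w.
Proof.
move=> pv pw v_even vw; have [i' _ wv] := linked_sym v_even (primitive_gt0 pv) vw.
apply/eqP; rewrite eqn_dvd; apply/andP; split; apply: primitive_period => // l.
  by rewrite -!wv /shift addnA bicycle_word_periodic.
by rewrite -!vw /shift addnA bicycle_word_periodic.
Qed.

Lemma linked_square_size y z b i : primitive y -> primitive z ->
  linked (y ++ y) (z ++ z) b i -> size (y ++ y) = size (z ++ z).
Proof.
move=> py pz yz; have yy_gt0 : (0 < size (y ++ y))%N by rewrite size_cat addn_gt0 primitive_gt0.
have yy_even : ~~ odd (size (y ++ y)) by rewrite size_cat addnn odd_double.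
have [i' _ zy] := linked_sym yy_even yy_gt0 yz; rewrite !size_cat.
have bw (x : word) c l : bicycle_word (x ++ x) c l = bicycle_word x c l.
  by case: c; rewrite /= /dual_seq periodic_word_square.
suff -> : size y = size z by [].
apply/eqP; rewrite eqn_dvd; apply/andP; split; apply: primitive_period => // l.
  by rewrite -(periodic_word_square y l) -(periodic_word_square y (l + _)) -!zy /shift addnA !bw bicycle_word_periodic.
by rewrite -(periodic_word_square z l) -(periodic_word_square z (l + _)) -!yz /shift addnA !bw bicycle_word_periodic.
Qed.

(** * Orbits of words in terms of shifts *)

Definition balanced (v : word) : Prop := (0 < size v)%N /\ ~~ odd (size v).

Lemma clos_orbit (gen rel : word -> word -> Prop) :
    (forall v w, gen v w -> size w = size v /\ (balanced v -> rel v w)) ->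
    (forall v, rel v v) -> (forall v w, balanced v -> rel v w -> rel w v) ->
    (forall v w x, rel v w -> rel w x -> rel v x) ->
  forall v w, clos_refl_sym_trans _ gen v w -> size w = size v /\ (balanced v -> rel v w).
Proof.
move=> gen_rel rel_refl rel_sym rel_trans v w.
elim=> {v w} [v w /gen_rel // | v // | v w _ [sz vw] | v w x _ [sz vw] _ [sz' wx]].
  by split=> // gw; apply: rel_sym; [| apply: vw]; rewrite /balanced -sz.
split=> [|gv]; first by rewrite sz'.
by apply: rel_trans (vw gv) _; apply: wx; rewrite /balanced sz.
Qed.

Definition even_linked v w := exists2 i, ~~ odd i & linked v w false i.

(** Within a bicycle the positions of degree 0 are the even ones of the word and the odd ones of its
    dual; hence dualisation goes with the parity of the shift. *)
Definition graded_linked v w := exists i, linked v w (odd i) i.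

Lemma even_linked_trans v w x : even_linked v w -> even_linked w x -> even_linked v x.
Proof.
move=> [i i_even vw] [j j_even wx]; exists (i + j)%N; last exact: linked_trans vw wx.
by rewrite oddD (negbTE i_even).
Qed.

Lemma graded_linked_trans v w x : graded_linked v w -> graded_linked w x -> graded_linked v x.
Proof.
by move=> [i vw] [j wx]; exists (i + j)%N; rewrite oddD; apply: linked_trans vw wx.
Qed.

Lemma even_linked_sym v w : balanced v -> even_linked v w -> even_linked w v.
Proof.
move=> [v_gt0 v_even] [i i_even vw]; have [j ij wv] := linked_sym v_even v_gt0 vw.
by exists j; rewrite ?ij.
Qed.

Lemma graded_linked_sym v w : balanced v -> graded_linked v w -> graded_linked w v.
Proof.
move=> [v_gt0 v_even] [i vw]; have [j ij wv] := linked_sym v_even v_gt0 vw.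
by exists j; rewrite ij.
Qed.

Lemma dual_tau v : dual (tau v) = tau (dual v).
Proof. by rewrite /dual /tau map_rotr. Qed.

Lemma even_primitive_balanced v : even_primitive v -> balanced v.
Proof. by case. Qed.

Lemma clos_iter_tau2 (gen : word -> word -> Prop) v i :
  (forall w, gen w (tau (tau w))) -> ~~ odd i -> clos_refl_sym_trans _ gen v (iter i tau v).
Proof.
move=> gen_tau2 i_even; rewrite -[i]odd_double_half (negbTE i_even) add0n.
elim: (i./2) => [|m IHm]; first exact: rst_refl.
by apply: rst_trans IHm _; apply: rst_step; rewrite doubleS.
Qed.

Lemma orbit1P v w : in_W1 v -> in_W1 w -> orbit1 v w <-> even_linked v w.
Proof.
move=> v1 w1; have bv := even_primitive_balanced (in_W1_even_primitive v1); split=> [vw|].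
  have [|x|_ h] := @clos_orbit _ even_linked _ _ even_linked_sym even_linked_trans _ _ vw.
  - move=> x y ->; rewrite !size_tau; split=> // _; exists 2 => //.
    exact: (linked_iter_tau x 2).
  - by exists 0.
  exact: h.
move=> [i i_even vw]; have sz : size v = size w.
  by apply: linked_primitive_size vw; [case: v1 | case: w1 | apply: in_W1_even].
by rewrite (linkedE _ sz vw); [apply: clos_iter_tau2 | case: bv].
Qed.

Lemma orbit2P v w : in_W2 v -> in_W2 w -> orbit2 v w <-> graded_linked v w.
Proof.
move=> v2 w2; have bv : balanced v by apply/even_primitive_balanced/W234_even_primitive; constructor 1.
split=> [vw|].
  have [|x|_ h] := @clos_orbit _ graded_linked _ _ graded_linked_sym graded_linked_trans _ _ vw.
  - move=> x y [] ->; rewrite ?size_dual !size_tau; split=> // -[x_gt0 x_even].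
      by exists 2; apply: (linked_iter_tau x 2).
    exists 1; apply: (linked_trans (b := false) (i := 1) (i' := 0) (linked_iter_tau x 1)).
    by apply: linked_dual; rewrite size_tau.
  - by exists 0.
  exact: h.
move=> [i vw]; have sz : size v = size w.
  by apply: linked_primitive_size vw; [case: v2 | case: w2 | case: v2].
rewrite (linkedE _ sz vw); last by case: bv.
case: ifP => i_odd; last by apply: clos_iter_tau2; rewrite ?i_odd // => x; left.
case: i i_odd {vw} => // i /= i_even; rewrite -iterS iterSr -dual_tau.
apply: (@rst_trans _ _ _ (dual (tau v))); first by apply: rst_step; right.
by apply: clos_iter_tau2 => // x; left.
Qed.

(** The antiperiods of such a word are even, so they supply a dualisation without changing the
    parity of the shift. Conversely self-duality expresses [dual] as a power of [tau]. *)
Lemma orbit3P v w : in_W3 v -> in_W3 w -> orbit3 v w <-> graded_linked v w.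
Proof.
move=> v3 w3; have bv : balanced v by apply/even_primitive_balanced/W234_even_primitive; constructor 2.
have [v_gt0 v_even] := bv; split=> [vw|].
  have [||||_ /(_ bv) [i {}vw]] := @clos_orbit _ (fun x y => exists i, linked x y false i) _ _ _ _ v w vw.
  - move=> x y ->; rewrite size_tau; split=> // _; exists 1.
    exact: (linked_iter_tau x 1).
  - by move=> x; exists 0.
  - by move=> x y [x_gt0 x_even] [i xy]; have [j _ yx] := linked_sym x_even x_gt0 xy; exists j.
  - by move=> x y z [i xy] [j yz]; exists (i + j)%N; apply: linked_trans xy yz.
  case i_odd: (odd i); last by exists i; rewrite i_odd.
  have [m mE] := in_W3_antiperiodic v3; have m_even := in_W3_antiperiod_even v3 mE.
  have vv : linked v v true m.
    by move=> l; rewrite /shift /= /dual_seq addnC mE dual_letterK.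
  exists (m + i)%N; rewrite oddD i_odd (negbTE m_even); exact: linked_trans vv vw.
move=> [i vw]; have sz : size v = size w.
  by apply: linked_primitive_size vw; [case: v3 | case: w3 | ].
have tau_orbit x j : orbit3 x (iter j tau x).
  elim: j => [|j IHj]; first exact: rst_refl.
  by apply: rst_trans IHj _; apply: rst_step.
rewrite (linkedE v_gt0 sz vw); case: ifP => _; last exact: tau_orbit.
case: v3 => _ [m ->] _; rewrite -iterD; exact: tau_orbit.
Qed.

(** The odd period of zz changes the parity of the shift without changing the word, so shifting and
    dualising become independent. *)
Lemma orbit4P v w : in_W4 v -> in_W4 w -> orbit4 v w <-> graded_linked v w.
Proof.
move=> v4 w4; have bv : balanced v by apply/even_primitive_balanced/W234_even_primitive; constructor 3.
have [v_gt0 v_even] := bv; split=> [vw|].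
  have [||||_ /(_ bv) [b [i {}vw]]] := @clos_orbit _ (fun x y => exists b i, linked x y b i) _ _ _ _ v w vw.
  - move=> x y [] ->; rewrite ?size_tau ?size_dual; split=> // -[x_gt0 _].
      by exists false, 1; apply: (linked_iter_tau x 1).
    by exists true, 0; apply: linked_dual.
  - by move=> x; exists false, 0.
  - by move=> x y [x_gt0 x_even] [b [i xy]]; have [j _ yx] := linked_sym x_even x_gt0 xy; exists b, j.
  - by move=> x y z [b [i xy]] [b' [j yz]]; exists (b (+) b'), (i + j)%N; apply: linked_trans xy yz.
  have [ib | nib] := eqVneq (odd i) b; first by exists i; rewrite ib.
  have [m m_odd mP] := in_W4_odd_periodic v4.
  have vv : linked v v false m by move=> l; rewrite /shift /= addnC mP.
  exists (m + i)%N; rewrite oddD m_odd; have := linked_trans vv vw.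
  by case: (odd i) b nib {vw} => -[].
move=> [i vw]; have sz : size v = size w.
  case: v4 w4 vw => y [-> py _] [z [-> pz _]] yz.
  exact: linked_square_size yz.
have tau_orbit x j : orbit4 x (iter j tau x).
  elim: j => [|j IHj]; first exact: rst_refl.
  by apply: rst_trans IHj _; apply: rst_step; left.
rewrite (linkedE v_gt0 sz vw); case: ifP => _; last exact: tau_orbit.
apply: (@rst_trans _ _ _ (dual v)); last exact: tau_orbit.
by apply: rst_step; right.
Qed.

(** Decidable form of [linked]: the product of the lengths is a common period. *)
Definition agree (v w : word) (b : bool) (i : nat) : bool :=
  all (fun l => shift i (bicycle_word v b) l == periodic_word w l) (iota 0 (size v * size w)).

Lemma agreeP v w b i : (0 < size v)%N -> (0 < size w)%N ->
  reflect (linked v w b i) (agree v w b i).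
Proof.
move=> v_gt0 w_gt0; apply: (iffP allP) => [ag | lk l _]; last by rewrite lk.
apply: (@eq_periodic _ (size v * size w)).
- by rewrite muln_gt0 v_gt0.
- by rewrite mulnC; apply/periodic_mul/shift_periodic/bicycle_word_periodic.
- exact/periodic_mul/periodic_word_periodic.
- by move=> l lt; apply/eqP/ag; rewrite mem_iota.
Qed.

Definition mult1_set (v w : word) : pred 'I_(size v) :=
  fun i => ~~ odd i && agree v w false i.

Definition mult2_set (v w : word) : pred (bool * 'I_(size v)) :=
  fun x => (odd x.2 == x.1) && agree v w x.1 x.2.

Arguments mult1_set : clear implicits.
Arguments mult2_set : clear implicits.

Lemma linked_mod v w b i : linked v w b (i %% size v) <-> linked v w b i.
Proof.
have e l : shift (i %% size v) (bicycle_word v b) l = shift i (bicycle_word v b) l.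
  have pb := shift_periodic l (@bicycle_word_periodic v b).
  by have := periodic_mod i pb; rewrite /shift ![(l + _)%N]addnC.
by split=> h l; rewrite -h e.
Qed.

Lemma card_le1_eq (T : finType) (A : pred T) : (forall x y, A x -> A y -> x = y) -> (#|A| <= 1)%N.
Proof. by move=> A1; apply/card_le1P => x xA y; apply/idP/eqP => [yA | ->]; [apply: A1|]. Qed.

(** By separation, a word is read off at no more than one even position of a unicycle. *)
Lemma mult1_card v w : in_W1 v -> (0 < size w)%N ->
  exists2 b : bool, #|mult1_set v w| = b & (b <-> even_linked v w).
Proof.
move=> v1 w_gt0; have ev := in_W1_even_primitive v1; have [v_gt0 v_even] := even_primitive_balanced ev.
have le1 : (#|mult1_set v w| <= 1)%N.
  apply: card_le1_eq => i j /andP [i_even /(agreeP _ _ v_gt0 w_gt0) vi].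
  case/andP=> [j_even /(agreeP _ _ v_gt0 w_gt0) vj].
  apply/val_inj/(even_primitive_separated ev); rewrite ?ltn_ord //.
    by rewrite (negbTE i_even) (negbTE j_even).
  by move=> l; have := vi l; rewrite -vj.
exists (0 < #|mult1_set v w|)%N; first by case: #|_| le1 => [|[]].
split=> [/card_gt0P [i /andP [i_even /(agreeP _ _ v_gt0 w_gt0) vi]] | [i i_even vi]].
  by exists i.
apply/card_gt0P; exists (cycle_index v_gt0 i); apply/andP; split; first by rewrite /= odd_mod ?(negbTE v_even).
by apply/(agreeP _ _ v_gt0 w_gt0)/linked_mod.
Qed.

(** Two positions with equal flags contradict separation; with different flags they would give an
    odd antiperiod, which these three classes exclude. *)
Lemma mult2_card v w : [\/ in_W2 v, in_W3 v | in_W4 v] -> (0 < size w)%N ->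
  exists2 b : bool, #|mult2_set v w| = b & (b <-> graded_linked v w).
Proof.
move=> v234 w_gt0; have ev := W234_even_primitive v234; have [v_gt0 v_even] := even_primitive_balanced ev.
have nd := not_odd_antiperiodic_shift (@periodic_word_periodic v) v_even v_gt0 (W234_not_odd_antiperiodic v234).
have le1 : (#|mult2_set v w| <= 1)%N.
  apply: card_le1_eq => -[b i] [b' j] /andP [/eqP /= ib /(agreeP _ _ v_gt0 w_gt0) vi].
  case/andP=> [/eqP /= jb /(agreeP _ _ v_gt0 w_gt0) vj].
  have vij l : shift i (bicycle_word v b) l = shift j (bicycle_word v b') l by rewrite vi vj.
  have [bb | nbb] := eqVneq b b'.
    rewrite -bb; congr (_, _); apply/val_inj/(even_primitive_separated ev); rewrite ?ltn_ord //.
      by rewrite ib jb.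
    move=> l; have := vij l; rewrite -bb; case: (b) => //=.
    by rewrite /shift /dual_seq => /(can_inj dual_letterK).
  case: (nd i j); first by rewrite ib jb.
  move=> l; have := vij l; case: b b' nbb {ib jb vi vj vij} => -[] //= _; rewrite /shift /dual_seq.
  by move=> <-; rewrite dual_letterK.
exists (0 < #|mult2_set v w|)%N; first by case: #|_| le1 => [|[]].
split=> [/card_gt0P [[b i] /andP [/eqP /= <- /(agreeP _ _ v_gt0 w_gt0) vi]] | [i vi]].
  by exists i.
apply/card_gt0P; exists (odd i, cycle_index v_gt0 i); apply/andP; split.
  by rewrite /= odd_mod ?(negbTE v_even).
by apply/(agreeP _ _ v_gt0 w_gt0)/linked_mod.
Qed.

(** * Isomorphisms between cycles in the same orbit, and regrouping of sums *)

Section CycleIsomorphisms.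

Variables (k : closedFieldType) (p : nat).
Hypotheses (charp : p \in [pchar k]) (p_gt2 : (2 < p)%N).

Lemma embedding_iso_dim (T N : ufv_module k) (psi : {linear T -> N}) :
    is_unitary_BT1 p T -> is_unitary_BT1 p N -> unitary_embedding psi ->
    \dim {:T} = \dim {:N} ->
  unitary_iso T N.
Proof.
move=> hT hN emb dimTN; apply: (embedding_iso emb); last first.
- by move=> x; apply: (grad_disjoint hN).
- exact: (grad_split hT false).
have ker0 : lker (linfun psi) == 0%VS.
  by apply/lker0P => x y; rewrite !lfunE; apply: (embedding_inj hT hN emb).
have im1 : limg (linfun psi) = fullv.
  by apply/eqP; rewrite eqEdim subvf /= -dimTN limg_dim_eq // (eqP ker0) capv0.
exists ((linfun psi)^-1)%VF => x; first by rewrite -[psi x](lfunE psi) lker0_lfunK.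
by rewrite -[LHS](lfunE psi) limg_lfunVK // im1 memvf.
Qed.

Variable c : word -> k.
Hypothesis hc : unicycle_const p c.

(** The shifted basis chain runs along w, but its pairing is a power of [c v]. It is rescaled to
    [c w] by [normalized_chain] before being straightened. *)
Lemma Mtilde1_iso v w : in_W1 v -> in_W1 w -> even_linked v w ->
  unitary_iso (Mtilde1 p (c w) w) (Mtilde1 p (c v) v).
Proof.
move=> v1 w1 [i i_even vw].
have [v_gt0 v_even] := even_primitive_balanced (in_W1_even_primitive v1).
have sz : size v = size w by apply: linked_primitive_size vw; [case: v1 | case: w1 | ].
have [l [vE l_odd antiv cv0 cvl]] := in_W1_half hc v1.
have [l' [wE l'_odd antiw cw0 cwl]] := in_W1_half hc w1.
have ll : l' = l by apply: double_inj; rewrite -vE -wE sz.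
rewrite {l'}ll in wE l'_odd antiw cwl *.
have hv := Mtilde1_in_W1_unitary charp p_gt2 hc v1; have hw := Mtilde1_in_W1_unitary charp p_gt2 hc w1.
pose a := shift i (unicycle_a p (c v) v_gt0).
have ha : closed_along l (periodic_word w) a.
  split; last by rewrite -vE; apply/shift_periodic/unicycle_periodic.
  have := chain_shift i (unicycle_a_chain charp (c v) v_gt0 vE).
  by rewrite (negbTE i_even) => ca; apply: eq_chain vw ca.
have aa : pairing (a 0) (a l) != 0.
  by rewrite /a /shift addn0 (unicycle_pairing _ _ _ vE) eqxx expf_neq0.
have [d [cd pd] dd] := normalized_chain charp hv l_odd antiw cw0 cwl ha aa.
rewrite -wE in pd; have w_gt0 : (0 < size w)%N by rewrite -sz.
have w_even : odd (size w) = false by rewrite wE odd_double.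
have [d' [cd' pd' dd']] := exact_self_chain charp p_gt2 hv w_gt0 w_even
  (@periodic_word_periodic w) (even_primitive_separated (in_W1_even_primitive w1))
  wE l_odd antiw cw0 cwl cd pd dd.
have [psi emb] := Mtilde1_embedding charp wE l_odd hv cd' pd' dd'.
by apply: (embedding_iso_dim hw hv emb); rewrite !dimvf /dim /= sz.
Qed.

Lemma Mtilde2_iso v w : balanced v -> size v = size w -> graded_linked v w ->
  unitary_iso (Mtilde2 k p w) (Mtilde2 k p v).
Proof.
move=> [v_gt0 /negbTE v_even] sz [i vw].
have w_gt0 : (0 < size w)%N by rewrite -sz.
have w_even : odd (size w) = false by rewrite -sz.
have hv := Mtilde2_unitary charp v_even; have hw := Mtilde2_unitary charp w_even.
have symp := unitary_symplectic hv.
have ca := chain_shift i (bicycle_a_chain charp v_gt0 v_even).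
have cb := chain_shift i (bicycle_b_chain charp v_gt0 v_even).
have [pa pb] := bicycle_periodic k p v_gt0.
have {}pa := shift_periodic i pa; have {}pb := shift_periodic i pb.
have modE j j' : (i + j == i + j' %[mod size v]) = (j == j' %[mod size w]).
  by rewrite -sz eqn_modDl.
suff [psi emb] : exists psi : {linear Mtilde2 k p w -> Mtilde2 k p v}, unitary_embedding psi.
  by apply: (embedding_iso_dim hw hv emb); rewrite !dimvf /dim /= !size_dual sz.
case i_odd: (odd i) vw ca cb => vw; rewrite [_ (+) _]/= [true (+) _]/= => ca cb; last first.
  apply: (@Mtilde2_embedding _ _ charp _ _ hv (shift i (bicycle_a k p v_gt0))
    (shift i (bicycle_b k p v_gt0)) w_gt0); rewrite -?sz //.
  - exact: eq_chain vw ca.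
  - by apply: eq_chain cb => j; rewrite /dual_seq -vw.
  - by move=> j j'; have [-> _ _] := bicycle_pairing k p v_gt0 (i + j) (i + j'); rewrite modE -sz.
  - by move=> j j'; have [_ ? ?] := bicycle_pairing k p v_gt0 (i + j) (i + j').
(* For an odd shift the two cycles change places, and the sign restores the value 1 of their
   pairing. *)
pose b' j := (-1) ^+ (p ^ j) *: shift i (bicycle_a k p v_gt0) j.
have N1 j : (-1) ^+ (p ^ j) = -1 :> k by rewrite frob_powerN // expr1n.
apply: (@Mtilde2_embedding _ _ charp _ _ hv (shift i (bicycle_b k p v_gt0)) b' w_gt0); rewrite -?sz //.
- exact: eq_chain vw cb.
- apply: (chainZ hv); apply: eq_chain ca => j.
  by rewrite /dual_seq -vw /shift /= /dual_seq dual_letterK.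
- by move=> j; rewrite /b' pa !N1.
- move=> j j'; rewrite /b' N1 (formZr symp) (formC symp).
  have [-> _ _] := bicycle_pairing k p v_gt0 (i + j') (i + j).
  by rewrite modE -sz mulN1r opprK eq_sym.
move=> j j'; have [_ aa bb] := bicycle_pairing k p v_gt0 (i + j) (i + j').
by split=> //; rewrite /b' !N1 (formZl symp) (formZr symp) aa !mulr0.
Qed.

Lemma W234_iso v w : [\/ in_W2 v /\ in_W2 w, in_W3 v /\ in_W3 w | in_W4 v /\ in_W4 w] ->
  graded_linked v w -> unitary_iso (Mtilde2 k p w) (Mtilde2 k p v).
Proof.
move=> h vw; have bv : balanced v.
  by apply/even_primitive_balanced/W234_even_primitive; case: h => -[]; [constructor 1 | constructor 2 | constructor 3].
apply: (Mtilde2_iso bv) => //; case: (vw) => i vwi; case: h => -[].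
- by move=> [pv _ ev] [pw _ _]; apply: linked_primitive_size vwi.
- by move=> v3 w3; apply: linked_primitive_size vwi; [case: v3 | case: w3 | apply: in_W3_even].
by move=> [y [vE py _]] [z [wE pz _]]; rewrite vE wE in vwi *; apply: linked_square_size vwi.
Qed.

Lemma big_sum_rem (T : word -> ufv_module k) (W : seq word) w : w \in W ->
  unitary_iso (\big[@ufv_sum k/ufv_zero k]_(v <- W) T v)
    (ufv_sum (T w) (\big[@ufv_sum k/ufv_zero k]_(v <- rem w W) T v)).
Proof.
elim: W => // v W IHW; rewrite inE /=; have [-> _ | _ /= wW] := eqVneq w v.
  by rewrite big_cons; apply: unitary_iso_refl.
rewrite !big_cons; apply: unitary_iso_trans (ufv_sum_swap _ _ _).
by apply: ufv_sum_iso; [apply: unitary_iso_refl | apply: IHW].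
Qed.

Lemma big_sum_perm (T : word -> ufv_module k) (W W' : seq word) : perm_eq W W' ->
  unitary_iso (\big[@ufv_sum k/ufv_zero k]_(v <- W) T v) (\big[@ufv_sum k/ufv_zero k]_(v <- W') T v).
Proof.
elim: W W' => [|w W IHW] W' eqW.
  by move: eqW; rewrite perm_sym => /perm_nilP ->; apply: unitary_iso_refl.
have wW' : w \in W' by rewrite -(perm_mem eqW) mem_head.
apply: unitary_iso_trans (unitary_iso_sym (big_sum_rem T wW')); rewrite big_cons.
apply: ufv_sum_iso; first exact: unitary_iso_refl.
by apply: IHW; rewrite -(perm_cons w) (perm_trans eqW) // perm_to_rem.
Qed.

Lemma big_sum_mset_eq (T : word -> ufv_module k) (P : word -> Prop) (R : word -> word -> Prop) W W' :
    {in W, forall w, P w} -> {in W', forall w, P w} ->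
    (forall v w, P v -> P w -> R v w -> unitary_iso (T w) (T v)) -> mset_eq_up_to R W W' ->
  unitary_iso (\big[@ufv_sum k/ufv_zero k]_(v <- W) T v) (\big[@ufv_sum k/ufv_zero k]_(v <- W') T v).
Proof.
move=> PW PW' RT [W'' eqW RW]; apply: unitary_iso_trans (unitary_iso_sym (big_sum_perm T eqW)).
have {eqW W' PW'} PW'' : {in W'', forall w, P w} by move=> w; rewrite -(perm_mem eqW) => /PW'.
elim: RW PW PW'' => [|v w V U vw _ IH] PW PW''; first by rewrite !big_nil; apply: unitary_iso_refl.
rewrite !big_cons; apply: ufv_sum_iso.
  by apply/unitary_iso_sym/RT => //; [apply: PW | apply: PW'']; apply: mem_head.
by apply: IH => u uU; [apply: PW | apply: PW'']; rewrite inE uU orbT.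
Qed.

End CycleIsomorphisms.

(** Matching one element at a time: the first word of [W] has a related word in [W'], and removing
    both lowers every count by the same amount. *)
Lemma mset_eq_of_counts (P : word -> Prop) (e : word -> word -> bool)
    (rel R : word -> word -> Prop) W W' :
    {in W, forall w, P w} -> {in W', forall w, P w} ->
    (forall v w, P v -> P w -> e w v <-> rel v w) ->
    (forall v, rel v v) -> (forall v w, P v -> rel v w -> rel w v) ->
    (forall v w x, rel v w -> rel w x -> rel v x) ->
    (forall v w, P v -> P w -> R v w <-> rel v w) ->
    (forall w, P w -> count (e w) W = count (e w) W') ->
  mset_eq_up_to R W W'.
Proof.
move=> PW PW' eP rel_refl rel_sym rel_trans RP.
have e_refl w : P w -> e w w by move=> Pw; apply/(eP w w Pw Pw).
have e_congr u v w : P u -> P v -> P w -> e u v -> e w u = e w v.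
  move=> Pu Pv Pw /(eP v u Pv Pu) vu; apply/idP/idP.
    by move/(eP u w Pu Pw) => uw; apply/(eP v w Pv Pw)/(rel_trans _ _ _ vu uw).
  move/(eP v w Pv Pw) => vw; apply/(eP u w Pu Pw).
  exact: rel_trans (rel_sym _ _ Pv vu) vw.
elim: W W' PW PW' => [|w W IHW] W' PW PW' cnt.
  exists [::]; last by constructor.
  case: W' PW' cnt => // w W' PW' cnt; have Pw := PW' w (mem_head _ _).
  by have /= := cnt w Pw; rewrite e_refl.
have Pw := PW w (mem_head _ _).
have : has (e w) W' by rewrite has_count -cnt //= e_refl.
case/hasP => v vW' wv; have Pv := PW' v vW'.
have PrW' : {in rem v W', forall u, P u} by move=> u /mem_rem /PW'.
have PW1 : {in W, forall u, P u} by move=> u uW; apply: PW; rewrite inE uW orbT.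
have [u Pu|W'' eqW RW] := IHW _ PW1 PrW' _.
  have := cnt u Pu; rewrite (permP (perm_to_rem vW')) /= (e_congr w v u) // => /eqP.
  by rewrite eqn_add2l => /eqP.
exists (v :: W''); last first.
  by constructor => //; apply/(RP _ _ Pw Pv)/(rel_sym _ _ Pv)/(eP v w Pv Pw).
by rewrite (perm_trans (perm_to_rem vW')) // perm_cons.
Qed.

(** * Recovering the multisets from the multiplicities *)

Section Uniqueness.

Variables (k : closedFieldType) (p : nat).
Hypotheses (charp : p \in [pchar k]) (p_gt2 : (2 < p)%N).
Variable c : word -> k.
Hypothesis hc : unicycle_const p c.

Definition related1 (w v : word) : bool := (0 < #|mult1_set v w|)%N.
Definition related2 (w v : word) : bool := (0 < #|mult2_set v w|)%N.

Lemma related1P w v : in_W1 v -> (0 < size w)%N -> related1 w v <-> even_linked v w.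
Proof. by move=> v1 w_gt0; have [b + vw] := mult1_card v1 w_gt0; rewrite /related1 => ->; rewrite lt0b. Qed.

Lemma related2P w v : [\/ in_W2 v, in_W3 v | in_W4 v] -> (0 < size w)%N ->
  related2 w v <-> graded_linked v w.
Proof. by move=> v1 w_gt0; have [b + vw] := mult2_card v1 w_gt0; rewrite /related2 => ->; rewrite lt0b. Qed.

Lemma sum_mult1 (W : seq word) w : {in W, forall v, in_W1 v} -> (0 < size w)%N ->
  (\sum_(v <- W) #|mult1_set v w| = count (related1 w) W)%N.
Proof.
move=> W1 w_gt0; rewrite -sum1_count [RHS]big_mkcond; apply: eq_big_seq => v /W1 v1.
by have [b + _] := mult1_card v1 w_gt0; rewrite /related1 => ->; case: b.
Qed.

Lemma sum_mult2 (W : seq word) w : {in W, forall v, [\/ in_W2 v, in_W3 v | in_W4 v]} ->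
  (0 < size w)%N -> (\sum_(v <- W) #|mult2_set v w| = count (related2 w) W)%N.
Proof.
move=> W1 w_gt0; rewrite -sum1_count [RHS]big_mkcond; apply: eq_big_seq => v /W1 v1.
by have [b + _] := mult2_card v1 w_gt0; rewrite /related2 => ->; case: b.
Qed.

Lemma cycle_sum_multiplicity W1 W2 W3 W4 w : cycle_multisets W1 W2 W3 W4 -> (0 < size w)%N ->
  multiplicity (cycle_sum p c W1 W2 W3 W4) (periodic_word w)
    (count (related1 w) W1 + (count (related2 w) W2 + (count (related2 w) W3 + count (related2 w) W4))).
Proof.
move=> [m1 m2 m3 m4] w_gt0.
have m2' : {in W2, forall v, [\/ in_W2 v, in_W3 v | in_W4 v]} by move=> v /m2; constructor 1.
have m3' : {in W3, forall v, [\/ in_W2 v, in_W3 v | in_W4 v]} by move=> v /m3; constructor 2.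
have m4' : {in W4, forall v, [\/ in_W2 v, in_W3 v | in_W4 v]} by move=> v /m4; constructor 3.
rewrite -sum_mult1 // -!sum_mult2 //.
have T2 v : [\/ in_W2 v, in_W3 v | in_W4 v] ->
    multiplicity (Mtilde2 k p v) (periodic_word w) #|mult2_set v w|.
  move=> v234; have [v_even v_gt0] := W234_even v234.
  apply: (Mtilde2_multiplicity charp v_gt0 v_even) => -[b i] /=.
  by apply: (iffP andP) => -[/eqP e /(agreeP _ _ v_gt0 w_gt0) vw].
do !apply: multiplicity_sum; apply: multiplicity_big => v vW; try (apply: T2; auto).
have v1 := m1 v vW; have [v_gt0 v_even] := even_primitive_balanced (in_W1_even_primitive v1).
have [l [vE l_odd anti cv0 cvl]] := in_W1_half hc v1.
apply: (Mtilde1_multiplicity charp p_gt2 v_gt0 vE l_odd anti cv0 cvl) => i.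
by apply: (iffP andP) => -[e /(agreeP false i v_gt0 w_gt0) vw].
Qed.

Lemma graded_linked_iff (Inv : word -> Prop) v w :
    (forall v w b i, linked v w b i -> Inv v -> Inv w) -> balanced v ->
  graded_linked v w -> Inv v <-> Inv w.
Proof.
move=> Inv_linked [v_gt0 v_even] [i vw]; split; first exact: Inv_linked vw.
by have [j _ wv] := linked_sym v_even v_gt0 vw; apply: Inv_linked wv.
Qed.

Lemma class_invariants v w : balanced v -> graded_linked v w ->
  [/\ odd_antiperiodic (periodic_word v) <-> odd_antiperiodic (periodic_word w),
      antiperiodic (periodic_word v) <-> antiperiodic (periodic_word w)
    & odd_periodic (periodic_word v) <-> odd_periodic (periodic_word w)].
Proof.
move=> bv vw; split; apply: (graded_linked_iff (Inv := fun x => _ (periodic_word x)) _ bv vw).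
- exact: linked_odd_antiperiodic.
- exact: linked_antiperiodic.
- exact: linked_odd_periodic.
Qed.

Lemma related1_W234 v w : in_W1 v -> [\/ in_W2 w, in_W3 w | in_W4 w] -> related1 w v = false.
Proof.
move=> v1 w234; apply/negP => /(related1P v1 (proj2 (W234_even w234))) [i _ vw].
apply: (W234_not_odd_antiperiodic w234); apply: linked_odd_antiperiodic vw _.
exact: in_W1_odd_antiperiodic.
Qed.

Lemma count_none (e : pred word) W : {in W, forall v, e v = false} -> count e W = 0%N.
Proof. by move=> eW; apply/eqP; rewrite eqn0Ngt -has_count; apply/hasPn => v /eW ->. Qed.

Lemma in_W2_not_odd_periodic w : in_W2 w -> ~ odd_periodic (periodic_word w).
Proof. by case=> pw _ w_even; apply: primitive_not_odd_periodic. Qed.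

Lemma in_W3_not_odd_periodic w : in_W3 w -> ~ odd_periodic (periodic_word w).
Proof. by move=> w3; apply: primitive_not_odd_periodic (in_W3_even w3); case: w3. Qed.

(** Only the multiset of the class of w contributes. Odd antiperiodicity separates the first class
    from the others, odd periodicity the fourth from the second and third, and antiperiodicity the
    second from the third. *)
Lemma count_total W1 W2 W3 W4 w : cycle_multisets W1 W2 W3 W4 ->
  let total := (count (related1 w) W1 +
    (count (related2 w) W2 + (count (related2 w) W3 + count (related2 w) W4)))%N in
  [/\ in_W1 w -> total = count (related1 w) W1, in_W2 w -> total = count (related2 w) W2,
      in_W3 w -> total = count (related2 w) W3 & in_W4 w -> total = count (related2 w) W4].
Proof.
move=> [m1 m2 m3 m4] total.
have m2' v : v \in W2 -> [\/ in_W2 v, in_W3 v | in_W4 v] by move=> /m2; constructor 1.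
have m3' v : v \in W3 -> [\/ in_W2 v, in_W3 v | in_W4 v] by move=> /m3; constructor 2.
have m4' v : v \in W4 -> [\/ in_W2 v, in_W3 v | in_W4 v] by move=> /m4; constructor 3.
have none (Inv : (nat -> letter) -> Prop) W : (0 < size w)%N ->
    (forall x y, graded_linked x y -> balanced x -> Inv (periodic_word x) <-> Inv (periodic_word y)) ->
    (forall v, v \in W -> [\/ in_W2 v, in_W3 v | in_W4 v]) ->
    (forall v, v \in W -> ~ (Inv (periodic_word v) <-> Inv (periodic_word w))) ->
    count (related2 w) W = 0%N.
  move=> w_gt0 inv W234 ninv; apply: count_none => v vW; apply/negP.
  move/(related2P (W234 v vW) w_gt0)/inv => h; apply: (ninv v vW); apply: h.
  exact/even_primitive_balanced/W234_even_primitive/W234.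
have oa x y (xy : graded_linked x y) (bx : balanced x) := let: And3 h _ _ := class_invariants bx xy in h.
have ap x y (xy : graded_linked x y) (bx : balanced x) := let: And3 _ h _ := class_invariants bx xy in h.
have op x y (xy : graded_linked x y) (bx : balanced x) := let: And3 _ _ h := class_invariants bx xy in h.
have c1 : [\/ in_W2 w, in_W3 w | in_W4 w] -> count (related1 w) W1 = 0%N.
  by move=> w234; apply: count_none => v /m1 v1; apply: related1_W234.
rewrite /total; split=> [w1 | w2 | w3 | w4].
- have w_gt0 : (0 < size w)%N by case: w1 => /primitive_gt0.
  have noa v : [\/ in_W2 v, in_W3 v | in_W4 v] ->
      ~ (odd_antiperiodic (periodic_word v) <-> odd_antiperiodic (periodic_word w)).
    by move=> v234 inv; apply/(W234_not_odd_antiperiodic v234)/inv/in_W1_odd_antiperiodic.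
  by rewrite (none _ W2 w_gt0 oa) ?(none _ W3 w_gt0 oa) ?(none _ W4 w_gt0 oa) ?addn0 // => v vW; apply: noa; auto.
- have w_gt0 : (0 < size w)%N by case: w2 => /primitive_gt0.
  rewrite c1; last by constructor 1.
  rewrite (none _ W3 w_gt0 ap) ?(none _ W4 w_gt0 op) ?addn0 // => v vW inv.
    exact/(in_W2_not_odd_periodic w2)/inv/in_W4_odd_periodic/m4.
  exact/(in_W2_not_antiperiodic w2)/inv/in_W3_antiperiodic/m3.
- have w_gt0 : (0 < size w)%N by case: w3 => /primitive_gt0.
  rewrite c1; last by constructor 2.
  rewrite (none _ W2 w_gt0 ap) ?(none _ W4 w_gt0 op) ?addn0 // => v vW inv.
    exact/(in_W3_not_odd_periodic w3)/inv/in_W4_odd_periodic/m4.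
  exact/(in_W2_not_antiperiodic (m2 v vW))/inv/in_W3_antiperiodic.
have w_gt0 : (0 < size w)%N by case: (in_W4_even_primitive w4).
rewrite c1; last by constructor 3.
rewrite (none _ W2 w_gt0 op) ?(none _ W3 w_gt0 op) // => v vW inv.
  exact/(in_W3_not_odd_periodic (m3 v vW))/inv/in_W4_odd_periodic.
exact/(in_W2_not_odd_periodic (m2 v vW))/inv/in_W4_odd_periodic.
Qed.

Lemma mset_eq_of_related2 (R : word -> word -> Prop) (P : word -> Prop) W W' :
    (forall w, P w -> [\/ in_W2 w, in_W3 w | in_W4 w]) ->
    (forall v w, P v -> P w -> R v w <-> graded_linked v w) ->
    {in W, forall w, P w} -> {in W', forall w, P w} ->
    (forall w, P w -> count (related2 w) W = count (related2 w) W') ->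
  mset_eq_up_to R W W'.
Proof.
move=> P234 RP PW PW'; have bal w : P w -> balanced w.
  by move/P234/W234_even_primitive/even_primitive_balanced.
apply: (mset_eq_of_counts PW PW' _ _ _ graded_linked_trans RP) => [v w Pv Pw | v | v w Pv].
- by apply: related2P; [apply: P234 | case: (bal w Pw)].
- by exists 0; apply: linked_refl.
exact/graded_linked_sym/bal.
Qed.

Lemma mset_eq_of_related1 W W' : {in W, forall w, in_W1 w} -> {in W', forall w, in_W1 w} ->
  (forall w, in_W1 w -> count (related1 w) W = count (related1 w) W') -> mset_eq_up_to orbit1 W W'.
Proof.
move=> PW PW'; have bal w : in_W1 w -> balanced w.
  by move/in_W1_even_primitive/even_primitive_balanced.
apply: (mset_eq_of_counts PW PW' _ _ _ even_linked_trans orbit1P) => [v w Pv Pw | v | v w Pv].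
- by apply: related1P => //; case: (bal w Pw).
- by exists 0.
exact/even_linked_sym/bal.
Qed.

(** An isomorphism preserves the multiplicity of every periodic word, and evaluated at a word of one
    class it counts the members of that word's orbit in the corresponding multiset. *)
Lemma cycle_sum_iso_iff W1 W2 W3 W4 V1 V2 V3 V4 :
    cycle_multisets W1 W2 W3 W4 -> cycle_multisets V1 V2 V3 V4 ->
  unitary_iso (cycle_sum p c W1 W2 W3 W4) (cycle_sum p c V1 V2 V3 V4) <->
  [/\ mset_eq_up_to orbit1 W1 V1, mset_eq_up_to orbit2 W2 V2,
      mset_eq_up_to orbit3 W3 V3 & mset_eq_up_to orbit4 W4 V4].
Proof.
move=> mW mV; have [w1 w2 w3 w4] := mW; have [v1 v2 v3 v4] := mV; split=> [iso | [o1 o2 o3 o4]].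
  have tot w : (0 < size w)%N -> _ :=
    fun w_gt0 => multiplicity_unique (multiplicity_iso iso (cycle_sum_multiplicity mW w_gt0))
      (cycle_sum_multiplicity mV w_gt0).
  split.
  - apply: mset_eq_of_related1 => // w ww; have [/(_ ww) <- _ _ _] := count_total w mW.
    have [/(_ ww) <- _ _ _] := count_total w mV; apply: tot.
    by case: ww => /primitive_gt0.
  - apply: (mset_eq_of_related2 (P := in_W2)) => //; [by constructor 1 | exact: orbit2P | move=> w ww].
    have [_ /(_ ww) <- _ _] := count_total w mW; have [_ /(_ ww) <- _ _] := count_total w mV.
    by apply: tot; case: ww => /primitive_gt0.
  - apply: (mset_eq_of_related2 (P := in_W3)) => //; [by constructor 2 | exact: orbit3P | move=> w ww].
    have [_ _ /(_ ww) <- _] := count_total w mW; have [_ _ /(_ ww) <- _] := count_total w mV.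
    by apply: tot; case: ww => /primitive_gt0.
  - apply: (mset_eq_of_related2 (P := in_W4)) => //; [by constructor 3 | exact: orbit4P | move=> w ww].
    have [_ _ _ /(_ ww) <-] := count_total w mW; have [_ _ _ /(_ ww) <-] := count_total w mV.
    by apply: tot; case: (in_W4_even_primitive ww).
apply: ufv_sum_iso.
  apply: (big_sum_mset_eq w1 v1 _ o1) => v w vP wP /(orbit1P vP wP); exact: Mtilde1_iso.
apply: ufv_sum_iso.
  apply: (big_sum_mset_eq w2 v2 _ o2) => v w vP wP /(orbit2P vP wP).
  by apply: (W234_iso charp); constructor 1.
apply: ufv_sum_iso.
  apply: (big_sum_mset_eq w3 v3 _ o3) => v w vP wP /(orbit3P vP wP).
  by apply: (W234_iso charp); constructor 2.
apply: (big_sum_mset_eq w4 v4 _ o4) => v w vP wP /(orbit4P vP wP).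
by apply: (W234_iso charp); constructor 3.
Qed.

End Uniqueness.

Unset Implicit Arguments.

Theorem theorem4p21 (k : closedFieldType) (p : nat)
  (charp : p \in [pchar k]) (p_gt2 : (2 < p)%N)
  (c : word -> k) (hc : unicycle_const p c)
  (M : ufv_module k) (hM : is_unitary_BT1 p M) :
  (exists W1 W2 W3 W4 : seq word,
      cycle_multisets W1 W2 W3 W4
      /\ unitary_iso M (cycle_sum p c W1 W2 W3 W4))
  /\ (forall W1 W2 W3 W4 : seq word,
      cycle_multisets W1 W2 W3 W4 ->
      unitary_iso M (cycle_sum p c W1 W2 W3 W4) ->
      forall W1' W2' W3' W4' : seq word,
      cycle_multisets W1' W2' W3' W4' ->
      (unitary_iso M (cycle_sum p c W1' W2' W3' W4')
       <-> [/\ mset_eq_up_to orbit1 W1 W1', mset_eq_up_to orbit2 W2 W2',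
               mset_eq_up_to orbit3 W3 W3' & mset_eq_up_to orbit4 W4 W4'])).
Proof.
split; first exact: unitary_decomposition.
move=> W1 W2 W3 W4 mW iMW W1' W2' W3' W4' mW'.
rewrite -(cycle_sum_iso_iff charp p_gt2 hc mW mW').
split; last exact: unitary_iso_trans.
exact: unitary_iso_trans (unitary_iso_sym iMW).
Qed.
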